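(* Let $\mathcal X$ be a finite state space, $\mathcal H:\mathcal X\to\mathbb R$, $Q$ a symmetric irreducible generator on $\mathcal X$, let $f,c$ satisfy the standing assumption described in the context, and let the penalty $\alpha$ be constant in time. Let $X^f_{1,\alpha,c}$ be the modified Metropolis-Hastings chain and $w$ the weight function. For $g\in\ell^2(\mu)$, as $t\to\infty$: (1) (Strong consistency) $$\frac{\int_0^t w(X^f_{1,\alpha,c}(s))\,g(X^f_{1,\alpha,c}(s))\,ds}{\int_0^t w(X^f_{1,\alpha,c}(s))\,ds}\longrightarrow \mu(g)\quad\text{almost surely.}$$ (2) (Central limit theorem) $$\sqrt t\left(\frac{\int_0^t w(X^f_{1,\alpha,c}(s))\,g(X^f_{1,\alpha,c}(s))\,ds}{\int_0^t w(X^f_{1,\alpha,c}(s))\,ds}-\mu(g)\right)\longrightarrow \frac{Z^f_{1,\alpha,c}}{Z^0}\,N\!\left(0,\mathrm{Var}_{\mu^f_{1,\alpha,c}}(wg)\right)\quad\text{in distribution,}$$ where the limiting variance is defined to be $$\mathrm{Var}_{\mu^f_{1,\alpha,c}}(wg):=\lim_{t\to\infty}\mathbb E_\mu\left(\frac{\int_0^t w(X^f_{1,\alpha,c}(s))\,g(X^f_{1,\alpha,c}(s))\,ds}{\int_0^t w(X^f_{1,\alpha,c}(s))\,ds}-\mu(g)\right)^2 .$$ In particular, when $f=0$ or $\alpha=0$, so that $w=1$, these reduce to the classical Markov chain law of large numbers and central limit theorem for the Metropolis-Hastings chain.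
   Context: Setting. $\mathcal X$ is a finite set, $\mathcal H:\mathcal X\to\mathbb R$, $\mathcal H_{\min}=\min_x\mathcal H(x)$, $\mathcal H_{\max}=\max_x\mathcal H(x)$, $\mu(x)\propto e^{-\mathcal H(x)}$ the target probability distribution, $\mu(g)=\sum_x g(x)\mu(x)$. $Q$ is a symmetric irreducible generator on $\mathcal X$ (the proposal chain). Standing assumption: $f:\mathbb R^+\to\mathbb R^+$ is differentiable, non-negative, non-decreasing with $f(0)=0$; $\mathcal H_{\min}\le c\le\mathcal H_{\max}$; $\alpha\ge0$. Landscape-modified Hamiltonian: $\mathcal H^f_{1,\alpha,c}(x)=\int_{\mathcal H_{\min}}^{\mathcal H(x)}\frac{1}{\alpha f((u-c)_+)+1}\,du$, where $y_+=\max\{y,0\}$. $\mu^f_{1,\alpha,c}(x)=e^{-\mathcal H^f_{1,\alpha,c}(x)}/Z^f_{1,\alpha,c}$ with $Z^f_{1,\alpha,c}=\sum_x e^{-\mathcal H^f_{1,\alpha,c}(x)}$, and $Z^0=\sum_x e^{-(\mathcal H(x)-\mathcal H_{\min})}$. $X^f_{1,\alpha,c}$ is the continuous-time Markov chain with generator $M^f_{1,\alpha,c}(x,y)=Q(x,y)e^{-(\mathcal H^f_{1,\alpha,c}(y)-\mathcal H^f_{1,\alpha,c}(x))_+}$ for $x\ne y$, $M^f_{1,\alpha,c}(x,x)=-\sum_{y\neq x}M^f_{1,\alpha,c}(x,y)$. Weight function: $w(x)=e^{-(\mathcal H(x)-\mathcal H_{\min})}/e^{-\mathcal H^f_{1,\alpha,c}(x)}$.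 $N(0,\sigma^2)$ denotes a Gaussian variable; $\frac{Z^f_{1,\alpha,c}}{Z^0}N(0,\sigma^2)$ is the law of the constant times such a variable. $\mathbb E_\mu$ denotes expectation with respect to $\mu$.
   Formalization: The displayed limiting variance is always 0, making the CLT false; it is replaced by v = lim E_μ[(t^{-1/2}∫_0^t w(g−μ(g))ds)²], and it is also proved that t times the mean squared error of the weighted average tends to (Z^f/Z^0)² v. *)

(* Defs.v *)
From HB Require Import structures.
From mathcomp Require Import all_boot all_order all_algebra.
From mathcomp Require Import all_classical all_reals all_analysis.

Set Implicit Arguments.
Unset Strict Implicit.
Unset Printing Implicit Defensive.

Import Order.TTheory GRing.Theory Num.Theory.
Import numFieldNormedType.Exports.

Local Open Scope classical_set_scope.
Local Open Scope ring_scope.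

Section Landscape.
Context {R : realType} {S : finType}.
Implicit Types (H K : S -> R) (Q M : S -> S -> R) (f : R -> R) (c alpha : R).

Definition pos_part (y : R) : R := Num.max y 0.

(* On a nonempty finite S these are the minimum and the maximum of H. *)
Definition Hmin H : R := inf (range H).
Definition Hmax H : R := sup (range H).

Definition gibbs K (x : S) : R := expR (- K x) / \sum_(y : S) expR (- K y).

Definition mean (mu g : S -> R) : R := \sum_(x : S) g x * mu x.

(* Only the values of f on [0, +oo[ are constrained; at 0 the derivative is
   one-sided. *)
Definition differentiable_nonneg f : Prop :=
  forall x, 0 <= x ->
    cvg ((f y - f x) / (y - x) @[y --> within [set y | 0 <= y] x^']).

Definition admissible f : Prop :=
  [/\ differentiable_nonneg f,
      forall x, 0 <= x -> 0 <= f x,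
      forall x y, 0 <= x -> x <= y -> f x <= f y &
      f 0 = 0].

Definition modified_H f alpha c H (x : S) : R :=
  \int[lebesgue_measure]_(u in `[Hmin H, H x])
    (alpha * f (pos_part (u - c)) + 1)^-1.

Definition Zmod f alpha c H : R :=
  \sum_(x : S) expR (- modified_H f alpha c H x).

Definition Z0 H : R := \sum_(x : S) expR (- (H x - Hmin H)).

Definition weight f alpha c H (x : S) : R :=
  expR (- (H x - Hmin H)) / expR (- modified_H f alpha c H x).

Definition is_generator Q : Prop :=
  (forall x y, x != y -> 0 <= Q x y) /\ (forall x, \sum_(y : S) Q x y = 0).

Definition is_symmetric Q : Prop := forall x y, Q x y = Q y x.

Definition is_irreducible Q : Prop :=
  forall x y, connect [rel u v | 0 < Q u v] x y.

Definition mh_rate Q K (x y : S) : R :=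
  Q x y * expR (- pos_part (K y - K x)).

Definition mh_generator Q K (x y : S) : R :=
  if x == y then - \sum_(z : S | z != x) mh_rate Q K x z else mh_rate Q K x y.

Fixpoint gen_pow M (n : nat) (x y : S) : R :=
  if n is m.+1 then \sum_(z : S) M x z * gen_pow M m z y else (x == y)%:R.

(* The (x, y) entry of the matrix exponential e^(tM). *)
Definition transition M (t : R) (x y : S) : R :=
  limn (series (fun n : nat => t ^+ n / n`!%:R * gen_pow M n x y)).

End Landscape.

Section Chains.
Context {R : realType} {S : finType}.

(* A right-continuous continuous-time Markov chain with generator M and
   initial law nu, given by its finite-dimensional distributions.  Only the
   times t >= 0 are meaningful. *)
Record is_markov_chain (d : measure_display) (T : measurableType d)
    (P : probability T R) (M : S -> S -> R) (nu : S -> R)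
    (X : R -> T -> S) : Prop := {
  chain_measurable : forall (t : R) (y : S), 0 <= t ->
    measurable [set w | X t w = y];
  chain_right_continuous : forall (w : T) (t : R), 0 <= t ->
    \forall s \near t^'+, X s w = X t w;
  chain_fdd : forall (n : nat) (t : nat -> R) (x : nat -> S),
    t 0%N = 0 -> (forall i j : nat, (i <= j)%N -> t i <= t j) ->
    P [set w | forall k : nat, (k <= n)%N -> X (t k) w = x k] =
      (nu (x 0%N) *
        \prod_(k < n) transition M (t k.+1 - t k) (x k) (x k.+1))%:E }.

Definition path_integral (T : Type) (X : R -> T -> S) (h : S -> R)
    (t : R) (w : T) : R :=
  \int[lebesgue_measure]_(s in `[0, t]) h (X s w).

Definition weighted_average (T : Type) (X : R -> T -> S) (wt g : S -> R)
    (t : R) (w : T) : R :=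
  path_integral X (fun x => wt x * g x) t w / path_integral X wt t w.

(* The normal law with mean 0 and variance v; the library's normal_prob is not
   the Dirac mass when its standard deviation is 0. *)
Definition gaussian (v : R) : set (measurableTypeR R) -> \bar R :=
  if v == 0 then \d_(0 : R) else normal_prob 0 (Num.sqrt v).

(* The law of a * Z when Z has the given law. *)
Definition scaled_law (a : R) (law : set (measurableTypeR R) -> \bar R) :
    set (measurableTypeR R) -> \bar R :=
  @pushforward _ _ (measurableTypeR R) (measurableTypeR R) R law
    (fun z : R => a * z).

Definition cvg_in_distribution (d : measure_display) (T : measurableType d)
    (P : probability T R) (Y : R -> T -> R)
    (law : set (measurableTypeR R) -> \bar R) : Prop :=
  forall h : R -> R, continuous h -> (exists C, forall x, `|h x| <= C) ->
    'E_P[fun w => h (Y t w)]%E @[t --> +oo%R] -->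
      (\int[law]_x (h x)%:E)%E.

Definition second_moment_cvg (d : measure_display) (T : measurableType d)
    (P : probability T R) (Y : R -> T -> R) (v : R) : Prop :=
  'E_P[fun w => (Y t w ^+ 2)%R]%E @[t --> +oo%R] --> v%:E.

End Chains.

(* Main.v *)
Require Import Defs.
From HB Require Import structures.
From mathcomp Require Import all_boot all_order all_algebra.
From mathcomp Require Import all_classical all_reals all_analysis.
From mathcomp Require Import measurable_realfun.
From mathcomp Require Import ring lra.

(* Let h = w (g - mu(g)), which is centred for the invariant law of the chain,
   and let A_t = int_0^t h(X_s) ds and B_t = int_0^t w(X_s) ds, so that the
   error of the weighted average is A_t / B_t.  Pick correctors with
   M chi = -h and M chi2 = v/2 - h chi, where v = 2 pi(h chi).  For a smooth
   test function phi the generator of (s, X_s, A_s) applied to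
   phi + chi phi' + chi2 phi'' equals d_s phi + (v/2) phi'' up to third order
   terms, so A behaves like a Brownian motion of variance v and Dynkin's
   formula quantifies this without any martingale theory:
   - exponential phi (with one corrector) bounds the exponential moments of
     A_t / sqrt t uniformly for large t; as E A_t^2 = O(t), the law of large
     numbers holds along the times n^2, hence along all times since A is
     Lipschitz;
   - phi = y^2 gives E A_t^2 = v t + O(sqrt t);
   - phi(s, y) = a Gaussian kernel run backwards along the heat flow bounds, for
     each b > 0, the distance between the densities of A_t / sqrt t + N(0, b)
     and N(0, v + b) by O(1 / sqrt t), uniformly in the space variable.
   Letting b tend to 0 and using tightness gives weak convergence.  Finally
   B_t / t converges to pi(w) = Z0 / Zmod in mean square, which transfers the
   limits from A_t / sqrt t to sqrt t (A_t / B_t). *)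

Set Implicit Arguments.
Unset Strict Implicit.
Unset Printing Implicit Defensive.

Import Order.TTheory GRing.Theory Num.Theory.
Import numFieldNormedType.Exports.

Local Open Scope classical_set_scope.
Local Open Scope ring_scope.

(** The chain is known only through its finite-dimensional laws and its right-continuous paths, so
    Dynkin's formula is proved on a time grid: a step of length r costs O(r^2), there are t/r steps,
    and right-endpoint Riemann sums converge to A_t along every path. This dictates the calculus
    used: a test function needs a second order expansion along lines of slope h(x), uniform on the
    cone |y| <= L s that contains A. Gaussian kernels stand in for characteristic functions. Their
    backward heat flow is explicit, since only the variance changes, and a density bound uniform in
    space can be integrated against a compactly supported function. Keeping b > 0 bounds their
    derivatives up to the terminal time. The correctors are bounded functions of the state, so the
    initial law contributes only vanishing terms. *)

Lemma Rintegral_cvg_bounded d (T : measurableType d) (R : realType)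
    (mu : {measure set T -> \bar R}) (D : set T) (Y_ : nat -> T -> R)
    (Y : T -> R) (C : R) :
  measurable D -> (mu D < +oo)%E ->
  (forall n, measurable_fun D (Y_ n)) ->
  (forall n w, D w -> `|Y_ n w| <= C) ->
  (forall w, D w -> Y_ n w @[n --> \oo] --> Y w) ->
  measurable_fun D Y /\
  \int[mu]_(w in D) Y_ n w @[n --> \oo] --> \int[mu]_(w in D) Y w.
Proof.
move=> mD muD mY bY YY.
have bounded_int (Z : T -> R) : measurable_fun D Z ->
    (forall w, D w -> `|Z w| <= C) -> mu.-integrable D (EFin \o Z).
  move=> mZ bZ; apply: measurable_bounded_integrable => //.
  exists C; split=> //; first exact: num_real.
  by move=> x Cx w Dw /=; apply: le_trans (bZ w Dw) (ltW Cx).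
have mE n : measurable_fun D (EFin \o Y_ n) by apply/measurable_EFinP.
have cE w : D w -> (EFin \o Y_ n) w @[n --> \oo] --> (EFin \o Y) w.
  by move=> Dw; apply: cvg_EFin; [apply: nearW|apply: YY].
have mYl : measurable_fun D Y by apply: (measurable_fun_cvg mY).
have bYl w : D w -> `|Y w| <= C.
  move=> Dw; apply: (cvgr_to_le (cvg_norm (YY w Dw))).
  by apply: nearW => n; apply: bY.
split=> //.
have mYE : measurable_fun D (EFin \o Y) by apply/measurable_EFinP.
have iC : mu.-integrable D (fun=> C%:E).
  apply: (@measurable_bounded_integrable _ _ _ _ (cst C)) => //.
  by exists `|C|; split=> [|x Cx w _]; [exact: num_real|exact: ltW].
have aeC : {ae mu, forall w n, D w -> (`|(EFin \o Y_ n) w| <= C%:E)%E}.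
  by apply: aeW => w n Dw /=; rewrite lee_fin bY.
have [_ _] := @dominated_convergence _ T R mu D mD
  (fun n => EFin \o Y_ n) (EFin \o Y) (fun=> C%:E) mE mYE (aeW _ cE) iC aeC.
have fY : (\int[mu]_(w in D) (Y w)%:E)%E \is a fin_num.
  exact: integrable_fin_num (bounded_int _ mYl bYl).
by rewrite -[X in _ --> X -> _](fineK fY) => /fine_cvg.
Qed.

(** * Bounded random variables *)

Section BoundedExpectation.
Context d (T : measurableType d) (R : realType) (P : probability T R).
Implicit Types Y Z : T -> R.

(** At a fixed time every random variable of the proof is bounded, the state space being finite.
    This class is stable under products and continuous maps, unlike integrability. *)
Definition bmf Y := measurable_fun setT Y /\ exists C, forall w, `|Y w| <= C.

Definition Ex Y : R := \int[P]_w Y w.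

Lemma bmf_bound Y C : measurable_fun setT Y -> (forall w, `|Y w| <= C) -> bmf Y.
Proof. by move=> mY bY; split=> //; exists C. Qed.

Lemma bmf_integrable Y : bmf Y -> P.-integrable setT (EFin \o Y).
Proof.
move=> [mY [C bC]]; apply: measurable_bounded_integrable => //.
  exact: fin_num_fun_lty (fin_num_measure P).
exists C; split=> //; first exact: num_real.
by move=> x Cx w _ /=; apply: le_trans (bC w) (ltW Cx).
Qed.

Lemma expectationE Y : bmf Y -> 'E_P[Y]%E = (Ex Y)%:E.
Proof.
move=> bY; rewrite unlock /Ex /Rintegral fineK//.
exact: integrable_fin_num (bmf_integrable bY).
Qed.

Lemma bmf_cst a : bmf (fun=> a).
Proof. by apply: (@bmf_bound _ `|a|). Qed.

Lemma bmfD Y Z : bmf Y -> bmf Z -> bmf (fun w => Y w + Z w).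
Proof.
move=> [mY [C bC]] [mZ [D bD]]; apply: (@bmf_bound _ (C + D)).
  exact: measurable_funD.
by move=> w; apply: le_trans (ler_normD _ _) (lerD (bC w) (bD w)).
Qed.

Lemma bmfM Y Z : bmf Y -> bmf Z -> bmf (fun w => Y w * Z w).
Proof.
move=> [mY [C bC]] [mZ [D bD]]; apply: (@bmf_bound _ (C * D)).
  exact: measurable_funM.
by move=> w; rewrite normrM ler_pM.
Qed.

Lemma bmfZ a Y : bmf Y -> bmf (fun w => a * Y w).
Proof. by apply: bmfM; apply: bmf_cst. Qed.

Lemma bmfN Y : bmf Y -> bmf (fun w => - Y w).
Proof. by move=> /(bmfZ (-1)); under eq_fun do rewrite mulN1r. Qed.

Lemma bmfB Y Z : bmf Y -> bmf Z -> bmf (fun w => Y w - Z w).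
Proof. by move=> bY /bmfN; apply: bmfD. Qed.

Lemma bmfX Y n : bmf Y -> bmf (fun w => Y w ^+ n).
Proof.
move=> bY; elim: n => [|n IH]; first exact: bmf_cst.
by under eq_fun do rewrite exprS; apply: bmfM.
Qed.

Lemma bmf_norm Y : bmf Y -> bmf (fun w => `|Y w|).
Proof.
move=> [mY [C bC]]; apply: (@bmf_bound _ C); first exact: measurableT_comp.
by move=> w; rewrite normr_id.
Qed.

Lemma bmf_continuous Y (f : R -> R) : continuous f -> bmf Y ->
  bmf (fun w => f (Y w)).
Proof.
move=> cf [mY [C bC]].
(* [f] need only be bounded on the compact range of [Y]. *)
have [|c _ fc] := @EVT_max R (fun x => `|f x|) (- `|C|) `|C| ltac:(by rewrite ge0_cp).
  by apply: continuous_subspaceT => x; apply: cvg_norm; apply: cf.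
apply: (@bmf_bound _ `|f c|).
  by apply: measurableT_comp mY; apply: continuous_measurable_fun.
move=> w; apply: fc; rewrite in_itv /= -ler_norml.
exact: le_trans (bC w) (ler_norm C).
Qed.

Lemma bmf_sum (I : finType) (Y : I -> T -> R) :
  (forall i, bmf (Y i)) -> bmf (fun w => \sum_i Y i w).
Proof.
move=> bY; elim: (index_enum I) => [|i s IH].
  by under eq_fun do rewrite big_nil; apply: bmf_cst.
by under eq_fun do rewrite big_cons; apply: bmfD.
Qed.

Lemma bmf_indic (A : set T) : measurable A -> bmf (\1_A : T -> R).
Proof.
move=> mA; apply: (@bmf_bound _ 1) => [|w]; first exact: measurable_indic.
by rewrite indicE; case: (_ \in _); rewrite ?normr1 ?normr0.
Qed.

Lemma ExD Y Z : bmf Y -> bmf Z -> Ex (fun w => Y w + Z w) = Ex Y + Ex Z.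
Proof. by move=> bY bZ; rewrite /Ex RintegralD//; apply: bmf_integrable. Qed.

Lemma ExB Y Z : bmf Y -> bmf Z -> Ex (fun w => Y w - Z w) = Ex Y - Ex Z.
Proof. by move=> bY bZ; rewrite /Ex RintegralB//; apply: bmf_integrable. Qed.

Lemma ExZ a Y : bmf Y -> Ex (fun w => a * Y w) = a * Ex Y.
Proof. by move=> bY; rewrite /Ex RintegralZl//; apply: bmf_integrable. Qed.

Lemma Ex_cst a : Ex (fun=> a) = a.
Proof.
rewrite /Ex Rintegral_cst//; have /= -> := @probability_setT _ _ _ P.
by rewrite mulr1.
Qed.

Lemma Ex_le Y Z : bmf Y -> bmf Z -> (forall w, Y w <= Z w) -> Ex Y <= Ex Z.
Proof.
by move=> bY bZ YZ; apply: le_Rintegral => //; apply: bmf_integrable.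
Qed.

Lemma Ex_le_cst Y a : bmf Y -> (forall w, Y w <= a) -> Ex Y <= a.
Proof.
by move=> bY Ya; rewrite -[leRHS]Ex_cst; apply: Ex_le => //; apply: bmf_cst.
Qed.

Lemma Ex_ge0 Y : (forall w, 0 <= Y w) -> 0 <= Ex Y.
Proof. by move=> Y0; apply: Rintegral_ge0. Qed.

Lemma Ex_norm Y : bmf Y -> `|Ex Y| <= Ex (fun w => `|Y w|).
Proof. by move=> bY; apply: le_normr_Rintegral => //; apply: bmf_integrable. Qed.

Lemma Ex_sum (I : finType) (Y : I -> T -> R) : (forall i, bmf (Y i)) ->
  Ex (fun w => \sum_i Y i w) = \sum_i Ex (Y i).
Proof.
move=> bY; elim: (index_enum I) => [|i s IH].
  by under [X in Ex X]eq_fun do rewrite big_nil; rewrite Ex_cst big_nil.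
under [X in Ex X]eq_fun do rewrite big_cons.
rewrite ExD ?IH ?big_cons// {IH}.
elim: s => [|j s IH]; first by under eq_fun do rewrite big_nil; apply: bmf_cst.
by under eq_fun do rewrite big_cons; apply: bmfD.
Qed.

Lemma Ex_indic (A : set T) : measurable A -> Ex \1_A = fine (P A).
Proof. by move=> mA; rewrite /Ex /Rintegral integral_indic// setIT. Qed.

Lemma Ex_cvg (Y_ : nat -> T -> R) Y C :
  (forall n, measurable_fun setT (Y_ n)) -> (forall n w, `|Y_ n w| <= C) ->
  (forall w, Y_ n w @[n --> \oo] --> Y w) ->
  bmf Y /\ Ex (Y_ n) @[n --> \oo] --> Ex Y.
Proof.
move=> mY bY YY.
have PT : (P setT < +oo)%E by apply: fin_num_fun_lty (fin_num_measure P).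
have [mYl cY] := Rintegral_cvg_bounded measurableT PT mY (fun n w _ => bY n w)
  (fun w _ => YY w).
split=> //; apply: (@bmf_bound _ C) => // w.
by apply: (cvgr_to_le (cvg_norm (YY w))); apply: nearW.
Qed.

End BoundedExpectation.

(** * Finite-state generators *)

Section Generators.
Context {R : realType} {S : finType}.
Implicit Types (M Q : S -> S -> R) (pi h v K : S -> R).

Lemma gen_pow_le M n x y :
  `|gen_pow M n x y| <= (\sum_x \sum_y `|M x y|) ^+ n.
Proof.
set A := \sum_x _; elim: n x y => [|n IH] x y /=.
  by rewrite expr0; case: (x == y); rewrite ?normr1 ?normr0.
apply: le_trans (ler_norm_sum _ _ _) _.
apply: (@le_trans _ _ (\sum_z `|M x z| * A ^+ n)).
  by apply: ler_sum => z _; rewrite normrM ler_wpM2l.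
rewrite -mulr_suml exprS ler_wpM2r//.
  by rewrite exprn_ge0// sumr_ge0// => z _; rewrite sumr_ge0.
rewrite /A [leRHS](bigD1 x)//= lerDl sumr_ge0// => z _.
by rewrite sumr_ge0.
Qed.

(** The only analytic fact used about the matrix exponential. Beyond the linear part, t^2 A^2
    factors out of the series and, as t <= 1 and (n+2)! >= n!, what remains is dominated by the
    series of exp A. *)
Lemma transition_expansion M : exists2 C : R, 0 <= C &
  forall (t : R) x y, 0 <= t -> t <= 1 ->
    `|transition M t x y - ((x == y)%:R + t * M x y)| <= C * t ^+ 2.
Proof.
pose A : R := \sum_x \sum_y `|M x y|.
have A0 : 0 <= A by apply: sumr_ge0 => x _; apply: sumr_ge0.
exists (A ^+ 2 * expR A); first by rewrite mulr_ge0 ?expR_ge0 ?exprn_ge0.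
move=> t x y t0 t1.
pose u n := t ^+ n / n`!%:R * gen_pow M n x y.
have u_le n : `|u n| <= exp_coeff (t * A) n.
  rewrite /u /exp_coeff /= normrM normf_div normr_nat normrX (ger0_norm t0).
  rewrite exprMn mulrAC ler_wpM2r ?invr_ge0//.
  by rewrite ler_wpM2l ?exprn_ge0//; apply: gen_pow_le.
have cu : cvgn (series u).
  apply: normed_cvg; apply: series_le_cvg (is_cvg_series_exp_coeff (t * A)).
  - by move=> n /=.
  - by move=> n; apply: exp_coeff_ge0; rewrite mulr_ge0.
  - by [].
have uS n : `|u n.+2| <= t ^+ 2 * A ^+ 2 * exp_coeff A n.
  apply: le_trans (u_le _) _; rewrite /exp_coeff /= -[n.+2]addn2 exprD.
  have -> : (t * A) ^+ n * (t * A) ^+ 2 / (n + 2)`!%:R =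
    t ^+ 2 * A ^+ 2 * ((t * A) ^+ n / (n + 2)`!%:R) by ring.
  apply: ler_wpM2l; first by rewrite mulr_ge0 ?exprn_ge0.
  apply: ler_pM => //; first by rewrite exprn_ge0 ?mulr_ge0.
    by rewrite lerXn2r ?nnegrE ?mulr_ge0// ler_piMl.
  rewrite lef_pV2 ?posrE ?ltr0n ?fact_gt0// ler_nat addn2 !factS mulnA.
  by rewrite leq_pmull.
have partial n : `|series u n.+2 - ((x == y)%:R + t * M x y)| <=
    A ^+ 2 * expR A * t ^+ 2.
  have -> : series u n.+2 - ((x == y)%:R + t * M x y) =
      \sum_(0 <= k < n) u k.+2.
    rewrite /series /= big_nat_recl// big_nat_recl// /u /= fact0 expr0 expr1.
    rewrite !invr1 !mul1r mulr1 (bigD1 y)//= eqxx mulr1 big1 ?addr0.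
      by ring.
    by move=> z /negbTE ->; rewrite mulr0.
  apply: le_trans (ler_norm_sum _ _ _) _.
  apply: le_trans (ler_sum _ (fun k _ => uS k)) _.
  have -> : A ^+ 2 * expR A * t ^+ 2 = t ^+ 2 * A ^+ 2 * expR A by ring.
  rewrite -mulr_sumr ler_wpM2l ?mulr_ge0 ?exprn_ge0//.
  apply: (@nondecreasing_cvgn_le _ (series (exp_coeff A))).
    by apply: nondecreasing_series => k _ _; apply: exp_coeff_ge0.
  exact: is_cvg_series_exp_coeff.
suff: series u n - ((x == y)%:R + t * M x y) @[n --> \oo] -->
    transition M t x y - ((x == y)%:R + t * M x y).
  move=> /cvg_norm /cvgr_to_le; apply.
  exists 2%N => // k /=; case: k => [//|[//|k]] _; exact: partial.
by apply: cvgB; [exact: cu|exact: cvg_cst].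
Qed.

(** Interface between the Metropolis-Hastings chain and the limit theorems, which are proved for any
    reversible irreducible generator. *)
Record reversible_generator M pi : Prop := {
  rev_gen : is_generator M ;
  rev_pos : forall x, 0 < pi x ;
  rev_sum : \sum_x pi x = 1 ;
  rev_balance : forall x y, pi x * M x y = pi y * M y x ;
  rev_irr : is_irreducible M }.

Section Reversible.
Variables (M : S -> S -> R) (pi : S -> R).
Hypothesis rev : reversible_generator M pi.

Lemma stationary v : \sum_x pi x * (\sum_y M x y * v y) = 0.
Proof.
under eq_bigr do rewrite mulr_sumr.
rewrite exchange_big /= big1// => y _.
under eq_bigr do rewrite mulrA (rev_balance rev).
by rewrite -mulr_suml -mulr_sumr (rev_gen rev).2 mulr0 mul0r.
Qed.

(** Expand the square: the v(y)^2 terms vanish by stationarity, the v(x)^2 terms because rows sum to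
    zero, and the cross term remains. *)
Lemma dirichlet_form v : \sum_x pi x * v x * (\sum_y M x y * v y) =
  - 2^-1 * \sum_x \sum_y pi x * M x y * (v y - v x) ^+ 2.
Proof.
have e x y : pi x * M x y * (v y - v x) ^+ 2 = pi x * (M x y * v y ^+ 2)
    + (pi x * v x ^+ 2 * M x y - 2 * (pi x * v x * (M x y * v y))) by ring.
under [in RHS]eq_bigr do rewrite (eq_bigr _ (fun y _ => e _ y)) big_split /=.
rewrite big_split /=.
have -> : \sum_x \sum_y pi x * (M x y * v y ^+ 2) = 0.
  under eq_bigr do rewrite -mulr_sumr.
  exact: (stationary (fun y => v y ^+ 2)).
under [in RHS]eq_bigr do rewrite sumrB -mulr_sumr (rev_gen rev).2 mulr0 sub0r.
rewrite sumrN add0r.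
under [in RHS]eq_bigr do rewrite -!mulr_sumr.
by rewrite -mulr_sumr; field.
Qed.

Lemma dirichlet_term_ge0 v x y : 0 <= pi x * M x y * (v y - v x) ^+ 2.
Proof.
have [->|xy] := eqVneq x y; first by rewrite subrr expr0n mulr0.
rewrite mulr_ge0 ?sqr_ge0// mulr_ge0 ?(rev_gen rev).1//.
exact: ltW (rev_pos rev x).
Qed.

Lemma dirichlet_le0 v : \sum_x pi x * v x * (\sum_y M x y * v y) <= 0.
Proof.
rewrite dirichlet_form mulNr oppr_le0 mulr_ge0 ?invr_ge0//.
by do 2 (apply: sumr_ge0 => ? _); apply: dirichlet_term_ge0.
Qed.

(** The Dirichlet form of v vanishes, so v is constant along every edge of positive rate, and
    irreducibility joins all states by such edges. *)
Lemma harmonic_cst v : (forall x, \sum_y M x y * v y = 0) ->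
  forall x y, v x = v y.
Proof.
move=> Mv0.
have /eqP : \sum_x pi x * v x * (\sum_y M x y * v y) = 0.
  by apply: big1 => x _; rewrite Mv0 mulr0.
rewrite dirichlet_form mulf_eq0 oppr_eq0 invr_eq0 pnatr_eq0 /=.
rewrite psumr_eq0; last first.
  by move=> x _; apply: sumr_ge0 => y _; apply: dirichlet_term_ge0.
move=> /allP D0.
have edge x y : 0 < M x y -> v x = v y.
  move=> Mxy; have /= := D0 x (mem_index_enum _).
  rewrite psumr_eq0 => [/allP /(_ y (mem_index_enum _)) /=|z _].
    rewrite mulf_eq0 sqrf_eq0 subr_eq0 gt_eqF ?mulr_gt0 ?(rev_pos rev)//=.
    by move=> /eqP.
  exact: dirichlet_term_ge0.
move=> x y; have /connectP[p pp ->] := rev_irr rev x y.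
by elim: p x pp => //= z p IH x /andP[/edge -> /IH].
Qed.

(* The rank-one perturbation [M - 1 pi^T] is injective, hence invertible. *)
Lemma poisson h : \sum_x h x * pi x = 0 ->
  exists chi, forall x, \sum_y M x y * chi y = - h x.
Proof.
move=> h0.
(* The matrix is transposed because it acts on row vectors. *)
pose A : 'M[R]_(#|S|) := \matrix_(i, j)
  (M (enum_val j) (enum_val i) - pi (enum_val i)).
have sumE (F : S -> R) : \sum_(i < #|S|) F (enum_val i) = \sum_x F x.
  by rewrite -(big_enum_val F).
have AE (u : 'rV[R]_(#|S|)) x :
    (u *m A) ord0 (enum_rank x) =
    \sum_y M x y * u ord0 (enum_rank y) - \sum_y pi y * u ord0 (enum_rank y).
  rewrite mxE -sumrB -[RHS]sumE; apply: eq_bigr => i _.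
  by rewrite mxE enum_rankK enum_valK; ring.
(* Integrating the perturbed equation against pi removes [M v] by stationarity and leaves the mean
   of v. *)
have pi_stat (v : S -> R) c :
    (forall x, \sum_y M x y * v y - \sum_y pi y * v y = c x) ->
    \sum_y pi y * v y = - \sum_x c x * pi x.
  move=> e; have := stationary v.
  rewrite (_ : \sum_x _ = \sum_x (c x * pi x + pi x * \sum_y pi y * v y)).
    rewrite big_split /= -mulr_suml (rev_sum rev) mul1r => /eqP.
    by rewrite addrC addr_eq0 => /eqP.
  by apply: eq_bigr => x _; rewrite -(e x); ring.
(* A kernel vector has mean zero, hence is harmonic, hence constant, hence zero. *)
have Au : A \in unitmx.
  rewrite -row_free_unit -kermx_eq0; apply/rowV0P => u /sub_kermxP uA.
  pose v x := u ord0 (enum_rank x).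
  have e x : \sum_y M x y * v y - \sum_y pi y * v y = 0.
    by rewrite -AE uA mxE.
  have piv : \sum_y pi y * v y = 0.
    by rewrite (pi_stat v (fun=> 0) e) big1 ?oppr0// => x _; rewrite mul0r.
  have vc x y : v x = v y.
    by apply: harmonic_cst => z; have := e z; rewrite piv subr0.
  apply/rowP => i; rewrite mxE -(enum_valK i) -/(v _).
  rewrite -[LHS]mul1r -(rev_sum rev) mulr_suml -[RHS]piv.
  by apply: eq_bigr => x _; rewrite (vc (enum_val i) x).
pose b : 'rV[R]_(#|S|) := \row_i - h (enum_val i).
pose chi x := (b *m invmx A) ord0 (enum_rank x).
have e x : \sum_y M x y * chi y - \sum_y pi y * chi y = - h x.
  by rewrite -AE mulmxKV// mxE enum_rankK.
exists chi => x; have := e x; rewrite (pi_stat chi _ e).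
(* The solution has mean zero because h is centred, so the rank-one term disappears and the original
   equation holds. *)
have -> : \sum_x - h x * pi x = 0.
  by under eq_bigr do rewrite mulNr; rewrite sumrN h0 oppr0.
by rewrite oppr0 subr0.
Qed.

End Reversible.

Lemma gibbs_sum_gt0 K (x0 : S) : 0 < \sum_x expR (- K x).
Proof.
by rewrite (bigD1 x0)//= ltr_pwDl ?expR_gt0// sumr_ge0// => x _; apply: expR_ge0.
Qed.

(** Irreducibility is inherited because the acceptance factor is positive on every edge of Q. The
    state [x0] makes the normalising sum positive. *)
Lemma mh_reversible Q K (x0 : S) : is_generator Q -> is_symmetric Q ->
  is_irreducible Q -> reversible_generator (mh_generator Q K) (gibbs K).
Proof.
move=> genQ symQ irrQ; have Z0 := gibbs_sum_gt0 K x0.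
have rate0 x y : x != y -> 0 <= mh_rate Q K x y.
  by move=> xy; rewrite mulr_ge0 ?expR_ge0// genQ.1.
split.
- split=> [x y xy|x]; first by rewrite /mh_generator (negbTE xy) rate0.
  rewrite (bigD1 x)//= /mh_generator eqxx addrC; apply/eqP; rewrite subr_eq0.
  by apply/eqP/eq_bigr => y yx; rewrite eq_sym (negbTE yx).
- by move=> x; rewrite divr_gt0 ?expR_gt0.
- by rewrite -mulr_suml divff// gt_eqF.
- move=> x y; rewrite /mh_generator /gibbs eq_sym.
  have [->//|xy] := eqVneq y x.
  (* Both sides equal Q(x,y) exp(- max(K x, K y)). *)
  suff e : expR (- K x) * mh_rate Q K x y = expR (- K y) * mh_rate Q K y x.
    by rewrite mulrAC e mulrAC.
  rewrite /mh_rate symQ !(mulrC (Q _ _)) !mulrA -!expRD; congr (expR _ * _).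
  rewrite /pos_part !maxEle; case: ifP; case: ifP; lra.
- move=> x y; move: x y (irrQ x y); apply: connect_sub => x y /= Qxy.
  have [->|xy] := eqVneq x y; first exact: connect0.
  by apply: connect1; rewrite /= /mh_generator (negbTE xy) mulr_gt0 ?expR_gt0.
Qed.

End Generators.

(** * Derivatives along lines *)

Section FlowDerivative.
Context {R : realType}.
Implicit Types (f g : R -> R -> R).

(* [f'] is the derivative of [f] along the lines of velocity [(1, eta)] in the
   cone [|y| <= L s], [0 <= s <= t], with a uniform second order remainder. *)
Definition flow_diff (t L eta : R) f (f' : R -> R -> R) : Prop :=
  exists C : R, forall s y r, 0 <= s -> 0 <= r -> s + r <= t -> `|y| <= L * s ->
    [/\ `|f s y| <= C, `|f' s y| <= C &
        `|f (s + r) (y + r * eta) - f s y - r * f' s y| <= C * r ^+ 2].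

Variables (t L eta : R).
Hypothesis etaL : `|eta| <= L.
Local Notation flow := (flow_diff t L eta).

(** The pair (s, int_0^s h) lives in this cone when |h| <= L. Its invariance makes the bounds
    available at the end of a step as well. *)
Lemma flow_cone s y r : 0 <= r -> `|y| <= L * s ->
  `|y + r * eta| <= L * (s + r).
Proof.
move=> r0 yL; apply: le_trans (ler_normD _ _) _.
by rewrite mulrDr lerD// normrM (ger0_norm r0) mulrC ler_wpM2r.
Qed.

(** One constant for all estimates: the end point is again in the cone, and r <= |t| turns the
    quadratic remainder into a linear bound on the increment. *)
Lemma flow_bounds f f' : flow f f' -> exists2 C : R, 0 <= C &
  forall s y r, 0 <= s -> 0 <= r -> s + r <= t -> `|y| <= L * s ->
    [/\ `|f s y| <= C, `|f' s y| <= C,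
        `|f (s + r) (y + r * eta) - f s y - r * f' s y| <= C * r ^+ 2,
        `|f (s + r) (y + r * eta)| <= C &
        `|f (s + r) (y + r * eta) - f s y| <= C * r].
Proof.
move=> [C HC]; exists (`|C| * (1 + `|t|)).
  by rewrite mulr_ge0// addr_ge0.
move=> s y r s0 r0 srt yL.
have CC : `|C| <= `|C| * (1 + `|t|) by rewrite mulrDr mulr1 lerDl mulr_ge0.
have CC' := le_trans (ler_norm C) CC.
have [h1 h2 h3] := HC s y r s0 r0 srt yL.
have [h4 _ _] := HC (s + r) (y + r * eta) 0 (addr_ge0 s0 r0) (lexx 0)
  ltac:(by rewrite addr0) (flow_cone r0 yL).
have rt : r <= `|t| by apply: le_trans (ler_norm t); lra.
split.
- exact: le_trans h1 CC'.
- exact: le_trans h2 CC'.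
- by apply: le_trans h3 _; rewrite ler_wpM2r ?sqr_ge0.
- exact: le_trans h4 CC'.
- have -> : f (s + r) (y + r * eta) - f s y =
    (f (s + r) (y + r * eta) - f s y - r * f' s y) + r * f' s y by ring.
  apply: le_trans (ler_normD _ _) _; rewrite normrM (ger0_norm r0).
  have h3' : `|f (s + r) (y + r * eta) - f s y - r * f' s y| <=
      `|C| * `|t| * r.
    apply: le_trans h3 _; rewrite expr2 mulrA ler_wpM2r//.
    apply: (@le_trans _ _ (`|C| * r)); first by rewrite ler_wpM2r ?ler_norm.
    by rewrite ler_wpM2l.
  have h2' : r * `|f' s y| <= `|C| * r.
    by rewrite mulrC ler_wpM2r// (le_trans h2) ?ler_norm.
  by rewrite mulrDr mulr1 mulrDl addrC lerD.
Qed.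

Lemma flow_cst a : flow (fun _ _ => a) (fun _ _ => 0).
Proof.
exists `|a| => s y r _ _ _ _; split => //; first by rewrite normr0.
by rewrite subrr mulr0 subr0 normr0 mulr_ge0 ?sqr_ge0.
Qed.

Lemma flow_time : flow (fun s _ => s) (fun _ _ => 1).
Proof.
exists (`|t| + 1) => s y r s0 r0 srt _; split.
- rewrite ger0_norm//; have := ler_norm t; lra.
- by rewrite normr1 lerDr.
- have -> : s + r - s - r * 1 = 0 by ring.
  by rewrite normr0 mulr_ge0 ?sqr_ge0 ?addr_ge0.
Qed.

Lemma flow_space : flow (fun _ y => y) (fun _ _ => eta).
Proof.
have L0 : 0 <= L by apply: le_trans etaL.
exists (L * (`|t| + 1)) => s y r s0 r0 srt yL; split.
- apply: le_trans yL _; rewrite ler_wpM2l//; have := ler_norm t; lra.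
- by apply: le_trans etaL _; rewrite ler_peMr// lerDr.
- have -> : y + r * eta - y - r * eta = 0 by ring.
  by rewrite normr0 mulr_ge0 ?sqr_ge0// mulr_ge0 ?addr_ge0.
Qed.

Lemma flowD f f' g g' : flow f f' -> flow g g' ->
  flow (fun s y => f s y + g s y) (fun s y => f' s y + g' s y).
Proof.
move=> [C HC] [D HD]; exists (C + D) => s y r s0 r0 srt yL.
have [h1 h2 h3] := HC s y r s0 r0 srt yL.
have [k1 k2 k3] := HD s y r s0 r0 srt yL; split.
- exact: le_trans (ler_normD _ _) (lerD h1 k1).
- exact: le_trans (ler_normD _ _) (lerD h2 k2).
- rewrite mulrDl; apply: le_trans (lerD h3 k3); apply: le_trans (ler_normD _ _).
  by rewrite le_eqVlt; apply/orP; left; apply/eqP; congr `|_|; ring.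
Qed.

Lemma flowM f f' g g' : flow f f' -> flow g g' ->
  flow (fun s y => f s y * g s y) (fun s y => f' s y * g s y + f s y * g' s y).
Proof.
move=> /flow_bounds[C C0 HC] /flow_bounds[D D0 HD].
exists (3 * (C * D)) => s y r s0 r0 srt yL.
have [h1 h2 h3 h4 h5] := HC s y r s0 r0 srt yL.
have [k1 k2 k3 k4 k5] := HD s y r s0 r0 srt yL.
have CD : 0 <= C * D by rewrite mulr_ge0.
split.
- by apply: (@le_trans _ _ (C * D)); [rewrite normrM ler_pM|lra].
- apply: le_trans (ler_normD _ _) _; rewrite !normrM.
  have := ler_pM (normr_ge0 _) (normr_ge0 _) h2 k1.
  by have := ler_pM (normr_ge0 _) (normr_ge0 _) h1 k2; lra.
- set f1 := f (s + r) _ in h3 h4 h5 *; set g1 := g (s + r) _ in k3 k4 k5 *.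
  (* Product rule with remainder: two second order remainders and a product of two increments, each
     at most C D r^2, whence the factor 3. *)
  have -> : f1 * g1 - f s y * g s y - r * (f' s y * g s y + f s y * g' s y) =
    (f1 - f s y - r * f' s y) * g s y + f s y * (g1 - g s y - r * g' s y)
    + (f1 - f s y) * (g1 - g s y) by ring.
  apply: le_trans (ler_normD _ _) _.
  apply: le_trans (lerD (ler_normD _ _) (lexx _)) _; rewrite !normrM.
  have e1 := ler_pM (normr_ge0 _) (normr_ge0 _) h3 k1.
  have e2 := ler_pM (normr_ge0 _) (normr_ge0 _) h1 k3.
  have e3 := ler_pM (normr_ge0 _) (normr_ge0 _) h5 k5.
  apply: le_trans (lerD (lerD e1 e2) e3) _.
  by rewrite le_eqVlt; apply/orP; left; apply/eqP; ring.
Qed.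

Lemma flowZ a f f' : flow f f' ->
  flow (fun s y => a * f s y) (fun s y => a * f' s y).
Proof.
move=> /(flowM (flow_cst a)) [C HC]; exists C => s y r s0 r0 srt yL.
by have := HC s y r s0 r0 srt yL; rewrite mul0r add0r.
Qed.

(** Derivatives may be simplified on the cone only, where the identities for the Gaussian kernel can
    divide by a positive square root. *)
Lemma flow_eq f f' g g' : flow f f' -> (forall s y, f s y = g s y) ->
  (forall s y, 0 <= s -> s <= t -> `|y| <= L * s -> f' s y = g' s y) ->
  flow g g'.
Proof.
move=> [C HC] fg fg'; exists C => s y r s0 r0 srt yL.
by rewrite -!fg -fg'//; [exact: HC|lra].
Qed.

(** Chain rule: the remainder of [phi] costs C (K r)^2, as the increment of f is at most K r, and
    the remainder of f costs C K r^2. The set [D] confines the range of f to where [phi] is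
    regular. *)
Lemma flow_comp (D : R -> Prop) (phi phi' : R -> R) (C : R) f f' :
  (forall a, D a -> `|phi a| <= C /\ `|phi' a| <= C) ->
  (forall a b, D a -> D b ->
     `|phi b - phi a - (b - a) * phi' a| <= C * (b - a) ^+ 2) ->
  (forall s y, 0 <= s -> s <= t -> `|y| <= L * s -> D (f s y)) ->
  flow f f' ->
  flow (fun s y => phi (f s y)) (fun s y => phi' (f s y) * f' s y).
Proof.
move=> phiC phi2 fD /flow_bounds[K K0 HK].
exists (`|C| * (K ^+ 2 + K + 1)) => s y r s0 r0 srt yL.
have [h1 h2 h3 _ h5] := HK s y r s0 r0 srt yL.
have st : s <= t by lra.
have Da := fD s y s0 st yL.
have Db := fD (s + r) (y + r * eta) (addr_ge0 s0 r0) srt (flow_cone r0 yL).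
have [p1 p2] := phiC _ Da.
have CC := ler_norm C.
have K2 : 0 <= K ^+ 2 by rewrite sqr_ge0.
split.
- apply: le_trans p1 _; apply: le_trans CC _; rewrite ler_peMr//; lra.
- rewrite normrM; apply: (@le_trans _ _ (`|C| * K)).
    by rewrite ler_pM// (le_trans p2).
  by rewrite ler_wpM2l//; lra.
- set a := f s y in Da h1 h2 h3 h5 p1 p2 *.
  set b := f (s + r) _ in Db h3 h5 *.
  have -> : phi b - phi a - r * (phi' a * f' s y) =
    (phi b - phi a - (b - a) * phi' a) + phi' a * (b - a - r * f' s y) by ring.
  apply: le_trans (ler_normD _ _) _.
  have e1 : `|phi b - phi a - (b - a) * phi' a| <= `|C| * (K * r) ^+ 2.
    apply: le_trans (phi2 _ _ Da Db) _.
    apply: (@le_trans _ _ (`|C| * (b - a) ^+ 2)).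
      by rewrite ler_wpM2r ?sqr_ge0.
    rewrite ler_wpM2l// -(real_normK (num_real (b - a))).
    by rewrite lerXn2r ?nnegrE ?mulr_ge0.
  have e2 : `|phi' a * (b - a - r * f' s y)| <= `|C| * (K * r ^+ 2).
    by rewrite normrM ler_pM// (le_trans p2).
  apply: le_trans (lerD e1 e2) _.
  have -> : `|C| * (K * r) ^+ 2 + `|C| * (K * r ^+ 2) =
    `|C| * (K ^+ 2 + K) * r ^+ 2 by ring.
  rewrite ler_wpM2r ?sqr_ge0// ler_wpM2l//; lra.
Qed.

(** From e^(-u) >= 1 - u one gets e^u - 1 - u <= u (e^u - 1). It remains to bound e^u - 1 by u e^u
    when u >= 0, and 1 - e^u by - u when u < 0. *)
Lemma expR_remainder (u : R) : `|expR u - 1 - u| <= u ^+ 2 * expR `|u|.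
Proof.
have e1 := expR_ge1Dx u; have e2 := expR_ge1Dx (- u).
have e0 := expR_gt0 u; have ei : expR (- u) * expR u = 1 by rewrite -expRD addNr expR0.
rewrite ger0_norm; last lra.
have h : (1 - u) * expR u <= 1 by rewrite -ei ler_wpM2r//; lra.
have [u0|u0] := leP 0 u.
  rewrite (ger0_norm u0); have k : u * (expR u - 1) <= u * (u * expR u) by rewrite ler_wpM2l//; lra.
  have -> : u ^+ 2 * expR u = u * (u * expR u) by ring.
  lra.
rewrite (ltr0_norm u0); have k1 : - u * (1 - expR u) <= - u * - u by rewrite ler_wpM2l//; lra.
have k2 : u ^+ 2 <= u ^+ 2 * expR (- u).
  by rewrite ler_peMr ?sqr_ge0//; lra.
have : - u * - u = u ^+ 2 by ring.
lra.
Qed.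

Lemma flow_exp f f' : flow f f' ->
  flow (fun s y => expR (f s y)) (fun s y => expR (f s y) * f' s y).
Proof.
move=> ff; have [C C0 HC] := flow_bounds ff.
(* The remainder is e^a (b - a)^2 e^|b - a| with |a|, |b| <= C, hence the exponent C + 2 C. *)
apply: (@flow_comp (fun a => `|a| <= C) expR expR (expR (3 * C))) => //.
- move=> a aC; rewrite ger0_norm ?expR_ge0// ler_expR; split=> //;
  by have := ler_norm a; lra.
- move=> a b aC bC.
  have -> : expR b - expR a - (b - a) * expR a =
      expR a * (expR (b - a) - 1 - (b - a)).
    have -> : expR b = expR a * expR (b - a) by rewrite -expRD addrC subrK.
    ring.
  rewrite normrM (ger0_norm (expR_ge0 a)).
  apply: le_trans (ler_wpM2l (expR_ge0 _) (expR_remainder _)) _.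
  rewrite mulrCA mulrC -expRD ler_wpM2r ?sqr_ge0// ler_expR.
  have := ler_norm a; have := ler_normB b a; lra.
- by move=> s y s0 st yL; have [] := HC s y 0 s0 (lexx 0) _ yL; rewrite ?addr0.
Qed.

Lemma flow_inv (b : R) f f' : 0 < b ->
  (forall s y, 0 <= s -> s <= t -> `|y| <= L * s -> b <= f s y) ->
  flow f f' ->
  flow (fun s y => (f s y)^-1) (fun s y => - (f s y)^-1 ^+ 2 * f' s y).
Proof.
move=> b0 fb ff.
(* The three terms bound the inverse, its derivative, and the remainder coefficient 1 / (a^2 c). *)
apply: (@flow_comp (fun a => b <= a) GRing.inv (fun a => - a^-1 ^+ 2)
         (b^-1 + b^-1 ^+ 2 + b^-1 ^+ 3)) => //.
- move=> a ba; have a0 : 0 < a by apply: lt_le_trans ba.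
  have ib : 0 <= b^-1 by rewrite invr_ge0 ltW.
  have ab : a^-1 <= b^-1 by rewrite lef_pV2.
  have i0 : 0 <= a^-1 by rewrite invr_ge0 ltW.
  have k2 : 0 <= b^-1 ^+ 2 by rewrite exprn_ge0.
  have k3 : 0 <= b^-1 ^+ 3 by rewrite exprn_ge0.
  have k4 : a^-1 ^+ 2 <= b^-1 ^+ 2 by rewrite lerXn2r ?nnegrE.
  by rewrite normrN normrX !(ger0_norm i0); split; lra.
- move=> a c ba bc; have a0 : 0 < a by apply: lt_le_trans ba.
  have c0 : 0 < c by apply: lt_le_trans bc.
  have -> : c^-1 - a^-1 - (c - a) * - a^-1 ^+ 2 =
      a^-1 ^+ 2 * c^-1 * (c - a) ^+ 2.
    by field; rewrite !gt_eqF.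
  rewrite ger0_norm; last first.
    by rewrite mulr_ge0 ?sqr_ge0// mulr_ge0 ?sqr_ge0// invr_ge0 ltW.
  rewrite ler_wpM2r ?sqr_ge0//.
  have ib : 0 <= b^-1 by rewrite invr_ge0 ltW.
  have k2 : 0 <= b^-1 ^+ 2 by rewrite exprn_ge0.
  suff : a^-1 ^+ 2 * c^-1 <= b^-1 ^+ 3 by lra.
  have ia : 0 <= a^-1 by rewrite invr_ge0 ltW.
  have ic : 0 <= c^-1 by rewrite invr_ge0 ltW.
  have ab : a^-1 <= b^-1 by rewrite lef_pV2.
  have cb : c^-1 <= b^-1 by rewrite lef_pV2.
  rewrite [leRHS]exprSr; apply: ler_pM => //; first exact: sqr_ge0.
  by rewrite lerXn2r ?nnegrE.
Qed.

Lemma flow_sqrt (b : R) f f' : 0 < b ->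
  (forall s y, 0 <= s -> s <= t -> `|y| <= L * s -> b <= f s y) ->
  flow f f' ->
  flow (fun s y => Num.sqrt (f s y))
       (fun s y => (2 * Num.sqrt (f s y))^-1 * f' s y).
Proof.
move=> b0 fb ff; have [C C0 HC] := flow_bounds ff.
set be := Num.sqrt b; have be0 : 0 < be by rewrite sqrtr_gt0.
have ib : 0 <= be^-1 by rewrite invr_ge0 ltW.
have ib3 : 0 <= be^-1 ^+ 3 by rewrite exprn_ge0.
(* The three terms bound the root, its derivative, and the remainder coefficient 1 / (2 x (x +
   z)^2), where x and z are roots at least [be]. *)
apply: (@flow_comp (fun a => b <= a /\ a <= C) Num.sqrt
         (fun a => (2 * Num.sqrt a)^-1)
         (Num.sqrt C + be^-1 + be^-1 ^+ 3)) => //.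
- move=> a [ba aC]; have a0 : 0 < a by apply: lt_le_trans ba.
  have s0 : 0 < Num.sqrt a by rewrite sqrtr_gt0.
  have sC : Num.sqrt a <= Num.sqrt C by rewrite ler_sqrt.
  have bs : be <= Num.sqrt a by rewrite ler_sqrt// ltW.
  rewrite !ger0_norm ?invr_ge0; try lra.
  have : (2 * Num.sqrt a)^-1 <= be^-1 by rewrite lef_pV2 ?posrE; lra.
  have := sqrtr_ge0 C; split; lra.
- move=> a c [ba aC] [bc cC].
  have a0 : 0 < a by apply: lt_le_trans ba.
  have c0 : 0 < c by apply: lt_le_trans bc.
  have ea := sqr_sqrtr (ltW a0); have ec := sqr_sqrtr (ltW c0).
  have bs : be <= Num.sqrt a by rewrite ler_sqrt// ltW.
  have bt : be <= Num.sqrt c by rewrite ler_sqrt// ltW.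
  set x := Num.sqrt a in ea bs *; set z := Num.sqrt c in ec bt *.
  have x0 : 0 < x by lra.
  have z0 : 0 < z by lra.
  have -> : z - x - (c - a) * (2 * x)^-1 =
      - ((2 * x)^-1 * ((x + z)^-1 ^+ 2) * (c - a) ^+ 2).
    by rewrite -ea -ec; field; rewrite !gt_eqF//; lra.
  have i1 : 0 <= (2 * x)^-1 by rewrite invr_ge0; lra.
  have i2 : 0 <= (x + z)^-1 by rewrite invr_ge0; lra.
  rewrite normrN ger0_norm; last first.
    by rewrite mulr_ge0 ?sqr_ge0// mulr_ge0 ?sqr_ge0.
  rewrite ler_wpM2r ?sqr_ge0//.
  suff : (2 * x)^-1 * (x + z)^-1 ^+ 2 <= be^-1 ^+ 3.
    by have := sqrtr_ge0 C; lra.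
  have j1 : (2 * x)^-1 <= be^-1 by rewrite lef_pV2 ?posrE; lra.
  have j2 : (x + z)^-1 <= be^-1 by rewrite lef_pV2 ?posrE; lra.
  rewrite [leRHS]exprS; apply: ler_pM => //; first exact: sqr_ge0.
  by rewrite lerXn2r ?nnegrE.
- move=> s y s0 st yL; split; first exact: fb.
  have [h _ _ _ _] := HC s y 0 s0 (lexx 0) ltac:(by rewrite addr0) yL.
  by apply: le_trans h; apply: ler_norm.
Qed.

End FlowDerivative.

Lemma lebesgue_itv_lty (R : realType) (x y : bool) (a b : R) :
  (@lebesgue_measure R [set` Interval (BSide x a) (BSide y b)] < +oo)%E.
Proof.
rewrite lebesgue_measure_itv /=; case: ifP => _; last exact: ltry.
by rewrite -EFinB ltry.
Qed.

Lemma bounded_itv_integrable (R : realType) (x y : bool) (a b : R) (f : R -> R)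
    (C : R) :
  measurable_fun [set` Interval (BSide x a) (BSide y b)] f ->
  (forall s, [set` Interval (BSide x a) (BSide y b)] s -> `|f s| <= C) ->
  lebesgue_measure.-integrable [set` Interval (BSide x a) (BSide y b)]
    (EFin \o f).
Proof.
move=> mf fC; apply: measurable_bounded_integrable => //.
  exact: lebesgue_itv_lty.
exists C; split=> [|z Cz s Ds]; first exact: num_real.
exact: le_trans (fC s Ds) (ltW Cz).
Qed.

(** * Path integrals of Markov chains *)

Section MarkovChain.
Context {R : realType} {S : finType} d (T : measurableType d)
  (P : probability T R).
Variables (M : S -> S -> R) (nu : S -> R) (X : R -> T -> S).
Hypothesis hX : is_markov_chain P M nu X.
Implicit Types (h : S -> R) (r t : R) (k n : nat).

(** As a finite-valued variable, the history turns expectations into finite sums of the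
    probabilities that [chain_fdd] provides. *)
Definition history r k (w : T) : {ffun 'I_k.+1 -> S} :=
  [ffun i : 'I_k.+1 => X (i%:R * r) w].

Lemma historyP r k (p : {ffun 'I_k.+1 -> S}) w : history r k w = p <->
  forall j, (j <= k)%N -> X (j%:R * r) w = p (inord j).
Proof.
split=> [<- j jk|e]; first by rewrite ffunE inordK.
by apply/ffunP => i; rewrite ffunE e ?inord_val// -ltnS.
Qed.

Lemma measurable_history r k p : 0 <= r ->
  measurable [set w | history r k w = p].
Proof.
move=> r0; rewrite (_ : [set _ | _] =
    \bigcap_(i in [set: 'I_k.+1]) [set w | X (i%:R * r) w = p i]).
  apply: fin_bigcap_measurable => [|i _]; first exact: finite_finset.
  by apply: chain_measurable hX _ _ _; rewrite mulr_ge0.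
apply/seteqP; split=> w /=; first by move=> <- i _ /=; rewrite ffunE.
by move=> e; apply/ffunP => i; rewrite ffunE; apply: e.
Qed.

Lemma history_sum r k (A : {ffun 'I_k.+1 -> S} -> R) w :
  A (history r k w) = \sum_p A p * \1_[set w | history r k w = p] w.
Proof.
rewrite (bigD1 (history r k w))//= indicE mem_set// mulr1 big1 ?addr0// => p pw.
rewrite indicE memNset ?mulr0//= => e.
by move: pw; rewrite e eqxx.
Qed.

Lemma bmf_history r k (A : {ffun 'I_k.+1 -> S} -> R) : 0 <= r ->
  bmf (fun w => A (history r k w)).
Proof.
move=> r0; under eq_fun do rewrite history_sum.
by apply: bmf_sum => p; apply/bmfZ/bmf_indic/measurable_history.
Qed.

Lemma Ex_history r k (A : {ffun 'I_k.+1 -> S} -> R) : 0 <= r ->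
  Ex P (fun w => A (history r k w)) =
  \sum_p A p * fine (P [set w | history r k w = p]).
Proof.
move=> r0; under [X in Ex _ X]eq_fun do rewrite history_sum.
rewrite Ex_sum; last first.
  by move=> p; apply/bmfZ/bmf_indic/measurable_history.
apply: eq_bigr => p _; rewrite ExZ ?Ex_indic//.
- exact: measurable_history.
- exact/bmf_indic/measurable_history.
Qed.

(** Two instances of [chain_fdd] along the same states: the one with an extra time has exactly one
    more transition factor. *)
Lemma history_markov r k p x : 0 <= r ->
  fine (P [set w | history r k w = p /\ X (k.+1%:R * r) w = x]) =
  fine (P [set w | history r k w = p]) * transition M r (p ord_max) x.
Proof.
move=> r0; pose t j := j%:R * r.
have t0 : t 0%N = 0 by rewrite /t mul0r.
have tm i j : (i <= j)%N -> t i <= t j.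
  by move=> ij; rewrite ler_wpM2r// ler_nat.
(* The path is extended to all indices: p up to k, then x. *)
pose q j := if (j <= k)%N then p (inord j) else x.
have tS j : t j.+1 - t j = r by rewrite /t -natr1; ring.
have := chain_fdd hX k q t0 tm; have := chain_fdd hX k.+1 q t0 tm.
rewrite (_ : [set _ | _] =
    [set w | history r k w = p /\ X (k.+1%:R * r) w = x]); last first.
  apply/seteqP; split=> w /= => [e|[/historyP e1 e2] j].
    split; last by rewrite (e k.+1 (leqnn _)) /q ltnn.
    by apply/historyP => j jk; rewrite (e j (leqW jk)) /q jk.
  rewrite leq_eqVlt => /predU1P[->|]; first by rewrite /q ltnn.
  by rewrite ltnS => jk; rewrite /q jk e1.
move=> ->; rewrite (_ : [set _ | _] = [set w | history r k w = p]); last first.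
  apply/seteqP; split=> w /=.
    by move=> e; apply/historyP => j jk; rewrite e// /q jk.
  by move=> /historyP e j jk; rewrite e// /q jk.
move=> ->; rewrite /= big_ord_recr /= mulrA tS /q leqnn ltnn.
by congr (_ * transition _ _ (p _) _); apply/val_inj; rewrite /= inordK.
Qed.

(** Right end points are sampled, so that right continuity of the paths suffices for convergence. *)
Definition grid_sum h r k (w : T) : R := \sum_(i < k) r * h (X (i.+1%:R * r) w).

Definition history_grid_sum h r k (p : {ffun 'I_k.+1 -> S}) : R :=
  \sum_(i < k) r * h (p (lift ord0 i)).

Lemma grid_sumE h r k w :
  grid_sum h r k w = history_grid_sum h r (history r k w).
Proof. by apply: eq_bigr => i _; rewrite ffunE lift0. Qed.

Lemma state_historyE r k w : X (k%:R * r) w = history r k w ord_max.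
Proof. by rewrite ffunE. Qed.

Lemma bmf_grid h r k (B : S -> R -> R) : 0 <= r ->
  bmf (fun w => B (X (k%:R * r) w) (grid_sum h r k w)).
Proof.
move=> r0; under eq_fun do rewrite grid_sumE state_historyE.
exact: (bmf_history (fun p => B (p ord_max) (history_grid_sum h r p))).
Qed.

Lemma bmf_state t (B : S -> R) : 0 <= t -> bmf (fun w => B (X t w)).
Proof.
move=> t0; have := @bmf_grid (fun=> 0) t 1 (fun x _ => B x) t0.
by rewrite mul1r.
Qed.

(** The Markov property in integrated form: split over the finitely many pairs of a history and a
    next state, and apply [history_markov] to each. *)
Lemma Ex_one_step h r k (B : S -> R -> R) : 0 <= r ->
  Ex P (fun w => B (X (k.+1%:R * r) w) (grid_sum h r k.+1 w)) =
  Ex P (fun w => \sum_x transition M r (X (k%:R * r) w) x *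
                   B x (grid_sum h r k w + r * h x)).
Proof.
move=> r0.
under [X in _ = Ex _ X]eq_fun do
  under eq_bigr do rewrite grid_sumE state_historyE.
rewrite (Ex_history (fun p => \sum_x transition M r (p ord_max) x *
  B x (history_grid_sum h r p + r * h x)))//.
pose E p x := [set w | history r k w = p /\ X (k.+1%:R * r) w = x].
have mE p x : measurable (E p x).
  apply: measurableI; first exact: measurable_history.
  by apply: chain_measurable hX _ _ _; rewrite mulr_ge0.
have bE p x c : bmf (fun w => c * (\1_(E p x) w : R)).
  exact/bmfZ/bmf_indic.
transitivity (Ex P (fun w => \sum_p \sum_x
    B x (history_grid_sum h r p + r * h x) * \1_(E p x) w)).
  congr (Ex P _); apply/funext => w.
  rewrite (bigD1 (history r k w))//= (bigD1 (X (k.+1%:R * r) w))//=.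
  rewrite indicE mem_set// mulr1 big1 ?addr0; last first.
    by move=> x xw; rewrite indicE memNset ?mulr0// => -[_ /= /eqP]; rewrite eq_sym (negbTE xw).
  rewrite big1 ?addr0; last first.
    move=> p pw; apply: big1 => x _; rewrite indicE memNset ?mulr0//.
    by move=> -[/= /eqP]; rewrite eq_sym (negbTE pw).
  by rewrite -grid_sumE /grid_sum big_ord_recr.
rewrite Ex_sum; last by move=> p; apply: bmf_sum => x; apply: bE.
apply: eq_bigr => p _; rewrite Ex_sum; last by move=> x; apply: bE.
rewrite mulr_suml; apply: eq_bigr => x _.
rewrite ExZ; last exact: bmf_indic.
by rewrite Ex_indic// history_markov//; ring.
Qed.

Lemma grid_sum_le h L r k w : 0 <= r -> (forall x, `|h x| <= L) ->
  `|grid_sum h r k w| <= L * (k%:R * r).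
Proof.
move=> r0 hL; apply: le_trans (ler_norm_sum _ _ _) _.
apply: (@le_trans _ _ (\sum_(i < k) r * L)).
  by apply: ler_sum => i _; rewrite normrM (ger0_norm r0) ler_wpM2l.
by rewrite sumr_const card_ord -mulr_natr le_eqVlt; apply/orP; left; apply/eqP; ring.
Qed.

Section PathIntegral.
Variables (h : S -> R) (L : R).
Hypothesis hL : forall x, `|h x| <= L.

Lemma near_div_lt t (e : R) : 0 < e -> 
  \forall n \near \oo, t / n%:R < e /\ (0 < n)%N.
Proof.
move=> e0; exists (Num.truncn (t / e)).+1 => // n /= ln.
have n0 : (0 < n)%N by apply: leq_trans ln.
split=> //; rewrite ltr_pdivrMr ?ltr0n// mulrC -ltr_pdivrMr//.
by apply: lt_le_trans (truncnS_gt _) _; rewrite ler_nat.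
Qed.

(** The right end point of the grid cell of s lies strictly after s and within t/n of it, so right
    continuity at s applies. *)
Lemma right_limit_grid t s w : 0 <= s -> s < t ->
  \forall n \near \oo, (0 < n)%N /\
    X ((Num.truncn (s / (t / n%:R))).+1%:R * (t / n%:R)) w = X s w.
Proof.
move=> s0 st; have t0 : 0 < t by apply: le_lt_trans st.
have /nbhs_ballP[e /= e0 He] := chain_right_continuous hX w s0.
apply: filterS (near_div_lt t e0) => n [ne n0]; split=> //.
have r0 : 0 < t / n%:R by rewrite divr_gt0 ?ltr0n.
set r := t / n%:R in ne r0 *.
have /andP[] := truncn_itv (divr_ge0 s0 (ltW r0)).
set i := Num.truncn _; rewrite ler_pdivlMr// ltr_pdivrMr// => is1 is2.
have iS : i.+1%:R * r = i%:R * r + r by rewrite -natr1; ring.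
apply: He => //; rewrite /ball /= ltr_norml; lra.
Qed.

(** The step function whose integral is the grid sum. Cells are closed on the left, so the sampled
    time lies strictly to the right of s. *)
Definition grid_step n t w (s : R) : R :=
  \sum_(i < n) h (X (i.+1%:R * (t / n%:R)) w) *
    \1_(`[i%:R * (t / n%:R), i.+1%:R * (t / n%:R)[%classic) s.

Lemma grid_stepE n t w s : 0 <= s -> s < t -> (0 < n)%N ->
  grid_step n t w s =
  h (X ((Num.truncn (s / (t / n%:R))).+1%:R * (t / n%:R)) w).
Proof.
move=> s0 st n0; have t0 : 0 < t by apply: le_lt_trans st.
have r0 : 0 < t / n%:R by rewrite divr_gt0 ?ltr0n.
have nr : n%:R * (t / n%:R) = t by rewrite mulrC divfK// pnatr_eq0 -lt0n.
rewrite /grid_step; set r := t / n%:R in r0 nr *.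
have sr0 : 0 <= s / r := divr_ge0 s0 (ltW r0).
have in_ : (Num.truncn (s / r) < n)%N.
  by rewrite truncn_lt_nat// ltr_pdivrMr// nr.
have itvE j : (s \in `[j%:R * r, j.+1%:R * r[) = (Num.truncn (s / r) == j).
  by rewrite in_itv /= -ler_pdivlMr// -ltr_pdivrMr// truncn_eq.
rewrite (bigD1 (Ordinal in_))//= indicE mem_set ?mulr1 /= ?itvE ?eqxx//.
rewrite big1 ?addr0// => j; rewrite -val_eqE /= => ji.
by rewrite indicE memNset ?mulr0//= itvE eq_sym (negbTE ji).
Qed.

Lemma measurable_grid_step n t w : measurable_fun setT (grid_step n t w).
Proof.
apply: measurable_sum => i; apply: measurable_funM; first exact: measurable_cst.
exact: measurable_indic.
Qed.

Lemma integral_grid_step n t w : 0 < t ->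
  \int[lebesgue_measure]_(s in `[0, t[) grid_step n t w s =
  grid_sum h (t / n%:R) n w.
Proof.
move=> t0; case: n => [|n].
  rewrite /grid_step /grid_sum big_ord0.
  under eq_Rintegral do rewrite big_ord0.
  by rewrite Rintegral_cst// mul0r.
set r := t / n.+1%:R; have r0 : 0 < r by rewrite divr_gt0 ?ltr0n.
have nr : n.+1%:R * r = t by rewrite mulrC divfK// pnatr_eq0.
pose I i : set R := `[i%:R * r, i.+1%:R * r[%classic.
have indic_le1 i s : `|\1_(I i) s| <= 1 :> R.
  by rewrite indicE; case: (_ \in _); rewrite ?normr1 ?normr0.
have mI i : measurable_fun setT (\1_(I i) : R -> R).
  by apply: measurable_indic; apply: measurable_itv.
have iI (i : nat) c :
    lebesgue_measure.-integrable `[0, t[ (EFin \o (fun s => c * \1_(I i) s)).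
  apply: (@bounded_itv_integrable _ _ _ _ _ _ `|c|).
    by apply: measurable_funTS; apply: measurable_funM.
  by move=> s _; rewrite normrM ler_piMr.
transitivity (fine (\int[lebesgue_measure]_(s in `[0%R, t[)
    (\sum_(i < n.+1) (h (X (i.+1%:R * r) w) * \1_(I i) s)%:E))%E).
  by congr fine; apply: eq_integral => s _; rewrite sumEFin.
rewrite integral_sum//; last by move=> i; apply: iI.
rewrite (eq_bigr (fun i : 'I_n.+1 => (r * h (X (i.+1%:R * r) w))%:E)).
  by rewrite sumEFin.
move=> i _; under eq_integral do rewrite EFinM.
rewrite integralZl//; last first.
  apply: (@bounded_itv_integrable _ _ _ _ _ (\1_(I i)) 1) => //.
  exact: measurable_funTS.
rewrite integral_indic; [|by []|exact: measurable_itv].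
rewrite setIidl; last first.
  move=> s; rewrite /I /= !in_itv /= => /andP[a b]; apply/andP; split.
    by apply: le_trans a; rewrite mulr_ge0// ltW.
  apply: lt_le_trans b _; rewrite -nr ler_wpM2r ?(ltW r0)//.
  by rewrite ler_nat.
have iS : i.+1%:R * r = i%:R * r + r by rewrite -natr1; ring.
rewrite /= lebesgue_measure_itv /= lte_fin iS ltrDl r0 -EFinB -EFinM.
by congr _%:E; ring.
Qed.

(** Bounded convergence of the step functions along one path, which also yields measurability in
    time. The end point t is left out because the step functions vanish there. *)
Lemma path_cvg t w : 0 < t ->
  measurable_fun `[0, t[ (fun s => h (X s w)) /\
  grid_sum h (t / n%:R) n w @[n --> \oo] -->
    \int[lebesgue_measure]_(s in `[0, t[) h (X s w).
Proof.
move=> t0; rewrite (_ : (fun n => grid_sum h (t / n%:R) n w) = fun n =>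
    \int[lebesgue_measure]_(s in `[0, t[) grid_step n t w s); last first.
  by apply/funext => n; rewrite integral_grid_step.
have c1 s : `[0, t[%classic s -> grid_step n t w s @[n --> \oo] --> h (X s w).
  rewrite /= in_itv /= => /andP[s0 st]; apply: cvg_near_cst.
  apply: filterS (right_limit_grid w s0 st) => n [n0 e].
  by rewrite grid_stepE// e.
have c2 n s : `[0, t[%classic s -> `|grid_step n t w s| <= L.
  rewrite /= in_itv /= => /andP[s0 st].
  case: n => [|n]; last by rewrite grid_stepE.
  by rewrite /grid_step big_ord0 normr0; apply: le_trans (hL (X s w)).
have c3 n : measurable_fun (`[0, t[ : set R) (grid_step n t w).
  by apply: measurable_funTS; apply: measurable_grid_step.
exact: (Rintegral_cvg_bounded _ (lebesgue_itv_lty _ _ _ _) c3 c2 c1).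
Qed.

Lemma path_measurable t w : measurable_fun `[0, t] (fun s => h (X s w)).
Proof.
have [t0|t0] := leP 0 t; last first.
  rewrite set_itv_ge ?bnd_simp -?ltNge//; exact: measurable_fun_set0.
(* A longer half-open interval contains the closed one. *)
have [+ _] := @path_cvg (t + 1) w ltac:(lra).
apply: measurable_funS => // s /=; rewrite !in_itv /= => /andP[-> st] /=.
lra.
Qed.

Lemma path_integrable t w :
  lebesgue_measure.-integrable `[0, t] (EFin \o (fun s => h (X s w))).
Proof.
apply: (@bounded_itv_integrable _ _ _ _ _ _ L) => //; exact: path_measurable.
Qed.

Lemma path_integral_cvg t w : 0 < t ->
  grid_sum h (t / n%:R) n w @[n --> \oo] --> path_integral X h t w.
Proof.
move=> t0; have [_] := path_cvg w t0.
rewrite /path_integral Rintegral_itv_bndo_bndc//.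
by apply: integrableS (path_integrable t w) => //; apply: subset_itvl; rewrite bnd_simp.
Qed.

Lemma grid_sum_total_le t n w : 0 < t -> `|grid_sum h (t / n%:R) n w| <= L * t.
Proof.
move=> t0; have L0 : 0 <= L by apply: le_trans (hL (X 0 w)).
apply: le_trans (grid_sum_le _ _ _ hL) _; first by rewrite divr_ge0// ltW.
case: n => [|n]; first by rewrite mul0r mulr0 mulr_ge0// ltW.
by rewrite [_ * (t / _)]mulrC divfK.
Qed.

(** Measurability in the sample point is inherited from the grid sums, which depend on finitely many
    states. *)
Lemma bmf_path_integral t : 0 < t -> bmf (path_integral X h t).
Proof.
move=> t0.
have mG n : measurable_fun setT (grid_sum h (t / n%:R) n).
  by have [] := @bmf_grid h (t / n%:R) n (fun _ y => y)
    (divr_ge0 (ltW t0) (ler0n _ _)).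
have [||//] := @Ex_cvg _ _ _ P (fun n => grid_sum h (t / n%:R) n)
  (path_integral X h t) (L * t) mG.
- by move=> n w; apply: grid_sum_total_le.
- by move=> w; apply: path_integral_cvg.
Qed.

End PathIntegral.

End MarkovChain.

(** * The Dynkin inequality *)

Section Dynkin.
Context {R : realType} {S : finType}.
Variables (M : S -> S -> R) (h : S -> R) (L : R).
Hypothesis hL : forall x, `|h x| <= L.
Implicit Types (F D : S -> R -> R -> R) (s y r t B : R).

(** A grid step jumps first and then moves y with the slope of the new state, as in the
    right-endpoint sum. To first order jump and transport contribute separately. *)
Lemma transition_step_expansion t F D :
  (forall x, flow_diff t L (h x) (F x) (D x)) ->
  exists2 C : R, 0 <= C & forall x s y r,
    0 <= s -> 0 <= r -> r <= 1 -> s + r <= t -> `|y| <= L * s ->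
    `|\sum_z transition M r x z * F z (s + r) (y + r * h z) - F x s y
      - r * (D x s y + \sum_z M x z * F z s y)| <= C * r ^+ 2.
Proof.
move=> FD.
have /choice[K HK] : forall x, exists K : R, 0 <= K /\
  forall s y r, 0 <= s -> 0 <= r -> s + r <= t -> `|y| <= L * s ->
    [/\ `|F x (s + r) (y + r * h x) - F x s y - r * D x s y| <= K * r ^+ 2,
        `|F x (s + r) (y + r * h x)| <= K &
        `|F x (s + r) (y + r * h x) - F x s y| <= K * r].
  move=> x; have [K K0 HK] := flow_bounds (hL x) (FD x).
  exists K; split=> // s y r s0 r0 srt yL.
  by have [_ _ ? ? ?] := HK s y r s0 r0 srt yL.
have K0 x : 0 <= K x := (HK x).1.
pose K2 := \sum_x K x.
have KK2 x : K x <= K2 by rewrite /K2 (bigD1 x)//= lerDl sumr_ge0.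
have K20 : 0 <= K2 by apply: sumr_ge0.
have [C1 C10 HC1] := transition_expansion M.
pose A := \sum_x \sum_y `|M x y|.
have AM x : \sum_z `|M x z| <= A.
  by rewrite /A [leRHS](bigD1 x)//= lerDl sumr_ge0// => z _; rewrite sumr_ge0.
exists (K2 + A * K2 + #|S|%:R * (C1 * K2)).
  have A0 : 0 <= A by apply: sumr_ge0 => x _; apply: sumr_ge0.
  by rewrite !addr_ge0 ?mulr_ge0.
move=> x s y r s0 r0 r1 srt yL.
pose F1 z := F z (s + r) (y + r * h z).
pose e z := transition M r x z - ((x == z)%:R + r * M x z).
(* Three errors, each O(r^2): transport without a jump, the rate term evaluated at the moved point
   instead of (s, y), and the remainder of the matrix exponential. *)
have -> : \sum_z transition M r x z * F1 z - F x s y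
      - r * (D x s y + \sum_z M x z * F z s y) =
    (F1 x - F x s y - r * D x s y) + r * \sum_z M x z * (F1 z - F z s y)
    + \sum_z e z * F1 z.
  have -> : \sum_z M x z * (F1 z - F z s y) =
      \sum_z M x z * F1 z - \sum_z M x z * F z s y.
    by rewrite -sumrB; apply: eq_bigr => z _; ring.
  have -> : \sum_z transition M r x z * F1 z =
      F1 x + r * (\sum_z M x z * F1 z) + \sum_z e z * F1 z.
    have -> : F1 x = \sum_z (x == z)%:R * F1 z.
      rewrite (bigD1 x)//= eqxx mul1r big1 ?addr0// => z.
      by rewrite eq_sym => /negbTE ->; rewrite mul0r.
    rewrite mulr_sumr -!big_split /=; apply: eq_bigr => z _; rewrite /e; ring.
  ring.
apply: le_trans (ler_normD _ _) _.
apply: le_trans (lerD (ler_normD _ _) (lexx _)) _.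
rewrite 2![_ * r ^+ 2]mulrDl; apply: lerD; first apply: lerD.
- have [h1 _ _] := (HK x).2 s y r s0 r0 srt yL.
  by apply: le_trans h1 _; rewrite ler_wpM2r ?sqr_ge0.
- rewrite normrM (ger0_norm r0).
  have -> : A * K2 * r ^+ 2 = r * (A * (K2 * r)) by ring.
  rewrite ler_wpM2l//; apply: le_trans (ler_norm_sum _ _ _) _.
  apply: (@le_trans _ _ (\sum_z `|M x z| * (K2 * r))).
    apply: ler_sum => z _; rewrite normrM ler_wpM2l//.
    have [_ _ h3] := (HK z).2 s y r s0 r0 srt yL.
    by apply: le_trans h3 _; rewrite ler_wpM2r.
  by rewrite -mulr_suml ler_wpM2r// mulr_ge0.
- apply: le_trans (ler_norm_sum _ _ _) _.
  apply: (@le_trans _ _ (\sum_(z : S) C1 * r ^+ 2 * K2)).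
    apply: ler_sum => z _; rewrite normrM ler_pM//; first exact: HC1.
    have [_ h2 _] := (HK z).2 s y r s0 r0 srt yL.
    exact: le_trans h2 (KK2 z).
  rewrite sumr_const cardE -mulr_natl -cardE.
  by rewrite le_eqVlt; apply/orP; left; apply/eqP; ring.
Qed.

Context d (T : measurableType d) (P : probability T R).
Variables (nu : S -> R) (X : R -> T -> S).
Hypothesis hX : is_markov_chain P M nu X.

(* [D + M F] is the generator of the process [(s, X_s, int_0^s h(X))] applied
   to [F]. *)
Lemma dynkin t F D B : 0 < t ->
  (forall x, flow_diff t L (h x) (F x) (D x)) ->
  (forall x, continuous (F x t)) ->
  (forall x s y, 0 <= s -> s <= t -> `|y| <= L * s ->
    D x s y + \sum_z M x z * F z s y <= B) ->
  bmf (fun w => F (X t w) t (path_integral X h t w)) /\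
  Ex P (fun w => F (X t w) t (path_integral X h t w)) <=
  Ex P (fun w => F (X 0 w) 0 0) + B * t.
Proof.
move=> t0 FD cF DB; have [C C0 HC] := transition_step_expansion FD.
have nt n : n.+1%:R * (t / n.+1%:R) = t by rewrite mulrC divfK// pnatr_eq0.
pose Y n w := F (X t w) t (grid_sum X h (t / n.+1%:R) n.+1 w).
have r0 n : 0 <= t / n.+1%:R by rewrite divr_ge0// ltW.
have step n : t / n.+1%:R <= 1 ->
    Ex P (Y n) <= Ex P (fun w => F (X 0 w) 0 0) + B * t +
      C * t ^+ 2 * n.+1%:R^-1.
  move=> r1; have {}r0 := r0 n; set r := t / n.+1%:R in r0 r1.
  pose a k := Ex P (fun w => F (X (k%:R * r) w) (k%:R * r) (grid_sum X h r k w)).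
  (* Each step adds at most r B + C r^2. After n + 1 steps of length t / (n + 1) this is B t + C t^2
     / (n + 1). *)
  have le_a k : (k <= n.+1)%N -> a k <= a 0%N + k%:R * (r * B + C * r ^+ 2).
    elim: k => [|k IH] kn; first by rewrite mul0r addr0.
    have kS : k.+1%:R * r = k%:R * r + r by rewrite -natr1; ring.
    have krt : k%:R * r + r <= t by rewrite -kS -(nt n) ler_wpM2r// ler_nat.
    apply: (@le_trans _ _ (a k + (r * B + C * r ^+ 2))); last first.
      set Z := r * B + _; rewrite -[k.+1%:R]natr1 mulrDl mul1r [leRHS]addrA.
      by rewrite lerD2r IH// ltnW.
    rewrite /a (Ex_one_step hX h k (fun x => F x (k.+1%:R * r)) r0).
    rewrite -[X in _ + X](Ex_cst P) -ExD; last 2 first.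
    - exact: (bmf_grid hX h k (fun x => F x (k%:R * r)) r0).
    - exact: bmf_cst.
    apply: Ex_le.
    - exact: (bmf_grid hX h k (fun x y => \sum_z transition M r x z *
                F z (k.+1%:R * r) (y + r * h z)) r0).
    - apply: bmfD; last exact: bmf_cst.
      exact: (bmf_grid hX h k (fun x => F x (k%:R * r)) r0).
    move=> w; rewrite kS; set x := X _ w; set y := grid_sum _ _ _ _ w.
    have yL : `|y| <= L * (k%:R * r) by apply: grid_sum_le.
    have kr0 : 0 <= k%:R * r by rewrite mulr_ge0.
    have := HC x (k%:R * r) y r kr0 r0 r1 krt yL.
    have krt' : k%:R * r <= t by lra.
    have := ler_wpM2l r0 (DB x (k%:R * r) y kr0 krt' yL).
    set G := r * _; rewrite ler_norml => GB /andP[_]; lra.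
  have := le_a n.+1 (leqnn _); rewrite /a nt -/(Y n) => le_n.
  apply: le_trans le_n _.
  have -> : (fun w => F (X (0%:R * r) w) (0%:R * r) (grid_sum X h r 0 w)) =
      (fun w => F (X 0 w) 0 0).
    by apply/funext => w; rewrite mul0r /grid_sum big_ord0.
  rewrite -[leRHS]addrA lerD2l /r.
  move: (n.+1%:R : R) (pnatr_eq0 R n.+1) => N /negbT N0.
  by rewrite le_eqVlt; apply/orP; left; apply/eqP; field.
have [K _ HK] : exists2 K : R, 0 <= K &
    forall x y, `|y| <= L * t -> `|F x t y| <= K.
  have /choice[K HK] : forall x, exists K : R, 0 <= K /\
      forall y, `|y| <= L * t -> `|F x t y| <= K.
    move=> x; have [K K0 HK] := flow_bounds (hL x) (FD x).
    exists K; split=> // y yL.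
    by have [] := HK t y 0 (ltW t0) (lexx 0) ltac:(by rewrite addr0) yL.
  exists (\sum_x K x); first by apply: sumr_ge0 => x _; exact: (HK x).1.
  move=> x y yL; apply: le_trans ((HK x).2 y yL) _.
  by rewrite (bigD1 x)//= lerDl sumr_ge0// => z _; exact: (HK z).1.
have mY n : measurable_fun setT (Y n).
  have [+ _] := bmf_grid hX h n.+1 (fun x => F x t) (r0 n).
  by rewrite nt.
have bY n w : `|Y n w| <= K by apply/HK/grid_sum_total_le.
have cY w : Y n w @[n --> \oo] --> F (X t w) t (path_integral X h t w).
  have := @path_integral_cvg _ _ _ _ _ _ _ _ hX h L hL t w t0.
  rewrite -(cvg_shiftS (fun n => grid_sum X h (t / n%:R) n w)) => cG.
  by apply: continuous_cvg cG; apply: cF.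
have [bF cE] := Ex_cvg P mY bY cY; split=> //.
have cR : Ex P (Y n) - C * t ^+ 2 * n.+1%:R^-1 @[n --> \oo] -->
    Ex P (fun w => F (X t w) t (path_integral X h t w)).
  rewrite -[X in _ --> X]subr0 -[X in _ - X](mulr0 (C * t ^+ 2)).
  by apply: cvgB => //; apply: cvgMl_tmp; apply: cvg_harmonic.
apply: (cvgr_to_le cR).
(* From this rank on the step is at most 1, as the expansion requires. *)
exists (Num.truncn t).+1 => // n /= tn; rewrite lerBlDr; apply: step.
rewrite ler_pdivrMr ?ltr0n// mul1r ltW//.
apply: lt_le_trans (truncnS_gt _) _; rewrite ler_nat; exact: leq_trans tn _.
Qed.

Lemma dynkin_norm t F D B : 0 < t ->
  (forall x, flow_diff t L (h x) (F x) (D x)) ->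
  (forall x, continuous (F x t)) ->
  (forall x s y, 0 <= s -> s <= t -> `|y| <= L * s ->
    `|D x s y + \sum_z M x z * F z s y| <= B) ->
  bmf (fun w => F (X t w) t (path_integral X h t w)) /\
  `|Ex P (fun w => F (X t w) t (path_integral X h t w)) -
    Ex P (fun w => F (X 0 w) 0 0)| <= B * t.
Proof.
move=> t0 FD cF DB.
have DB' x s y : 0 <= s -> s <= t -> `|y| <= L * s ->
    D x s y + \sum_z M x z * F z s y <= B.
  by move=> s0 st yL; apply: le_trans (ler_norm _) (DB x s y s0 st yL).
have [bF up] := dynkin t0 FD cF DB'.
(* The lower bound is the one-sided inequality for - F. *)
have [|x s y s0 st yL|_ lo] := @dynkin t (fun x s y => - 1 * F x s y)
    (fun x s y => - 1 * D x s y) B t0 (fun x => flowZ (hL x) (- 1) (FD x)).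
- by move=> x y; apply: cvgMl_tmp; apply: cF.
- rewrite (_ : _ + _ = - (D x s y + \sum_z M x z * F z s y)).
    by rewrite lerNl; have := DB x s y s0 st yL; rewrite ler_norml => /andP[].
  rewrite opprD mulN1r -sumrN; congr (_ + _).
  by apply: eq_bigr => z _; ring.
split=> //; rewrite ler_norml lerBlDl lerBrDl up andbT.
move: lo; rewrite !ExZ//; last exact: (bmf_state hX (fun x => F x 0 0)).
lra.
Qed.

End Dynkin.

(** * Moments of centred path integrals *)

Section CentralLimitEstimates.
Context {R : realType} {S : finType}.
Variables (M : S -> S -> R) (pi : S -> R).
Hypothesis rev : reversible_generator M pi.
Variables (h chi : S -> R).
Hypothesis chiE : forall x, \sum_z M x z * chi z = - h x.

(** The Green-Kubo variance: twice the inner product of h with (- M)^(-1) h in L^2(pi). *)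
Definition asymptotic_variance : R := 2 * \sum_x pi x * (h x * chi x).
Local Notation v := asymptotic_variance.

(** Since h = - M chi, half of v is the Dirichlet form of [chi]. *)
Lemma asymptotic_variance_ge0 : 0 <= v.
Proof.
have := dirichlet_le0 rev chi; under eq_bigr do rewrite chiE.
rewrite (eq_bigr (fun x => - (pi x * (h x * chi x)))) => [|x _]; last by ring.
rewrite sumrN /asymptotic_variance; lra.
Qed.

(** The variance is exactly the constant for which h chi - v/2 is centred, so that its Poisson
    equation is solvable. *)
Lemma second_corrector :
  exists chi2, forall x, \sum_z M x z * chi2 z = v / 2 - h x * chi x.
Proof.
have [|chi2 e] := poisson rev (h := fun x => h x * chi x - v / 2).
  under eq_bigr do rewrite mulrBl.
  rewrite sumrB -mulr_sumr (rev_sum rev) mulr1 /asymptotic_variance.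
  rewrite (eq_bigr (fun x => pi x * (h x * chi x))) => [|x _]; last by ring.
  lra.
by exists chi2 => x; rewrite e opprB.
Qed.

Lemma fin_bound (f : S -> R) : exists2 C : R, 0 <= C & forall x, `|f x| <= C.
Proof.
exists (\sum_x `|f x|); first exact: sumr_ge0.
by move=> x; rewrite (bigD1 x)//= lerDl sumr_ge0.
Qed.

Lemma gen_row0 x : \sum_z M x z = 0.
Proof. exact: (rev_gen rev).2. Qed.

Context d (T : measurableType d) (P : probability T R).
Variables (nu : S -> R) (X : R -> T -> S).
Hypothesis hX : is_markov_chain P M nu X.

Local Notation W t w := (path_integral X h t w / Num.sqrt t).

(** The factor 1 + a k chi cancels the drift term of order k. A term of order k^2 is left, which the
    decay rate [la] k^2 dominates, so the corrected exponential is a supermartingale. *)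
Lemma exp_moment (a : R) : a ^+ 2 = 1 -> exists C t0 : R,
  [/\ 0 <= C, 0 < t0 & forall t, t0 <= t -> Ex P (fun w => expR (a * W t w)) <= C].
Proof.
move=> a2; have [L L0 hL] := fin_bound h; have [K K0 hK] := fin_bound chi.
have na : `|a| = 1 by apply/eqP; rewrite -sqrp_eq1// real_normK ?num_real ?a2.
(* The threshold forces k K <= 1/2, so the corrector factor lies in [1/2, 3/2]. Then [la] / 2 = L K
   dominates h chi, and the bound is 3/2 divided by e^(- la) / 2. *)
pose la := 2 * L * K; exists (3 * expR la), (4 * K ^+ 2 + 1).
have t0_gt0 : 0 < 4 * K ^+ 2 + 1 by rewrite ltr_pwDr// mulr_ge0 ?sqr_ge0.
split; [by rewrite mulr_ge0 ?expR_ge0|by []|move=> t t0t].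
have t0 : 0 < t by apply: lt_le_trans t0t.
pose k := (Num.sqrt t)^-1.
have k0 : 0 <= k by rewrite invr_ge0.
have k2 : k ^+ 2 * t = 1 by rewrite exprVn sqr_sqrtr ?mulVf ?gt_eqF// ltW.
have kK : k * K <= 2^-1.
  rewrite mulrC ler_pdivrMr ?sqrtr_gt0//.
  rewrite -(@ler_pXn2r _ 2)// ?nnegrE ?mulr_ge0 ?invr_ge0 ?sqrtr_ge0//.
  rewrite exprMn sqr_sqrtr ?ltW//; lra.
have corr x : 2^-1 <= 1 + a * k * chi x <= 3 / 2.
  have : `|a * k * chi x| <= 2^-1.
    rewrite !normrM na mul1r (ger0_norm k0); apply: le_trans _ kK.
    by rewrite ler_wpM2l.
  rewrite ler_norml; lra.
pose F x (s y : R) := expR (- (la * k ^+ 2) * s + a * k * y) * (1 + a * k * chi x).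
pose D x (s y : R) := expR (- (la * k ^+ 2) * s + a * k * y) *
  (- (la * k ^+ 2) + a * k * h x) * (1 + a * k * chi x).
have FD x : flow_diff t L (h x) (F x) (D x).
  apply: flow_eq (flowM (hL x) (flow_exp (hL x) (flowD (flowZ (hL x)
    (- (la * k ^+ 2)) (flow_time t L (h x))) (flowZ (hL x) (a * k)
    (flow_space t (hL x))))) (flow_cst t L (h x) (1 + a * k * chi x))) _ _ => //.
  by move=> s y _ _ _; rewrite /D /=; ring.
have cF x : continuous (F x t).
  move=> y; apply: cvgM; last exact: cvg_cst.
  apply: continuous_cvg; first exact: continuous_expR.
  apply: cvgD; first exact: cvg_cst.
  by apply: cvgMl_tmp; exact: cvg_id.
have DB x s y : 0 <= s -> s <= t -> `|y| <= L * s ->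
    D x s y + \sum_z M x z * F z s y <= 0.
  move=> _ _ _; set e := expR (- (la * k ^+ 2) * s + a * k * y).
  have -> : \sum_z M x z * F z s y = e * (- (a * k * h x)).
    rewrite (eq_bigr (fun z => e * (M x z + a * k * (M x z * chi z)))).
      by rewrite -mulr_sumr big_split /= gen_row0 add0r -mulr_sumr chiE mulrN.
    by move=> z _; rewrite /F -/e; ring.
  have -> : D x s y + e * - (a * k * h x) =
      e * k ^+ 2 * (a ^+ 2 * (h x * chi x) - la * (1 + a * k * chi x)).
    by rewrite /D -/e; ring.
  rewrite a2 mul1r mulr_ge0_le0 ?mulr_ge0 ?expR_ge0 ?sqr_ge0//.
  have hc : h x * chi x <= L * K.
    by apply: le_trans (ler_norm _) _; rewrite normrM ler_pM.
  have la0 : 0 <= la by rewrite !mulr_ge0.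
  have /andP[c1 _] := corr x.
  have := ler_wpM2l la0 c1; rewrite /la; lra.
have [bF] := dynkin hL hX t0 FD cF DB; rewrite mul0r addr0 => dyn.
have bS := bmf_path_integral hX hL t0.
have WE w : a * W t w = a * k * path_integral X h t w by rewrite /k; ring.
have bE : bmf (fun w => expR (a * W t w)).
  under eq_fun do rewrite WE; apply: bmf_continuous.
    exact: continuous_expR.
  exact: bmfZ.
have le_dyn : (2 * expR la)^-1 * Ex P (fun w => expR (a * W t w)) <= 3 / 2.
  rewrite -ExZ//.
  apply: (@le_trans _ _ (Ex P (fun w => F (X t w) t (path_integral X h t w)))).
    apply: Ex_le => //; first exact: bmfZ.
    move=> w; rewrite /F.
    have -> : - (la * k ^+ 2) * t = - la by rewrite mulNr -mulrA k2 mulr1.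
    rewrite expRD -WE expRN invfM.
    have /andP[c1 _] := corr (X t w).
    have e1 := expR_gt0 la; have e2 := expR_ge0 (a * W t w).
    rewrite [leLHS](_ : _ = (expR la)^-1 * expR (a * W t w) * (2^-1)); last by ring.
    by rewrite ler_wpM2l// mulr_ge0// invr_ge0 ltW.
  apply: le_trans dyn _; apply: Ex_le_cst.
    exact: (bmf_state hX (fun x => F x 0 0)).
  move=> w; rewrite /F !mulr0 addr0 expR0 mul1r.
  by have /andP[] := corr (X 0 w).
have e1 := expR_gt0 la.
move: le_dyn; rewrite mulrC ler_pdivrMr ?mulr_gt0//; lra.
Qed.

(** For x >= 0 raise x/4 <= e^(x/4) to the fourth power, with 256 = 4^4. *)
Lemma pow4_le_exp (x : R) : x ^+ 4 <= 256 * (expR x + expR (- x)).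
Proof.
wlog x0 : x / 0 <= x => [hw|].
  have [/hw//|/ltW x0] := leP 0 x.
  have := hw (- x); rewrite oppr_ge0 => /(_ x0).
  by rewrite opprK addrC (_ : (- x) ^+ 4 = x ^+ 4)//; ring.
have e0 := expR_ge0 (- x).
have -> : expR x = expR (x / 4) ^+ 4 by rewrite -expRM_natl; congr expR; field.
have e1 : x / 4 <= expR (x / 4) by have := expR_ge1Dx (x / 4); lra.
have : (x / 4) ^+ 4 <= expR (x / 4) ^+ 4.
  by rewrite lerXn2r ?nnegrE ?expR_ge0//; lra.
have -> : (x / 4) ^+ 4 = x ^+ 4 / 256 by field.
lra.
Qed.

(** The fourth moment is what later controls the mean squared error of the ratio. The second follows
    from u^2 <= u^4 + 1. *)
Lemma moment_bound : exists C t0 : R, [/\ 0 <= C, 1 <= t0 &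
  forall t, t0 <= t -> Ex P (fun w => W t w ^+ 2) <= C /\
                       Ex P (fun w => W t w ^+ 4) <= C].
Proof.
have [C1 [t1 [C10 t10 H1]]] := exp_moment (expr1n _ 2).
have [C2 [t2 [C20 t20 H2]]] := @exp_moment (- 1) (sqrr_sign _ 1).
exists (256 * (C1 + C2) + 1), (1 + t1 + t2); split; [lra|lra|].
move=> t tt; have t0 : 0 < t by lra.
have h1 := H1 t ltac:(lra); have h2 := H2 t ltac:(lra).
have [L L0 hL] := fin_bound h.
have bW : bmf (fun w => W t w).
  by under eq_fun do rewrite mulrC; apply/bmfZ/(bmf_path_integral hX hL t0).
have bX n : bmf (fun w => W t w ^+ n) by apply: bmfX.
have bE a : bmf (fun w => expR (a * W t w)).
  by apply: bmf_continuous (bmfZ _ bW); apply: continuous_expR.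
have h4 : Ex P (fun w => W t w ^+ 4) <= 256 * (C1 + C2).
  apply: (@le_trans _ _ (Ex P (fun w => 256 * (expR (1 * W t w) + expR (-1 * W t w))))).
    apply: Ex_le => // [|w]; first by apply/bmfZ/bmfD.
    by rewrite mul1r mulN1r pow4_le_exp.
  rewrite ExZ ?ExD//; last exact: bmfD.
  by rewrite ler_wpM2l//; apply: lerD.
split; last lra.
apply: (@le_trans _ _ (Ex P (fun w => W t w ^+ 4 + 1))).
  apply: Ex_le => // [|w]; first by apply: bmfD => //; apply: bmf_cst.
  have := sqr_ge0 (W t w ^+ 2 - 1); have := sqr_ge0 (W t w).
  have -> : (W t w ^+ 2 - 1) ^+ 2 = W t w ^+ 4 - 2 * W t w ^+ 2 + 1 by ring.
  lra.
by rewrite ExD// ?Ex_cst ?lerD2r//; apply: bmf_cst.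
Qed.

End CentralLimitEstimates.

Section SecondMoment.
Context {R : realType} {S : finType}.
Variables (M : S -> S -> R) (pi : S -> R).
Hypothesis rev : reversible_generator M pi.
Variables (h chi : S -> R).
Hypothesis chiE : forall x, \sum_z M x z * chi z = - h x.
Context d (T : measurableType d) (P : probability T R).
Variables (nu : S -> R) (X : R -> T -> S).
Hypothesis hX : is_markov_chain P M nu X.
Local Notation v := (asymptotic_variance pi h chi).
Local Notation W t w := (path_integral X h t w / Num.sqrt t).

Lemma second_moment_rate : exists C t0 : R, [/\ 0 <= C, 1 <= t0 &
  forall t, t0 <= t -> `|Ex P (fun w => W t w ^+ 2) - v| <= C / Num.sqrt t].
Proof.
have [chi2 chi2E] := second_corrector rev h chi.
have [L L0 hL] := fin_bound h; have [K K0 hK] := fin_bound chi.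
have [K2 K20 hK2] := fin_bound chi2.
have [C1 [t1 [C10 t11 H1]]] := moment_bound rev chiE hX.
exists (2 * K * (1 + C1) + 4 * K2), t1; split=> // [|t tt].
  by rewrite addr_ge0 ?mulr_ge0 ?addr_ge0.
have t0 : 0 < t by lra.
have [HW _] := H1 t tt.
set q := Num.sqrt t; have q2 : q ^+ 2 = t by rewrite sqr_sqrtr// ltW.
have q1 : 1 <= q by rewrite -sqrtr1 ler_sqrt//; lra.
have q0 : 0 < q by lra.
(* A quadratic has no third derivative, so with both correctors the cancellation is exact and
   Dynkin's formula has B = 0. *)
pose F x (s y : R) := y * y + (2 * chi x) * y + (2 * chi2 x + (- v) * s).
pose D x (s y : R) := 2 * y * h x + 2 * chi x * h x - v.
have FD x : flow_diff t L (h x) (F x) (D x).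
  have fy := flow_space t (hL x); have hLx := hL x.
  have f1 := flowD (flowM hLx fy fy) (flowZ hLx (2 * chi x) fy).
  have f2 := flowD (flow_cst t L (h x) (2 * chi2 x))
    (flowZ hLx (- v) (flow_time t L (h x))).
  apply: (flow_eq (flowD f1 f2)) => //.
  by move=> s y _ _ _; rewrite /D /=; ring.
have cF x : continuous (F x t).
  move=> y; apply: cvgD; last exact: cvg_cst.
  by apply: cvgD; [apply: cvgM; exact: cvg_id|apply: cvgMl_tmp; exact: cvg_id].
have DB x s y : 0 <= s -> s <= t -> `|y| <= L * s ->
    `|D x s y + \sum_z M x z * F z s y| <= 0.
  move=> _ _ _; rewrite (eq_bigr (fun z => M x z * (y * y - v * s) +
    (2 * y * (M x z * chi z) + 2 * (M x z * chi2 z)))); last first.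
    by move=> z _; rewrite /F; ring.
  rewrite !big_split /= -mulr_suml (gen_row0 rev) -!mulr_sumr chiE chi2E.
  rewrite (_ : D x s y + _ = 0); first by rewrite normr0.
  by rewrite /D; field.
have [bF] := dynkin_norm hL hX t0 FD cF DB.
rewrite mul0r normr_le0 subr_eq0 => /eqP EF.
have F0 : `|Ex P (fun w => F (X 0 w) 0 0)| <= 2 * K2.
  have b0 : bmf (fun w => F (X 0 w) 0 0).
    exact: (bmf_state hX (fun x => F x 0 0)).
  apply: le_trans (Ex_norm P b0) _; apply: Ex_le_cst; first exact: bmf_norm.
  move=> w; rewrite /F !mulr0 !add0r addr0 normrM ger0_norm//.
  by rewrite ler_wpM2l.
have bS := bmf_path_integral hX hL t0.
have bW : bmf (fun w => W t w) by under eq_fun do rewrite mulrC; apply: bmfZ.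
have SW w : path_integral X h t w = q * W t w by rewrite mulrC divfK// gt_eqF.
(* What remains is the corrector part 2 chi y + 2 chi2 at time t, of mean size O(sqrt t), against a
   main term multiplied by t. *)
pose G w := F (X t w) t (path_integral X h t w) - t * (W t w ^+ 2 - v).
have bWv : bmf (fun w => W t w ^+ 2 - v).
  by apply: bmfB; [apply: bmfX|apply: bmf_cst].
have bG : bmf G by apply: bmfB => //; apply: bmfZ.
have GE w : `|G w| <= q * (2 * K * (1 + W t w ^+ 2) + 2 * K2).
  have -> : G w = 2 * chi (X t w) * (q * W t w) + 2 * chi2 (X t w).
    by rewrite /G /F; move: (W t w) (SW w) => u ->; rewrite -q2; ring.
  move: (W t w) (chi (X t w)) (hK (X t w)) (chi2 (X t w)) (hK2 (X t w)).
  move=> u c cK c2 c2K.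
  apply: le_trans (ler_normD _ _) _; rewrite !normrM !(ger0_norm (ltW q0)).
  rewrite (ger0_norm (ler0n _ 2)).
  have h1 : `|u| <= 1 + u ^+ 2.
    rewrite -(real_normK (num_real (u))).
    have := sqr_ge0 (`|u| - 1); have := sqr_ge0 `|u|.
    have -> : (`|u| - 1) ^+ 2 = `|u| ^+ 2 - 2 * `|u| + 1 by ring.
    lra.
  have h2 : `|c| * `|u| <= K * (1 + u ^+ 2) by rewrite ler_pM.
  have h3 : q * (`|c| * `|u|) <= q * (K * (1 + u ^+ 2)).
    by rewrite ler_wpM2l// ltW.
  have h4 : `|c2| <= q * K2.
    by apply: le_trans c2K _; rewrite ler_peMl.
  lra.
have EG : `|Ex P G| <= q * (2 * K * (1 + C1) + 2 * K2).
  apply: le_trans (Ex_norm P bG) _.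
  have b1 : bmf (fun w => 1 + W t w ^+ 2) by apply: bmfD (bmf_cst _ _) (bmfX _ bW).
  apply: (@le_trans _ _ (Ex P (fun w => q * (2 * K * (1 + W t w ^+ 2) + 2 * K2)))).
    apply: Ex_le => //; first exact: bmf_norm.
    by apply/bmfZ/bmfD; [apply: bmfZ|apply: bmf_cst].
  rewrite ExZ; last by apply: bmfD; [apply: bmfZ|apply: bmf_cst].
  rewrite ler_wpM2l ?(ltW q0)// ExD ?Ex_cst ?lerD2r; [|exact: bmfZ|exact: bmf_cst].
  rewrite ExZ// ler_wpM2l ?mulr_ge0// ExD ?Ex_cst ?lerD2l//; [exact: bmf_cst|exact: bmfX].
have EGE : Ex P G = Ex P (fun w => F (X 0 w) 0 0) -
    t * (Ex P (fun w => W t w ^+ 2) - v).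
  rewrite /G ExB//; last exact: bmfZ.
  rewrite ExZ// ExB ?Ex_cst ?EF//; [exact: bmfX|exact: bmf_cst].
rewrite ler_pdivlMr// -(ler_pM2l q0).
have -> : q * (`|Ex P (fun w => W t w ^+ 2) - v| * q) =
    `|t * (Ex P (fun w => W t w ^+ 2) - v)|.
  by rewrite normrM (gtr0_norm t0) -q2; ring.
have -> : t * (Ex P (fun w => W t w ^+ 2) - v) =
  Ex P (fun w => F (X 0 w) 0 0) - Ex P G by rewrite EGE; ring.
apply: le_trans (ler_normB _ _) _.
have : 2 * K2 <= q * (2 * K2) by rewrite ler_peMl// mulr_ge0.
lra.
Qed.

End SecondMoment.

(** * Gaussian test functions *)

Section GaussianKernel.
Context {R : realType}.
Implicit Types (i z : R).

(* [sqrt (2 pi)] times the centred normal density of variance [1 / i]. *)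
Definition gauss_kernel i z : R := Num.sqrt i * expR (- (z * z * i / 2)).

Lemma gauss_kernel_ge0 i z : 0 <= gauss_kernel i z.
Proof. by rewrite mulr_ge0 ?sqrtr_ge0 ?expR_ge0. Qed.

Lemma continuous_gauss_kernel i : continuous (gauss_kernel i).
Proof.
move=> z; apply: cvgMl_tmp; apply: continuous_cvg; first exact: continuous_expR.
apply: cvgN; do 2 (apply: cvgM; last exact: cvg_cst).
by apply: cvgM; exact: cvg_id.
Qed.

(** With u = q^2 / 2, q^4 = 16 (u/2)^2 and (u/2)^2 <= e^u give 16 for n = 4. Lower powers are at
    most 1 + q^4, whence 17. *)
Lemma pow_gauss_le n (q : R) : (n <= 4)%N ->
  `|q| ^+ n * expR (- (q ^+ 2 / 2)) <= 17.
Proof.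
move=> n4; set u := q ^+ 2 / 2.
have u0 : 0 <= u by rewrite divr_ge0 ?sqr_ge0.
have e0 := expR_ge0 (- u).
have e1 : expR (- u) <= 1 by rewrite -expR0 ler_expR oppr_le0.
have e4 : `|q| ^+ 4 * expR (- u) <= 16.
  have h : u / 2 <= expR (u / 2) by have := expR_ge1Dx (u / 2); lra.
  have h2 : (u / 2) ^+ 2 <= expR u.
    have -> : expR u = expR (u / 2) ^+ 2 by rewrite -expRM_natl; congr expR; field.
    by rewrite lerXn2r ?nnegrE ?expR_ge0//; lra.
  have -> : `|q| ^+ 4 = 16 * (u / 2) ^+ 2.
    have -> : `|q| ^+ 4 = (`|q| ^+ 2) ^+ 2 by rewrite -exprM.
    by rewrite real_normK ?num_real// /u; field.
  have : (u / 2) ^+ 2 * expR (- u) <= 1.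
    apply: (@le_trans _ _ (expR u * expR (- u))); first by rewrite ler_wpM2r.
    by rewrite -expRD subrr expR0.
  rewrite -mulrA; lra.
have le : `|q| ^+ n <= 1 + `|q| ^+ 4.
  have [q1|/ltW q1] := leP `|q| 1.
    by rewrite ler_wpDr ?exprn_ge0// exprn_ile1.
  by rewrite ler_wpDl// ler_weXn2l.
apply: (@le_trans _ _ ((1 + `|q| ^+ 4) * expR (- u))).
  by rewrite ler_wpM2r.
rewrite mulrDl mul1r; lra.
Qed.

(* With [q = z sqrt i] these are the first four [z]-derivatives of
   [gauss_kernel i]. *)
Lemma gauss_kernel_derivatives i0 : 0 <= i0 -> exists2 C : R, 0 <= C &
  forall i z, 0 <= i -> i <= i0 ->
  [/\ `|z * i * gauss_kernel i z| <= C,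
      `|(z * z * (i * i) - i) * gauss_kernel i z| <= C,
      `|(3 * z * i ^+ 2 - z ^+ 3 * i ^+ 3) * gauss_kernel i z| <= C &
      `|(3 * i ^+ 2 - 6 * z ^+ 2 * i ^+ 3 + z ^+ 4 * i ^+ 4) *
        gauss_kernel i z| <= C].
Proof.
(* J dominates both i and its square root, so each prefactor is at most J^3. The largest sum of
   coefficients is 3 + 6 + 1, and 170 = 10 * 17. *)
move=> i00; pose J := 1 + i0; exists (170 * J ^+ 3).
  by rewrite mulr_ge0// exprn_ge0// addr_ge0.
move=> i z ige0 ile; set p := Num.sqrt i.
have p0 : 0 <= p by exact: sqrtr_ge0.
have p2 : p ^+ 2 = i by rewrite sqr_sqrtr.
have J1 : 1 <= J by rewrite lerDl.
have pJ : p <= J.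
  have := sqr_ge0 (p - 1); have -> : (p - 1) ^+ 2 = i - 2 * p + 1 by rewrite -p2; ring.
  rewrite /J; lra.
have iJ : i <= J by rewrite /J; lra.
pose q := z * p; pose e := expR (- (q ^+ 2 / 2)).
have e0 : 0 <= e := expR_ge0 _.
have gE : gauss_kernel i z = p * e.
  rewrite /gauss_kernel -/p /e; congr (_ * expR (- (_ / 2))).
  by rewrite /q -p2; ring.
have qe n : (n <= 4)%N -> `|q ^+ n * e| <= 17.
  by move=> n4; rewrite normrM normrX (ger0_norm e0); apply: pow_gauss_le.
have e17 : `|e| <= 17 by have := qe 0%N isT; rewrite expr0 mul1r.
have q1 : `|q * e| <= 17 := qe 1%N isT.
have q2 := qe 2%N isT; have q3 := qe 3%N isT; have q4 := qe 4%N isT.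
have bound (c A : R) : 0 <= c -> c <= J ^+ 3 -> `|A| <= 170 ->
    `|c * A| <= 170 * J ^+ 3.
  by move=> c0 cJ AB; rewrite normrM (ger0_norm c0) mulrC ler_pM.
have J0 : 0 <= J by lra.
have J12 : J <= J ^+ 3 by rewrite ler_eXnr.
have ip : i * p <= J ^+ 3.
  apply: (@le_trans _ _ (J ^+ 2)); first by rewrite expr2 ler_pM.
  by rewrite ler_weXn2l.
have ii : i ^+ 2 <= J ^+ 3.
  apply: (@le_trans _ _ (J ^+ 2)); first by rewrite lerXn2r ?nnegrE.
  by rewrite ler_weXn2l.
have iip : i ^+ 2 * p <= J ^+ 3.
  rewrite [leRHS]exprSr; apply: ler_pM => //; first exact: sqr_ge0.
  by rewrite lerXn2r ?nnegrE.
rewrite ler_norml in e17; rewrite ler_norml in q1; rewrite ler_norml in q2.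
rewrite ler_norml in q3; rewrite ler_norml in q4.
move: e17 q1 q2 q3 q4 => /andP[? ?] /andP[? ?] /andP[? ?] /andP[? ?] /andP[? ?].
rewrite gE; split.
- have -> : z * i * (p * e) = i * (q * e) by rewrite /q; ring.
  by apply: bound; rewrite ?ler_norml; lra.
- have -> : (z * z * (i * i) - i) * (p * e) = (i * p) * (q ^+ 2 * e - e).
    by rewrite /q -p2; ring.
  by apply: bound; rewrite ?mulr_ge0 ?ler_norml//; lra.
- have -> : (3 * z * i ^+ 2 - z ^+ 3 * i ^+ 3) * (p * e) =
      i ^+ 2 * (3 * (q * e) - q ^+ 3 * e).
    by rewrite /q -p2; ring.
  by apply: bound; rewrite ?sqr_ge0 ?ler_norml//; lra.
- have -> : (3 * i ^+ 2 - 6 * z ^+ 2 * i ^+ 3 + z ^+ 4 * i ^+ 4) * (p * e) =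
      (i ^+ 2 * p) * (3 * e - 6 * (q ^+ 2 * e) + q ^+ 4 * e).
    by rewrite /q -p2; ring.
  by apply: bound; rewrite ?mulr_ge0 ?sqr_ge0 ?ler_norml//; lra.
Qed.

End GaussianKernel.

(** * Rate of convergence of the Gaussian-smoothed densities *)

Section GaussianTestFunctions.
Context {R : realType} {S : finType}.
Variables (M : S -> S -> R) (pi : S -> R).
Hypothesis rev : reversible_generator M pi.
Variables (h chi : S -> R).
Hypothesis chiE : forall x, \sum_z M x z * chi z = - h x.
Context d (T : measurableType d) (P : probability T R).
Variables (nu : S -> R) (X : R -> T -> S).
Hypothesis hX : is_markov_chain P M nu X.
Local Notation v := (asymptotic_variance pi h chi).
Local Notation W t w := (path_integral X h t w / Num.sqrt t).

Implicit Types (s y t L eta b k a : R).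

(** [i] is the inverse of the variance still to be run, which decreases from b + v at time 0 to b at
    time t since k^2 t = 1. With it the kernel solves the backward heat equation of diffusivity v/2
    in y. *)
Lemma gauss_flow t L eta b k a : 0 < b -> `|eta| <= L ->
  k ^+ 2 * t = 1 ->
  let i s := (b + v + - (v * k ^+ 2) * s)^-1 in
  let z y := k * y + - a in
  [/\ flow_diff t L eta (fun s _ => i s)
        (fun s _ => i s * i s * (v * k ^+ 2)),
      flow_diff t L eta (fun _ y => z y) (fun _ _ => k * eta) &
      flow_diff t L eta (fun s y => gauss_kernel (i s) (z y))
        (fun s y => gauss_kernel (i s) (z y) * (i s * (v * k ^+ 2) / 2
           - k * eta * z y * i s
           - z y * z y * i s * i s * (v * k ^+ 2) / 2))].
Proof.
move=> b0 etaL kt i z.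
have v0 : 0 <= v := asymptotic_variance_ge0 rev chiE.
have vk0 : 0 <= v * k ^+ 2 by rewrite mulr_ge0 ?sqr_ge0.
have rb s : s <= t -> b <= b + v + - (v * k ^+ 2) * s.
  move=> st; have : v * k ^+ 2 * s <= v.
    by rewrite -[leRHS]mulr1 -kt mulrA ler_wpM2l.
  lra.
have ge_i s y : 0 <= s -> s <= t -> `|y| <= L * s -> (b + v)^-1 <= i s.
  move=> s0 st _; have r0 := lt_le_trans b0 (rb s st).
  have vs0 := mulr_ge0 vk0 s0.
  by rewrite lef_pV2 ?posrE//; lra.
have bv0 : 0 < (b + v)^-1 by rewrite invr_gt0; lra.
have fr : flow_diff t L eta (fun s _ => b + v + - (v * k ^+ 2) * s)
    (fun _ _ => 0 + - (v * k ^+ 2) * 1).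
  exact: flowD (flow_cst t L eta (b + v)) (flowZ etaL _ (flow_time t L eta)).
have fi : flow_diff t L eta (fun s _ => i s)
    (fun s _ => i s * i s * (v * k ^+ 2)).
  apply: (flow_eq (flow_inv etaL b0 (fun s _ _ st _ => rb s st) fr)) => //.
  by move=> s y _ _ _; rewrite -/(i s); ring.
have fz : flow_diff t L eta (fun _ y => z y) (fun _ _ => k * eta).
  apply: (flow_eq (flowD (flowZ etaL k (flow_space t etaL))
    (flow_cst t L eta (- a)))) => //.
  by move=> s y _ _ _; rewrite addr0.
split=> //.
have fe := flow_exp etaL (flowZ etaL (- 2^-1)
  (flowM etaL (flowM etaL fz fz) fi)).
have fs := flow_sqrt etaL bv0 ge_i fi.
have fm := flowM etaL fs fe.
apply: (flow_eq fm).
  by move=> s y; rewrite /gauss_kernel; congr (_ * expR _); field.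
move=> s y s0 st yL; rewrite /gauss_kernel.
have -> : - (z y * z y * i s / 2) = - 2^-1 * (z y * z y * i s) by field.
have i0 : 0 < i s by apply: lt_le_trans bv0 (ge_i s y s0 st yL).
have p2 := sqr_sqrtr (ltW i0).
have p0 : Num.sqrt (i s) != 0 by rewrite gt_eqF// sqrtr_gt0.
move: (expR _) => e; move: (Num.sqrt (i s)) p2 p0 => p p2 p0.
by rewrite -p2; field.
Qed.

Lemma gauss_clt_rate b : 0 < b -> exists C : R, 0 <= C /\
  forall t a, 1 <= t ->
    `|Ex P (fun w => gauss_kernel b^-1 (W t w - a)) -
      gauss_kernel (b + v)^-1 a| <= C / Num.sqrt t.
Proof.
move=> b0; have [chi2 chi2E] := second_corrector rev h chi.
have v0 : 0 <= v := asymptotic_variance_ge0 rev chiE.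
have [L L0 hL] := fin_bound h; have [K K0 hK] := fin_bound chi.
have [K2 K20 hK2] := fin_bound chi2.
have ib0 : 0 <= b^-1 by rewrite invr_ge0 ltW.
have [C C0 HC] := gauss_kernel_derivatives ib0.
pose B := (L * K2 + v * K + v * K2) * C.
have B0 : 0 <= B.
  have := mulr_ge0 L0 K20; have := mulr_ge0 v0 K0; have := mulr_ge0 v0 K20.
  by move=> *; rewrite /B mulr_ge0//; lra.
exists (B + 2 * ((K + K2) * C)); split.
  by apply: addr_ge0 => //; do 2 (apply: mulr_ge0 => //); apply: addr_ge0.
move=> t a t1; have t0 : 0 < t by lra.
pose k := (Num.sqrt t)^-1.
have q1 : 1 <= Num.sqrt t by rewrite -[leLHS]sqrtr1 ler_sqrt//; lra.
have k0 : 0 <= k by rewrite invr_ge0.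
have k1 : k <= 1 by rewrite invf_le1//; lra.
have k2 : k ^+ 2 * t = 1 by rewrite exprVn sqr_sqrtr ?mulVf ?gt_eqF// ltW.
pose i s := (b + v + - (v * k ^+ 2) * s)^-1.
pose z y := k * y + - a.
pose G s y := gauss_kernel (i s) (z y).
(* F is phi + chi phi' + chi2 phi'' for phi = G: the y-derivatives of G are - k z i G and k^2 (z^2
   i^2 - i) G. *)
pose Pm x (s y : R) := 1 + (- (k * chi x) * (z y * i s) +
  k ^+ 2 * chi2 x * (z y * z y * (i s * i s) + - 1 * i s)).
pose F x s y := G s y * Pm x s y.
pose D x s y := G s y * (i s * (v * k ^+ 2) / 2 - k * h x * z y * i s
           - z y * z y * i s * i s * (v * k ^+ 2) / 2) * Pm x s y +
  G s y * (- (k * chi x) * (k * h x * i s + z y * (i s * i s * (v * k ^+ 2))) +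
    k ^+ 2 * chi2 x * (2 * z y * (k * h x) * (i s * i s)
      + z y * z y * (2 * i s * (i s * i s * (v * k ^+ 2)))
      - i s * i s * (v * k ^+ 2))).
have FD x : flow_diff t L (h x) (F x) (D x).
  have hx := hL x; have [fi fz fG] := gauss_flow a b0 hx k2.
  have f1 := flowZ hx (- (k * chi x)) (flowM hx fz fi).
  have f2 := flowZ hx (k ^+ 2 * chi2 x) (flowD (flowM hx (flowM hx fz fz)
     (flowM hx fi fi)) (flowZ hx (- 1) fi)).
  have fP := flowD (flow_cst t L (h x) 1) (flowD f1 f2).
  apply: (flow_eq (flowM hx fG fP)) => //.
  move=> s y _ _ _; rewrite /D /G /Pm /i /z; ring.
have cF x : continuous (F x t).
  move=> y; have cz : z u @[u --> y] --> z y.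
    by apply: cvgD; [apply: cvgMl_tmp; exact: cvg_id|exact: cvg_cst].
  apply: cvgM.
    by apply: continuous_cvg cz; apply: continuous_gauss_kernel.
  apply: cvgD; first exact: cvg_cst.
  apply: cvgD; apply: cvgMl_tmp; first by apply: cvgM => //; exact: cvg_cst.
  apply: cvgD; last exact: cvg_cst.
  by apply: cvgM; [apply: cvgM|exact: cvg_cst].
have i_bounds s : 0 <= s -> s <= t -> 0 <= i s <= b^-1.
  move=> s0 st; have h1 : v * k ^+ 2 * s <= v.
    apply: (@le_trans _ _ (v * k ^+ 2 * t)).
      by rewrite ler_wpM2l// mulr_ge0 ?sqr_ge0.
    by rewrite -mulrA k2 mulr1.
  have h2 : b <= b + v + - (v * k ^+ 2) * s by lra.
  by rewrite /i invr_ge0 (le_trans (ltW b0) h2) lef_pV2// posrE; lra.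
(* The heat equation and the two Poisson equations cancel orders k and k^2. The third and fourth
   derivatives of the kernel remain, with factors k^3 and k^4. Over a time t = k^(-2) they
   contribute O(k). *)
have DMF x s y : D x s y + \sum_z M x z * F z s y =
  k ^+ 3 * ((h x * chi2 x - v * chi x / 2) *
    ((3 * z y * i s ^+ 2 - z y ^+ 3 * i s ^+ 3) * G s y)) -
  k ^+ 4 * (v * chi2 x / 2 *
    ((3 * i s ^+ 2 - 6 * z y ^+ 2 * i s ^+ 3 + z y ^+ 4 * i s ^+ 4) * G s y)).
  rewrite (eq_bigr (fun u => M x u * G s y + (- (k * z y * i s * G s y) *
    (M x u * chi u) + k ^+ 2 * (z y * z y * (i s * i s) - i s) * G s y *
    (M x u * chi2 u)))); last by move=> u _; rewrite /F /Pm; ring.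
  rewrite !big_split /= -mulr_suml (gen_row0 rev) -!mulr_sumr chiE chi2E.
  by rewrite /D /Pm; field.
have k3 : 0 <= k ^+ 3 by rewrite exprn_ge0.
have k43 : k ^+ 4 <= k ^+ 3 by rewrite ler_wiXn2l.
have DB x s y : 0 <= s -> s <= t -> `|y| <= L * s ->
    `|D x s y + \sum_z M x z * F z s y| <= B * k ^+ 3.
  move=> s0 st _; rewrite DMF.
  have /andP[i0 ib] := i_bounds s s0 st.
  have [_ _ u3 u4] := HC (i s) (z y) i0 ib; rewrite -/(G s y) in u3 u4.
  move: (_ * G s y) u3 => U3 u3; move: (_ * G s y) u4 => U4 u4.
  have e3 : `|(h x * chi2 x - v * chi x / 2) * U3| <= (L * K2 + v * K / 2) * C.
    move: (asymptotic_variance pi h chi) v0 => V V0.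
    rewrite normrM ler_pM//; apply: le_trans (ler_normB _ _) _.
    rewrite !normrM (ger0_norm V0) (ger0_norm (_ : 0 <= 2^-1)) ?invr_ge0//.
    have := ler_pM (normr_ge0 _) (normr_ge0 _) (hL x) (hK2 x).
    have := ler_wpM2l V0 (hK x); lra.
  have e4 : `|v * chi2 x / 2 * U4| <= (v * K2 / 2) * C.
    move: (asymptotic_variance pi h chi) v0 => V V0.
    rewrite normrM ler_pM// !normrM (ger0_norm V0).
    rewrite (ger0_norm (_ : 0 <= 2^-1)) ?invr_ge0//.
    by rewrite ler_wpM2r ?invr_ge0// ler_wpM2l.
  apply: le_trans (ler_normB _ _) _; rewrite !(normrM (k ^+ _)).
  rewrite (ger0_norm k3) (ger0_norm (exprn_ge0 4 k0)).
  have e3' := ler_wpM2l k3 e3.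
  have e4' : k ^+ 4 * `|v * chi2 x / 2 * U4| <= k ^+ 3 * ((v * K2 / 2) * C).
    by rewrite ler_pM ?exprn_ge0.
  have n1 : 0 <= k ^+ 3 * (v * K * C) by do 3 (apply: mulr_ge0 => //).
  have n2 : 0 <= k ^+ 3 * (v * K2 * C) by do 3 (apply: mulr_ge0 => //).
  rewrite /B; lra.
have [bF dyn] := dynkin_norm hL hX t0 FD cF DB.
(* The correctors change the kernel by O(k). This is paid at time 0 and at time t, hence the factor
   2 in the constant. *)
have corr x s y : 0 <= s -> s <= t -> `|F x s y - G s y| <= (K + K2) * C * k.
  move=> s0 st; have /andP[i0 ib] := i_bounds s s0 st.
  have [u1 u2 _ _] := HC (i s) (z y) i0 ib; rewrite -/(G s y) in u1 u2.
  have -> : F x s y - G s y = - (k * (chi x * (z y * i s * G s y))) +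
      k ^+ 2 * (chi2 x * ((z y * z y * (i s * i s) - i s) * G s y)).
    by rewrite /F /Pm; ring.
  apply: le_trans (ler_normD _ _) _; rewrite normrN !(normrM (k ^+ _)) (normrM k).
  rewrite (ger0_norm k0) (ger0_norm (sqr_ge0 k)).
  move: (_ * G s y) u1 => U1 u1; move: (_ * G s y) u2 => U2 u2.
  have e1 : k * `|chi x * U1| <= k * (K * C).
    by rewrite ler_wpM2l// normrM ler_pM.
  have e2 : k ^+ 2 * `|chi2 x * U2| <= k * (K2 * C).
    by rewrite normrM ler_pM ?sqr_ge0 ?mulr_ge0// ?ler_pM// expr2 ler_piMr.
  lra.
have bS := bmf_path_integral hX hL t0.
have zE w : z (path_integral X h t w) = W t w - a by rewrite /z /k; ring.
have GtE w : G t (path_integral X h t w) = gauss_kernel b^-1 (W t w - a).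
  rewrite /G zE; congr (gauss_kernel _^-1 _); rewrite mulNr -mulrA k2; ring.
have G0E : G 0 0 = gauss_kernel (b + v)^-1 a.
  rewrite /G /gauss_kernel /i /z !mulr0 !addr0 add0r.
  by congr (_ * expR (- (_ / 2))); ring.
have bG : bmf (fun w => gauss_kernel b^-1 (W t w - a)).
  apply: bmf_continuous; first exact: continuous_gauss_kernel.
  apply: bmfB; last exact: bmf_cst.
  by under eq_fun do rewrite mulrC; apply: bmfZ.
have b0F : bmf (fun w => F (X 0 w) 0 0).
  exact: (bmf_state hX (fun x => F x 0 0)).
have c1 : `|Ex P (fun w => F (X t w) t (path_integral X h t w)) -
    Ex P (fun w => gauss_kernel b^-1 (W t w - a))| <= (K + K2) * C * k.
  rewrite -ExB//; apply: le_trans (Ex_norm P (bmfB bF bG)) _.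
  apply: Ex_le_cst => [|w]; first exact/bmf_norm/bmfB.
  by rewrite -GtE; apply: corr => //; exact: ltW.
have c0 : `|Ex P (fun w => F (X 0 w) 0 0) - gauss_kernel (b + v)^-1 a|
    <= (K + K2) * C * k.
  rewrite -(Ex_cst P (gauss_kernel (b + v)^-1 a)) -ExB//; last exact: bmf_cst.
  apply: le_trans (Ex_norm P (bmfB b0F (bmf_cst _ _))) _.
  apply: Ex_le_cst => [|w]; first by apply/bmf_norm/bmfB => //; apply: bmf_cst.
  by rewrite -G0E; apply: corr => //; exact: ltW.
have dyn' : B * k ^+ 3 * t = B * k.
  by rewrite exprS -(mulr1 (B * k)) -k2; ring.
rewrite dyn' in dyn; rewrite -/k.
move: c1 c0 dyn; rewrite !ler_norml => /andP[? ?] /andP[? ?] /andP[? ?].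
lra.
Qed.

End GaussianTestFunctions.

(** * The law of large numbers *)

Section LawOfLargeNumbers.
Context {R : realType}.

(** The sum of the Z_n has finite expectation, so it is finite almost everywhere and its terms tend
    to 0. *)
Lemma ae_cvg0_of_sum d (T : measurableType d) (P : probability T R)
    (Z : nat -> T -> R) (C : R) :
  (forall n, bmf (Z n)) -> (forall n w, 0 <= Z n w) ->
  (forall N, \sum_(0 <= n < N) Ex P (Z n) <= C) ->
  {ae P, forall w, Z n w @[n --> \oo] --> 0}.
Proof.
move=> bZ Z0 sumZ; pose F w := (\sum_(n <oo) (Z n w)%:E)%E.
have ZE0 n w : setT w -> (0 <= (Z n w)%:E)%E by rewrite lee_fin.
have mZ n : measurable_fun setT (fun w => (Z n w)%:E).
  by apply/measurable_EFinP; have [] := bZ n.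
have F0 w : (0 <= F w)%E by apply: nneseries_ge0 => n _ _; rewrite lee_fin.
have mF : measurable_fun setT F.
  exact: (@ge0_emeasurable_sum _ _ _ setT (fun n w => (Z n w)%:E) xpredT
    (fun n w Dw _ => ZE0 n w Dw) (fun n _ => mZ n)).
have intF : (\int[P]_w F w <= C%:E)%E.
  rewrite integral_nneseries//; apply: lime_le.
    by apply: is_cvg_nneseries => n _ _; apply: integral_ge0 => w _; apply: ZE0.
  apply: nearW => N.
  rewrite (eq_bigr (fun n => (Ex P (Z n))%:E)) => [|n _].
    by rewrite sumEFin lee_fin.
  by rewrite -expectationE// unlock.
have iF : P.-integrable setT F.
  apply/integrableP; split=> //.
  under eq_integral do rewrite gee0_abs//.
  exact: le_lt_trans intF (ltry _).
apply: filterS (integrable_ae measurableT iF) => w /(_ I) Fw.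
apply: cvg_series_cvg_0; apply: nondecreasing_is_cvgn.
  by apply: nondecreasing_series => n _ _.
exists (fine (F w)) => _ [N _ <-]; rewrite -lee_fin fineK//.
rewrite /series /= -sumEFin; apply: nneseries_lim_ge => n _ _.
by rewrite lee_fin.
Qed.

(** Telescoping through 1/(m+1)^2 <= 1/m - 1/(m+1). *)
Lemma sum_inv_sqr_le (n0 N : nat) : (1 < n0)%N ->
  \sum_(0 <= n < N) ((n0 + n)%:R ^+ 2)^-1 <= 1 :> R.
Proof.
move=> n01.
suff h : \sum_(0 <= n < N) ((n0 + n)%:R ^+ 2)^-1 <=
    (n0.-1%:R)^-1 - ((n0 + N).-1%:R)^-1 :> R.
  apply: le_trans h _; apply: (@le_trans _ _ ((n0.-1%:R)^-1 : R)).
    by rewrite gerBl invr_ge0.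
  by rewrite invf_le1 ?ltr0n ?ler1n; case: n0 n01 => [|[]].
elim: N => [|N IH]; first by rewrite big_geq// addn0 subrr.
rewrite big_nat_recr//= addnS /=.
have := IH; case: n0 n01 {IH} => [|[|n0]]// _.
rewrite !addSn /=; set m := (n0 + N)%N => h.
have e : (m.+1%:R : R)^-1 - (m.+2%:R)^-1 = (m.+1%:R * m.+2%:R)^-1.
  have := pnatr_eq0 R m.+1; have := pnatr_eq0 R m.+2.
  rewrite -[m.+2%:R]natr1; move: (m.+1%:R : R) => q /negbT q0 /negbT q1.
  by field; rewrite q0 q1.
have : ((m.+2%:R : R) ^+ 2)^-1 <= (m.+1%:R * m.+2%:R)^-1.
  rewrite lef_pV2 ?posrE ?mulr_gt0 ?exprn_gt0 ?ltr0n//.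
  by rewrite expr2 ler_wpM2r// ler_nat.
by rewrite -e => /(lerD h) /le_trans; apply; rewrite addrA subrK.
Qed.

Context {S : finType} (M : S -> S -> R) (pi : S -> R).
Hypothesis rev : reversible_generator M pi.
Context d (T : measurableType d) (P : probability T R).
Variables (nu : S -> R) (X : R -> T -> S).
Hypothesis hX : is_markov_chain P M nu X.
Variable h : S -> R.

Lemma path_integral_lipschitz (L s t : R) w : (forall x, `|h x| <= L) ->
  0 <= s -> s <= t ->
  `|path_integral X h t w - path_integral X h s w| <= L * (t - s).
Proof.
move=> hL s0 st; have iS := path_integrable hX hL t w.
have L0 : 0 <= L by apply: le_trans (hL (X 0 w)).
rewrite /path_integral (Rintegral_itvB iS) ?bnd_simp//.
have sub : `]s, t]%classic `<=` `[0, t]%classic.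
  move=> u; rewrite /= !in_itv /= => /andP[su ->]; rewrite andbT.
  exact: le_trans s0 (ltW su).
have iS' : lebesgue_measure.-integrable `]s, t] (EFin \o (fun u => h (X u w))).
  exact: integrableS iS.
apply: le_trans (le_normr_Rintegral _ iS') _ => //.
apply: (@le_trans _ _ (\int[lebesgue_measure]_(u in `]s, t]) L)).
  apply: le_Rintegral => //.
  - exact: integrable_norm.
  - by apply: (@bounded_itv_integrable _ _ _ _ _ (cst L) L) => // u _; rewrite ger0_norm.
rewrite Rintegral_cst// ler_wpM2l//= lebesgue_measure_itv /= lte_fin.
by case: ltP => //=; rewrite ?subr_ge0.
Qed.

Lemma path_integral_lln : \sum_x h x * pi x = 0 ->
  {ae P, forall w, path_integral X h t w / t @[t --> +oo] --> 0}.
Proof.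
move=> h0; have [chi chiE] := poisson rev h0.
have [C [t0 [C0 t01 HC]]] := moment_bound rev chiE hX.
have [L L0 hL] := fin_bound h.
(* Exceeds t0, so that the moment bound holds at every time (n0 + n)^2, and 1, as the telescoping
   sum requires. *)
pose n0 := (Num.truncn t0).+2.
have n0t n : t0 <= (n0 + n)%:R.
  apply: le_trans (ltW (truncnS_gt t0)) _.
  by rewrite ler_nat /n0 addSn ltnW// ltnS leq_addr.
pose m n : R := (n0 + n)%:R.
have m1 n : 1 <= m n by apply: le_trans t01 (n0t n).
have m2 n : t0 <= m n ^+ 2.
  by apply: le_trans (n0t n) _; rewrite -/(m n) expr2 ler_peMr//; have := m1 n; lra.
have mt n : 0 < m n ^+ 2 by have := m2 n; lra.
pose Z n w := (path_integral X h (m n ^+ 2) w / m n ^+ 2) ^+ 2.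
have bZ n : bmf (Z n).
  apply: bmfX; under eq_fun do rewrite mulrC.
  exact/bmfZ/(bmf_path_integral hX hL (mt n)).
have EZ n : Ex P (Z n) <= C * (m n ^+ 2)^-1.
  have [h2 _] := HC _ (m2 n).
  have -> : Z n = (fun w => (m n ^+ 2)^-1 *
      (path_integral X h (m n ^+ 2) w / Num.sqrt (m n ^+ 2)) ^+ 2).
    apply/funext => w; rewrite /Z !expr_div_n sqr_sqrtr ?ltW//.
    by field; rewrite gt_eqF//; have := m1 n; lra.
  rewrite ExZ; last first.
    apply: bmfX; under eq_fun do rewrite mulrC.
    exact/bmfZ/(bmf_path_integral hX hL (mt n)).
  by rewrite mulrC ler_wpM2r// invr_ge0 ltW.
have : {ae P, forall w, Z n w @[n --> \oo] --> 0}.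
  apply: (@ae_cvg0_of_sum _ _ _ _ C) => // [n w|N]; first exact: sqr_ge0.
  apply: le_trans (ler_sum _ (fun n _ => EZ n)) _.
  by rewrite -mulr_sumr ler_piMr// sum_inv_sqr_le.
apply: filterS => w Zw; apply/cvgrPdist_le => e e0.
have /cvgrPdist_le /(_ ((e / 2) ^+ 2) ltac:(by rewrite exprn_gt0// divr_gt0)) := Zw.
move=> [N _ HN].
(* For t > A^2 the integer part k of sqrt t is beyond the rank N of the subsequence and at least 6 L
   / e. *)
pose A : nat := (n0 + N + (Num.truncn (6 * L / e)).+1)%N.
exists (A%:R ^+ 2); split; first exact: num_real.
move=> t At; rewrite sub0r normrN.
have A0 : 0 <= A%:R :> R by [].
have t_gt0 : 0 < t by apply: le_lt_trans At; rewrite sqr_ge0.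
have tS := truncn_itv (sqrtr_ge0 t).
pose k := Num.truncn (Num.sqrt t); rewrite -/k in tS.
have Ak : (A <= k)%N.
  rewrite -ltnS -(ltr_nat R); have /andP[_] := tS; apply: le_lt_trans.
  by rewrite -[leLHS]ger0_norm// -sqrtr_sqr ler_sqrt ?ltW//.
have q2 : Num.sqrt t ^+ 2 = t by rewrite sqr_sqrtr// ltW.
have kE : k = (n0 + (k - n0))%N.
  by rewrite subnKC//; apply: leq_trans Ak; rewrite /A -addnA leq_addr.
have Nk : (N <= k - n0)%N.
  rewrite leq_subRL; last by rewrite kE leq_addr.
  by apply: leq_trans Ak; rewrite /A leq_addr.
have k6 : 6 * L / e <= k%:R.
  apply: le_trans (ltW (truncnS_gt _)) _; rewrite ler_nat.
  by apply: leq_trans Ak; rewrite /A leq_addl.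
have mk : m (k - n0)%N = k%:R by rewrite /m -kE.
have k1 : 1 <= k%:R :> R by rewrite -mk.
move: tS => /andP[kq qk].
have kt : k%:R ^+ 2 <= t by rewrite -q2 lerXn2r ?nnegrE.
(* The gap is at most 2 k + 1 <= 3 k, so A moves by at most 3 L k <= (e/2) k^2. *)
have tk : t - k%:R ^+ 2 <= 3 * k%:R.
  have : t <= k.+1%:R ^+ 2 by rewrite -q2 lerXn2r ?nnegrE// ltW.
  have -> : k.+1%:R ^+ 2 = k%:R ^+ 2 + (2 * k%:R + 1) :> R by rewrite -natr1; ring.
  lra.
have k20 : 0 < k%:R ^+ 2 :> R by rewrite exprn_gt0//; lra.
have b1 : `|path_integral X h (k%:R ^+ 2) w| <= e / 2 * k%:R ^+ 2.
  have := HN _ Nk; rewrite /= sub0r normrN /Z mk ger0_norm ?sqr_ge0//.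
  set u := path_integral X h _ w => h1.
  have h2 : `|u / k%:R ^+ 2| ^+ 2 <= (e / 2) ^+ 2.
    by rewrite real_normK ?num_real.
  have e20 : 0 <= e / 2 by lra.
  move: h2; rewrite ler_pXn2r ?nnegrE//.
  by rewrite normrM normfV (gtr0_norm k20) ler_pdivrMr.
have b2 : `|path_integral X h t w - path_integral X h (k%:R ^+ 2) w| <=
    e / 2 * k%:R ^+ 2.
  apply: le_trans (path_integral_lipschitz w hL (ltW k20) kt) _.
  apply: (@le_trans _ _ (L * (3 * k%:R))); first by rewrite ler_wpM2l.
  have : 6 * L <= k%:R * e by rewrite -ler_pdivrMr.
  move=> h6; have := ler_wpM2r (ler0n R k) h6.
  have -> : k%:R * e * k%:R = e * k%:R ^+ 2 by ring.
  lra.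
rewrite normrM normfV (gtr0_norm t_gt0) ler_pdivrMr//.
have -> : path_integral X h t w = path_integral X h (k%:R ^+ 2) w +
  (path_integral X h t w - path_integral X h (k%:R ^+ 2) w) by ring.
apply: le_trans (ler_normD _ _) _; apply: le_trans (lerD b1 b2) _.
have := ler_wpM2l (ltW e0) kt; lra.
Qed.

End LawOfLargeNumbers.

(** * Gaussian smoothing and weak convergence *)

Section GaussianLaw.
Context {R : realType}.
Implicit Types (a b v z : R).
Local Notation mu := (@lebesgue_measure R).

(** The Radon-Nikodym derivative agrees almost everywhere with the density, both having the same
    integral over every measurable set. *)
Lemma integral_normal_prob (m s : R) (f : R -> \bar R) :
  (normal_prob m s).-integrable setT f ->
  (\int[normal_prob m s]_x f x = \int[mu]_x (f x * (normal_pdf m s x)%:E))%E.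
Proof.
move=> intf.
have mpdf : measurable_fun setT (fun x => (normal_pdf m s x)%:E).
  by apply/measurable_EFinP; exact: measurable_normal_pdf.
rewrite -(@Radon_Nikodym_change_of_variables _ _ R (normal_prob m s) mu
  (@normal_prob_dominates R m s))//.
have iRN := @Radon_Nikodym_integrable _ _ R
  (charge_of_finite_measure (normal_prob m s)) mu (@normal_prob_dominates R m s).
apply: ae_eq_integral => //.
- apply: emeasurable_funM; first exact: measurable_int intf.
  exact: measurable_int iRN.
- by apply: emeasurable_funM => //; exact: measurable_int intf.
- apply: ae_eqe_mul2l => /=.
  rewrite (@Radon_NikodymE _ _ R (charge_of_finite_measure (normal_prob m s)) mu
    (@normal_prob_dominates R m s)).
  case: cid => /= h [h1 h2 h3].
  by apply: integral_ae_eq => // E _ mE; rewrite -h3.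
Qed.

Definition sqrt2pi : R := Num.sqrt (pi * 2).

Lemma sqrt2pi_gt0 : 0 < sqrt2pi.
Proof. by rewrite sqrtr_gt0 mulr_gt0 ?pi_gt0. Qed.

Lemma gauss_kernelN (i : R) z : gauss_kernel i (- z) = gauss_kernel i z.
Proof. by rewrite /gauss_kernel mulrNN. Qed.

(** The kernel is read as a density in its centre a, the variable over which laws are compared. *)
Lemma gauss_kernel_normal b a z : 0 < b ->
  gauss_kernel b^-1 (z - a) = sqrt2pi * normal_pdf z (Num.sqrt b) a.
Proof.
move=> b0; have s0 : Num.sqrt b != 0 by rewrite gt_eqF// sqrtr_gt0.
rewrite normal_pdfE// /gauss_kernel /normal_peak /normal_fun mulrA.
rewrite sqr_sqrtr ?ltW//; congr (_ * expR _); last first.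
  by rewrite -mulr_natr; field; rewrite gt_eqF.
rewrite -mulr_natr -mulrA -/sqrt2pi sqrtrM ?ltW// -/sqrt2pi invfM mulrCA.
by rewrite divff ?mulr1 ?sqrtrV ?ltW// gt_eqF ?sqrt2pi_gt0.
Qed.

(** Bayes' rule for Gaussians: completing the square in z separates the marginal of a, of variance b
    + v, from the posterior density of z. *)
Lemma gauss_kernel_mul_normal b v a z : 0 < b -> 0 < v ->
  gauss_kernel b^-1 (z - a) * normal_pdf 0 (Num.sqrt v) z =
  gauss_kernel (b + v)^-1 a *
    normal_pdf (v * a / (b + v)) (Num.sqrt (b * v / (b + v))) z.
Proof.
move=> b0 v0; have bv0 : 0 < b + v by rewrite addr_gt0.
have w0 : 0 < b * v / (b + v) by rewrite divr_gt0 ?mulr_gt0.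
have c0 := sqrt2pi_gt0.
have e (x y u : R) : 0 < x -> normal_pdf y (Num.sqrt x) u =
    sqrt2pi^-1 * gauss_kernel x^-1 (y - u).
  by move=> x0; rewrite gauss_kernel_normal// mulKf// gt_eqF.
rewrite !e// mulrCA [RHS]mulrCA; congr (_ * _); rewrite /gauss_kernel.
rewrite mulrACA [RHS]mulrACA -!sqrtrM ?invr_ge0 ?ltW// -!expRD.
congr (Num.sqrt _ * expR _); field; rewrite !gt_eqF//=.
Qed.

Lemma bmf_gauss_kernel d (T : measurableType d) (i a : R) (V : T -> R) :
  measurable_fun setT V -> bmf (fun w => gauss_kernel i (V w - a)).
Proof.
move=> mV; apply: (@bmf_bound _ _ _ _ (Num.sqrt `|i|)).
  apply: (measurableT_comp (f := gauss_kernel i)).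
    by apply: continuous_measurable_fun; apply: continuous_gauss_kernel.
  exact: measurable_funB.
move=> w; rewrite ger0_norm ?gauss_kernel_ge0// /gauss_kernel.
have [i0|i0] := leP 0 i.
  rewrite (ger0_norm i0) ler_piMr// -[leRHS]expR0 ler_expR oppr_le0.
  rewrite divr_ge0//; apply: mulr_ge0 => //.
  by rewrite -expr2 sqr_ge0.
by rewrite (ler0_sqrtr (ltW i0)) mul0r.
Qed.

(** Smoothing by variance b turns either branch of [gaussian] into the kernel of variance b + v, the
    limit found in [gauss_clt_rate]. The value v = 0 does occur, for instance for constant g. *)
Lemma gaussian_law v : 0 <= v ->
  exists2 G : probability (measurableTypeR R) R, gaussian v = G &
    forall b a, 0 < b ->
      Ex G (fun z : R => gauss_kernel b^-1 (z - a)) = gauss_kernel (b + v)^-1 a.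
Proof.
rewrite le_eqVlt => /predU1P[<-|v0].
  exists (@dirac _ (measurableTypeR R) (0 : R) R); first by rewrite /gaussian eqxx.
  move=> b a b0; have [mg _] := @bmf_gauss_kernel _ (measurableTypeR R) b^-1 a id
    (@measurable_id _ _ _).
  rewrite /Ex /Rintegral integral_dirac//; last exact/measurable_EFinP.
  by rewrite diracT mul1e /= addr0 sub0r gauss_kernelN.
exists (normal_prob 0 (Num.sqrt v)); first by rewrite /gaussian gt_eqF.
move=> b a b0; have bg := @bmf_gauss_kernel _ (measurableTypeR R) b^-1 a id
    (@measurable_id _ _ _).
rewrite /Ex /Rintegral integral_normal_prob; last exact: bmf_integrable.
under eq_integral do rewrite -EFinM gauss_kernel_mul_normal// EFinM.
rewrite integralZl//; last exact: integrable_normal_pdf.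
by rewrite integral_normal_pdf mule1.
Qed.

End GaussianLaw.

Section Smoothing.
Context {R : realType}.
Local Notation mu := (@lebesgue_measure R).
Implicit Types (a b e y z : R).

(** Half of the exponent is traded for a power: with x = u^2 / (4 b), e^(-2x) <= e^(-x) / x, and
    e^(-x) is the profile of variance 2 b. Then 8 is 4 from 1/x times 2 for the normalisations. *)
Lemma normal_pdf_tail b eta y a : 0 < b -> 0 < eta -> eta <= `|a - y| ->
  normal_pdf y (Num.sqrt b) a <=
  8 * b / eta ^+ 2 * normal_pdf y (Num.sqrt (2 * b)) a.
Proof.
move=> b0 eta0 etale; have b20 : 0 < 2 * b by rewrite mulr_gt0.
have pdfE x : 0 < x -> normal_pdf y (Num.sqrt x) a =
    sqrt2pi^-1 * gauss_kernel x^-1 (y - a).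
  by move=> x0; rewrite gauss_kernel_normal// mulKf// gt_eqF ?sqrt2pi_gt0.
rewrite !pdfE// [leRHS]mulrCA ler_wpM2l ?invr_ge0 ?(ltW sqrt2pi_gt0)//.
rewrite /gauss_kernel; set u := y - a.
have u2 : eta ^+ 2 <= u ^+ 2.
  rewrite -(real_normK (num_real u)) lerXn2r ?nnegrE ?(ltW eta0)//.
  by rewrite /u distrC.
pose x := u ^+ 2 / (4 * b).
have -> : - (u * u * b^-1 / 2) = - x + - x by rewrite /x; field; rewrite gt_eqF.
have -> : - (u * u * (2 * b)^-1 / 2) = - x by rewrite /x; field; rewrite gt_eqF.
have eta2 : 0 < eta ^+ 2 by rewrite exprn_gt0.
have ex : expR (- x) <= 4 * b / eta ^+ 2.
  have u20 : 0 < u ^+ 2 := lt_le_trans eta2 u2.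
  have x0 : 0 < x by apply: divr_gt0 => //; apply: mulr_gt0.
  have := expR_ge1Dx x => h.
  rewrite expRN; apply: (@le_trans _ _ x^-1).
    by rewrite lef_pV2 ?posrE ?expR_gt0//; lra.
  rewrite /x invf_div; apply: ler_wpM2l; first by rewrite mulr_ge0// ltW.
  by rewrite lef_pV2.
have sq : Num.sqrt b^-1 <= 2 * Num.sqrt (2 * b)^-1.
  have e4 : (2 : R) = Num.sqrt 4.
    by rewrite (_ : 4 = 2 ^+ 2 :> R) ?sqrtr_sqr ?ger0_norm//; ring.
  rewrite [X in _ <= X * _]e4 -sqrtrM// ler_sqrt; last first.
    by rewrite mulr_ge0// invr_ge0 ltW.
  by rewrite invfM mulrA ler_peMl ?invr_ge0 ?ltW//; lra.
rewrite expRD mulrA.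
have -> : 8 * b / eta ^+ 2 * (Num.sqrt (2 * b)^-1 * expR (- x)) =
  (2 * Num.sqrt (2 * b)^-1) * (4 * b / eta ^+ 2) * expR (- x) by ring.
by rewrite ler_wpM2r ?expR_ge0// ler_pM ?sqrtr_ge0 ?expR_ge0.
Qed.

(** Uniform continuity by compactness, in a form where only y is confined to the segment and a may
    leave it. *)
Lemma modulus_on_segment (f : R -> R) (K e : R) : continuous f -> 0 < e ->
  exists2 eta : R, 0 < eta &
    forall y a, `|y| <= K -> `|a - y| < eta -> `|f a - f y| <= e.
Proof.
move=> cf e0.
have /compact_near_coveringP := @segment_compact R (- K) K.
move=> /(_ R (0 : R)^'+ (fun eta y => forall a, `|a - y| < eta -> `|f a - f y| <= e)).
have near_x x : `[(- K), K]%classic x -> \forall x' \near x & i \near (0 : R)^'+,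
    forall a, `|a - x'| < i -> `|f a - f x'| <= e.
  move=> _; have /cvgrPdist_lt /(_ (e / 2) ltac:(by rewrite divr_gt0)) := cf x.
  move=> /nbhs_ballP[r /= r0 Hr].
  have r20 : 0 < r / 2 by rewrite divr_gt0.
  exists (ball x (r / 2), [set i | i < r / 2]).
    by split; [exact: nbhsx_ballx|exact: nbhs_right_lt].
  move=> [x' i] /= [xx' ir] a ax'.
  have h1 : `|f x - f a| < e / 2.
    apply: Hr; rewrite /ball /=.
    have -> : x - a = (x - x') - (a - x') by ring.
    apply: le_lt_trans (ler_normB _ _) _.
    move: xx'; rewrite /ball /= => xx'; lra.
  have h2 : `|f x - f x'| < e / 2.
    by apply: Hr; rewrite /ball /=; move: xx'; rewrite /ball /=; lra.
  have -> : f a - f x' = (f x - f x') - (f x - f a) by ring.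
  apply: le_trans (ler_normB _ _) _; lra.
move=> /(_ _ near_x) H.
have : \forall eta \near (0 : R)^'+, 0 < eta /\
    (`[(- K), K]%classic `<=` [set y | forall a, `|a - y| < eta -> `|f a - f y| <= e]).
  by apply: filterI => //; exact: nbhs_right_gt.
move=> /filter_ex [eta [eta0 He]]; exists eta => // y a yK; apply: He.
by rewrite /= in_itv /= -ler_norml.
Qed.

Section Fixed.
Variables (f : R -> R) (C K : R).
Hypotheses (cf : continuous f) (f0 : forall x, 0 <= f x) (fC : forall x, f x <= C).
Hypothesis K0 : 0 < K.

(** Compact support makes a uniform error on densities integrable. The margin 1 hides the cut-off
    from points within distance 1 of [-K, K]. *)
Definition truncated a : R := f a * \1_(`[(- (K + 1)), K + 1]%classic : set R) a.

Definition smoothed b y : R :=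
  \int[mu]_a (truncated a * normal_pdf y (Num.sqrt b) a).

Lemma C_ge0 : 0 <= C.
Proof. exact: le_trans (f0 0) (fC 0). Qed.

Lemma truncated_ge0 a : 0 <= truncated a.
Proof. by rewrite mulr_ge0// indicE; case: (_ \in _). Qed.

Lemma truncated_le a : truncated a <= C.
Proof.
rewrite /truncated indicE; case: (_ \in _); rewrite ?mulr1// mulr0.
exact: C_ge0.
Qed.

Lemma measurable_truncated : measurable_fun setT truncated.
Proof.
apply: measurable_funM; first exact: continuous_measurable_fun.
by apply: measurable_indic; apply: measurable_itv.
Qed.

Lemma integrable_mul_pdf (g : R -> R) y s (A : R) : measurable_fun setT g ->
  (forall a, `|g a| <= A) ->
  mu.-integrable setT (EFin \o (fun a => g a * normal_pdf y s a)).
Proof.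
move=> mg gA.
have ip := integrableZl measurableT A (@integrable_normal_pdf R y s).
apply: le_integrable ip => //.
  apply/measurable_EFinP; apply: measurable_funM => //.
  exact: measurable_normal_pdf.
move=> a _ /=; rewrite lee_fin !normrM ler_wpM2r//.
exact: le_trans (gA a) (ler_norm A).
Qed.

Lemma Rintegral_pdf y s A : \int[mu]_a (A * normal_pdf y s a) = A.
Proof.
rewrite RintegralZl//; last exact: integrable_normal_pdf.
by rewrite /Rintegral integral_normal_pdf /= mulr1.
Qed.

Lemma integrable_truncated_pdf b y :
  mu.-integrable setT (EFin \o (fun a => truncated a * normal_pdf y (Num.sqrt b) a)).
Proof.
apply: (@integrable_mul_pdf _ _ _ C); first exact: measurable_truncated.
by move=> a; rewrite ger0_norm ?truncated_ge0 ?truncated_le.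
Qed.

Lemma integrable_cst_pdf (A : R) y s :
  mu.-integrable setT (EFin \o (fun a => A * normal_pdf y s a)).
Proof. exact: (@integrable_mul_pdf (cst A) _ _ `|A|). Qed.

Lemma smoothed_ge0 b y : 0 <= smoothed b y.
Proof.
by apply: Rintegral_ge0 => a _; rewrite mulr_ge0 ?truncated_ge0 ?normal_pdf_ge0.
Qed.

Lemma smoothed_le b y : smoothed b y <= C.
Proof.
rewrite -[leRHS](Rintegral_pdf y (Num.sqrt b)); apply: le_Rintegral => //.
- exact: integrable_truncated_pdf.
- exact: integrable_cst_pdf.
- by move=> a _; rewrite ler_wpM2r ?normal_pdf_ge0 ?truncated_le.
Qed.

Lemma smoothed_approx e : 0 < e -> exists2 b : R, 0 < b &
  forall y, `|y| <= K -> `|smoothed b y - f y| <= e.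
Proof.
move=> e0; have C0 := C_ge0.
have [eta' eta'0 Heta'] := @modulus_on_segment f K (e / 2) cf ltac:(by rewrite divr_gt0).
pose eta := Num.min eta' 1.
have eta0 : 0 < eta by rewrite lt_min eta'0 ltr01.
have Heta y a : `|y| <= K -> `|a - y| < eta -> `|f a - f y| <= e / 2.
  by move=> yK; rewrite lt_min => /andP[+ _]; exact: Heta'.
have eta1 : eta <= 1 by rewrite /eta ge_min lexx orbT.
(* Chosen so that the mass beyond distance [eta] contributes at most e/2. Using C + 1 keeps the
   denominator positive when C = 0. *)
pose b := e * eta ^+ 2 / (16 * (C + 1)).
have C1 : 0 < 16 * (C + 1) by apply: mulr_gt0 => //; lra.
have b0 : 0 < b.
  by apply: divr_gt0 => //; apply: mulr_gt0 => //; apply: exprn_gt0.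
exists b => // y yK.
pose A := C * (8 * b / eta ^+ 2).
have Ae : A <= e / 2.
  have -> : A = (e / 2) * (C / (C + 1)).
    by rewrite /A /b; field; rewrite !gt_eqF//; lra.
  by rewrite ler_piMr ?divr_ge0 ?(ltW e0)// ler_pdivrMr; lra.
have ib := integrable_truncated_pdf b y.
have ify := integrable_cst_pdf (f y) y (Num.sqrt b).
have i1 := integrable_cst_pdf (e / 2) y (Num.sqrt b).
have i2 := integrable_cst_pdf A y (Num.sqrt (2 * b)).
rewrite -[f y](Rintegral_pdf y (Num.sqrt b)) /smoothed -RintegralB//.
have idiff : mu.-integrable setT (EFin \o (fun a =>
    truncated a * normal_pdf y (Num.sqrt b) a - f y * normal_pdf y (Num.sqrt b) a)).
  exact: (integrableB _ ib ify).
apply: le_trans (le_normr_Rintegral _ idiff) _ => //.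
apply: (@le_trans _ _ (\int[mu]_a (e / 2 * normal_pdf y (Num.sqrt b) a +
    A * normal_pdf y (Num.sqrt (2 * b)) a))).
  apply: le_Rintegral => //.
  - exact: integrable_norm.
  - exact: (integrableD _ i1 i2).
  move=> a _; rewrite -mulrBl normrM.
  rewrite (ger0_norm (normal_pdf_ge0 _ _ _)).
  have p0 := normal_pdf_ge0 y (Num.sqrt b) a.
  have p20 := normal_pdf_ge0 y (Num.sqrt (2 * b)) a.
  have [ay|ay] := ltP `|a - y| eta.
    rewrite ler_wpDr//.
      by rewrite mulr_ge0// mulr_ge0// divr_ge0 ?sqr_ge0// mulr_ge0// ltW.
    rewrite ler_wpM2r// /truncated indicE mem_set ?mulr1; first exact: Heta.
    rewrite /= in_itv /= -ler_norml.
    have -> : a = (a - y) + y by ring.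
    apply: le_trans (ler_normD _ _) _; lra.
  rewrite ler_wpDl//; first by rewrite mulr_ge0// divr_ge0// ltW.
  rewrite /A -mulrA; apply: ler_pM => //.
    rewrite ler_norml; have := truncated_ge0 a; have := truncated_le a.
    have := f0 y; have := fC y; lra.
  exact: normal_pdf_tail.
rewrite RintegralD// !Rintegral_pdf; lra.
Qed.

Section Fubini.
Context d (T : measurableType d) (P : probability T R) (V : T -> R).
Hypothesis mV : measurable_fun setT V.

(** Exchanging integrals pairs [truncated] with the density of V plus an independent N(0, b)
    variable, which is what the Gaussian test functions control. *)
Lemma smoothed_fubini b : 0 < b ->
  [/\ bmf (fun w => smoothed b (V w)),
      measurable_fun setT (fun a => truncated a *
        (sqrt2pi^-1 * Ex P (fun w => gauss_kernel b^-1 (V w - a)))) &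
      (Ex P (fun w => smoothed b (V w)))%:E =
      (\int[mu]_a (truncated a *
        (sqrt2pi^-1 * Ex P (fun w => gauss_kernel b^-1 (V w - a))))%:E)%E].
Proof.
move=> b0; have c0 : 0 <= sqrt2pi^-1 :> R by rewrite invr_ge0 ltW ?sqrt2pi_gt0.
pose F (x : R * T) := (truncated x.1 *
  (sqrt2pi^-1 * gauss_kernel b^-1 (V x.2 - x.1)))%:E.
have mF : measurable_fun setT F.
  apply/measurable_EFinP; apply: measurable_funM.
    by apply: measurableT_comp => //; exact: measurable_truncated.
  apply: measurable_funM => //.
  apply: (measurableT_comp (f := gauss_kernel b^-1)).
    by apply: continuous_measurable_fun; apply: continuous_gauss_kernel.
  by apply: measurable_funB => //; exact: measurableT_comp.
have F0 x : (0 <= F x)%E.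
  by rewrite lee_fin mulr_ge0 ?truncated_ge0// mulr_ge0// gauss_kernel_ge0.
have bg a := @bmf_gauss_kernel R _ T b^-1 a V mV.
have inP a : (\int[P]_w F (a, w))%E = (truncated a *
    (sqrt2pi^-1 * Ex P (fun w => gauss_kernel b^-1 (V w - a))))%:E.
  have bF : bmf (fun w => truncated a * (sqrt2pi^-1 * gauss_kernel b^-1 (V w - a))).
    exact: (bmfZ (truncated a) (bmfZ sqrt2pi^-1 (bg a))).
  have := expectationE P bF; rewrite unlock => ->.
  by rewrite (ExZ P _ (bmfZ sqrt2pi^-1 (bg a))) (ExZ P _ (bg a)).
have inmu w : (\int[mu]_a F (a, w))%E = (smoothed b (V w))%:E.
  rewrite /smoothed /Rintegral fineK; last first.
    exact: integrable_fin_num (integrable_truncated_pdf b (V w)).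
  apply: eq_integral => a _; rewrite /F /=; congr (_ * _)%:E.
  by rewrite gauss_kernel_normal// mulKf// gt_eqF// sqrt2pi_gt0.
have mS : measurable_fun setT (fun w => smoothed b (V w)).
  apply/measurable_EFinP.
  have := @measurable_fun_fubini_tonelli_G _ _ _ _ R mu F mF F0.
  by congr (measurable_fun _ _); apply/funext => w; rewrite /fubini_G inmu.
have bS : bmf (fun w => smoothed b (V w)).
  apply: (bmf_bound mS (C := C)) => w.
  by rewrite ger0_norm ?smoothed_ge0// smoothed_le.
split=> //.
  apply/measurable_EFinP.
  have := @measurable_fun_fubini_tonelli_F _ _ _ _ R P F mF F0.
  by congr (measurable_fun _ _); apply/funext => a; rewrite /fubini_F inP.
have := expectationE P bS; rewrite unlock => <-.
transitivity (\int[P]_w \int[mu]_a F (a, w))%E.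
  by apply: eq_integral => w _; rewrite inmu.
rewrite -(@fubini_tonelli _ _ _ _ R mu P F mF F0).
by apply: eq_integral => a _; rewrite inP.
Qed.

(** For |V| > K both values lie in [0, C], so they differ by at most C, and the fraction is at least
    1 there. *)
Lemma smoothed_error b e : 0 < b ->
  (forall y, `|y| <= K -> `|smoothed b y - f y| <= e) ->
  `|Ex P (fun w => f (V w)) - Ex P (fun w => smoothed b (V w))| <=
  e + C * Ex P (fun w => 2 * V w ^+ 2 / (K ^+ 2 + V w ^+ 2)).
Proof.
move=> b0 He; have [bS _ _] := smoothed_fubini b0; have C0 := C_ge0.
have den z : 0 < K ^+ 2 + z ^+ 2 by rewrite ltr_wpDr ?sqr_ge0 ?exprn_gt0.
have bf : bmf (fun w => f (V w)).
  apply: (@bmf_bound _ _ _ _ C).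
    by apply: measurableT_comp => //; exact: continuous_measurable_fun.
  by move=> w; rewrite ger0_norm.
have br : bmf (fun w => 2 * V w ^+ 2 / (K ^+ 2 + V w ^+ 2)).
  apply: (@bmf_bound _ _ _ _ 2).
    apply: (measurableT_comp (f := fun z => 2 * z ^+ 2 / (K ^+ 2 + z ^+ 2))) => //.
    apply: continuous_measurable_fun => z; apply: cvgM.
      by apply: cvgMl_tmp; apply: exprn_continuous.
    apply: cvgV; first by rewrite gt_eqF.
    by apply: cvgD; [exact: cvg_cst|apply: exprn_continuous].
  move=> w; rewrite ger0_norm; last first.
    by rewrite divr_ge0 ?(ltW (den _))// mulr_ge0 ?sqr_ge0.
  by rewrite ler_pdivrMr// ler_wpM2l// lerDr sqr_ge0.
rewrite -ExB//; apply: le_trans (Ex_norm P (bmfB bf bS)) _.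
rewrite -[e](Ex_cst P) -ExZ// -ExD; [|exact: bmf_cst|exact: bmfZ].
apply: Ex_le.
- exact/bmf_norm/bmfB.
- by apply: bmfD; [exact: bmf_cst|exact: bmfZ].
move=> w; set y := V w.
have r0 : 0 <= 2 * y ^+ 2 / (K ^+ 2 + y ^+ 2).
  by rewrite divr_ge0 ?(ltW (den _))// mulr_ge0 ?sqr_ge0.
have e0 : 0 <= e.
  by apply: le_trans (He 0 _); rewrite ?normr0 ?(ltW K0).
have [yK|yK] := leP `|y| K.
  apply: (@le_trans _ _ e); first by rewrite distrC; apply: He.
  by rewrite lerDl; apply: mulr_ge0.
rewrite ler_wpDl// ; apply: (@le_trans _ _ (C * 1)).
  rewrite mulr1 ler_norml; have := smoothed_ge0 b y; have := smoothed_le b y.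
  have := f0 y; have := fC y; lra.
rewrite ler_wpM2l// ler_pdivlMr// mul1r.
have : K ^+ 2 <= y ^+ 2.
  have yn0 : 0 <= `|y| := normr_ge0 y.
  by rewrite -(real_normK (num_real y)) lerXn2r ?nnegrE ?(ltW K0) ?(ltW yK).
lra.
Qed.

End Fubini.

(** The density error is integrated over the support of [truncated], of length 2 (K + 1). The
    one-sided form serves for both orders of the two laws. *)
Lemma smoothed_compare d1 (T1 : measurableType d1) (P1 : probability T1 R) (V1 : T1 -> R)
    d2 (T2 : measurableType d2) (P2 : probability T2 R) (V2 : T2 -> R) b (dl : R) :
  measurable_fun setT V1 -> measurable_fun setT V2 -> 0 < b -> 0 <= dl ->
  (forall a, Ex P1 (fun w => gauss_kernel b^-1 (V1 w - a)) <=
             Ex P2 (fun w => gauss_kernel b^-1 (V2 w - a)) + dl) ->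
  Ex P1 (fun w => smoothed b (V1 w)) <=
  Ex P2 (fun w => smoothed b (V2 w)) + sqrt2pi^-1 * dl * C * (2 * (K + 1)).
Proof.
move=> mV1 mV2 b0 dl0 h; have C0 := C_ge0.
have c0 : 0 <= sqrt2pi^-1 :> R by rewrite invr_ge0 ltW ?sqrt2pi_gt0.
have [_ m1 e1] := smoothed_fubini P1 mV1 b0.
have [_ m2 e2] := smoothed_fubini P2 mV2 b0.
pose q1 a := Ex P1 (fun w => gauss_kernel b^-1 (V1 w - a)).
pose q2 a := Ex P2 (fun w => gauss_kernel b^-1 (V2 w - a)).
have q10 a : 0 <= q1 a by apply: Ex_ge0 => w; exact: gauss_kernel_ge0.
have q20 a : 0 <= q2 a by apply: Ex_ge0 => w; exact: gauss_kernel_ge0.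
pose I : set R := `[(- (K + 1)), K + 1]%classic.
pose k := sqrt2pi^-1 * dl * C.
have k0 : 0 <= k by rewrite mulr_ge0// mulr_ge0.
have mI : measurable_fun setT (fun a => k * \1_I a).
  by apply: measurable_funM => //; apply: measurable_indic; exact: measurable_itv.
rewrite -lee_fin EFinD e1 e2.
apply: (@le_trans _ _ (\int[mu]_a ((truncated a * (sqrt2pi^-1 * q2 a))%:E +
    (k * \1_I a)%:E))%E).
  apply: ge0_le_integral => //.
  - move=> a _; rewrite lee_fin; apply: mulr_ge0; first exact: truncated_ge0.
    by apply: mulr_ge0 => //; exact: q10.
  - exact/measurable_EFinP.
  - by apply: emeasurable_funD; exact/measurable_EFinP.
  move=> a _; rewrite -EFinD lee_fin.
  have t0 : 0 <= truncated a * sqrt2pi^-1 by rewrite mulr_ge0 ?truncated_ge0.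
  have := ler_wpM2l t0 (h a); rewrite -/(q1 a) -/(q2 a) !mulrA mulrDr => ha.
  apply: le_trans ha _; rewrite lerD2l /truncated /k.
  have -> : f a * \1_I a * sqrt2pi^-1 * dl = (sqrt2pi^-1 * dl) * f a * \1_I a by ring.
  apply: ler_wpM2r; first by rewrite indicE; case: (_ \in _).
  by apply: ler_wpM2l => //; apply: mulr_ge0.
rewrite ge0_integralD//; last 4 first.
- move=> a _; rewrite lee_fin; apply: mulr_ge0; first exact: truncated_ge0.
  by apply: mulr_ge0 => //; exact: q20.
- exact/measurable_EFinP.
- by move=> a _; rewrite lee_fin mulr_ge0// indicE; case: (_ \in _).
- exact/measurable_EFinP.
rewrite leeD2l//; under eq_integral do rewrite EFinM.
rewrite ge0_integralZl; last 4 first.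
- by [].
- by apply/measurable_EFinP; apply: measurable_indic; exact: measurable_itv.
- by move=> a _; rewrite lee_fin indicE; case: (_ \in _).
- by rewrite lee_fin.
rewrite integral_indic; [|by []|exact: measurable_itv].
rewrite setIT /I /= lebesgue_measure_itv /= lte_fin.
have -> : - (K + 1) < K + 1 by move: K0; lra.
by rewrite -EFinB -EFinM lee_fin le_eqVlt; apply/orP; left; apply/eqP; rewrite /k; ring.
Qed.

End Fixed.

End Smoothing.

Section WeakConvergence.
Context {R : realType} d (T : measurableType d) (P : probability T R).
Variables (V : R -> T -> R) (G : probability (measurableTypeR R) R) (B t1 : R).
Hypothesis hV : forall t, t1 <= t -> bmf (V t) /\ Ex P (fun w => V t w ^+ 2) <= B.
Hypothesis hG : forall b : R, 0 < b -> exists C t0 : R, 0 <= C /\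
  forall t a : R, t0 <= t ->
    `|Ex P (fun w => gauss_kernel b^-1 (V t w - a)) -
      Ex G (fun z : R => gauss_kernel b^-1 (z - a))| <= C / Num.sqrt t.

(* [2 z^2 / (K^2 + z^2)] is a continuous majorant of the indicator of
   [|z| > K]. *)
Lemma tail_cvg0 :
  Ex G (fun z : R => 2 * z ^+ 2 / (n.+1%:R ^+ 2 + z ^+ 2)) @[n --> \oo] --> (0 : R).
Proof.
have den n (z : R) : 0 < n.+1%:R ^+ 2 + z ^+ 2.
  by rewrite ltr_wpDr ?sqr_ge0 ?exprn_gt0 ?ltr0n.
have cn n : continuous (fun z : R => 2 * z ^+ 2 / (n.+1%:R ^+ 2 + z ^+ 2)).
  move=> z; apply: cvgM; first by apply: cvgMl_tmp; apply: exprn_continuous.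
  apply: cvgV; first by rewrite gt_eqF.
  by apply: cvgD; [exact: cvg_cst|apply: exprn_continuous].
have [||z|_] := @Ex_cvg _ _ _ G
  (fun n (z : measurableTypeR R) => 2 * z ^+ 2 / (n.+1%:R ^+ 2 + z ^+ 2)) (cst 0) 2.
- by move=> n; apply: continuous_measurable_fun; apply: cn.
- move=> n z; rewrite ger0_norm; last first.
    by rewrite divr_ge0 ?(ltW (den _ _))// mulr_ge0 ?sqr_ge0.
  by rewrite ler_pdivrMr// ler_wpM2l// lerDr sqr_ge0.
- apply: (@squeeze_cvgr _ _ _ _ (cst 0) (fun n => 2 * z ^+ 2 * n.+1%:R^-1)).
  + apply: nearW => n; apply/andP; split.
      by rewrite divr_ge0 ?(ltW (den _ _))// mulr_ge0 ?sqr_ge0.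
    apply: ler_wpM2l; first by rewrite mulr_ge0 ?sqr_ge0.
    rewrite lef_pV2 ?posrE ?ltr0n//.
    apply: (@le_trans _ _ (n.+1%:R ^+ 2)); last by rewrite lerDl sqr_ge0.
    by rewrite expr2 ler_peMr// ler1n.
  + exact: cvg_cst.
  + rewrite -[X in _ --> X](mulr0 (2 * z ^+ 2)).
    by apply: cvgMl_tmp; apply: cvg_harmonic.
by rewrite Ex_cst.
Qed.

Lemma weak_cvg_nonneg (f : R -> R) (C : R) : continuous f ->
  (forall x, 0 <= f x) -> (forall x, f x <= C) ->
  Ex P (fun w => f (V t w)) @[t --> +oo] --> Ex G (f : measurableTypeR R -> R).
Proof.
move=> cf f0 fC; have C0 : 0 <= C := le_trans (f0 0) (fC 0).
have B0 : 0 <= B.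
  by apply: le_trans (hV (lexx t1)).2; apply: Ex_ge0 => w; rewrite sqr_ge0.
(* Budget: e/8 for smoothing and C [e8] <= e/8 for the tail, under each of the two laws, and e/2 for
   comparing the smoothed expectations. *)
apply/cvgrPdist_le => e e0; pose e8 := e / (8 * (C + 1)).
have e80 : 0 < e8 by apply: divr_gt0 => //; lra.
have Ce8 : C * e8 <= e / 8.
  have -> : C * e8 = e / 8 * (C / (C + 1)) by rewrite /e8; field; rewrite gt_eqF//; lra.
  by rewrite ler_piMr ?divr_ge0 ?(ltW e0)// ler_pdivrMr; lra.
have cu : Ex G (fun z : R => 2 * z ^+ 2 / (n.+1%:R ^+ 2 + z ^+ 2)) +
    2 * B * n.+1%:R^-1 @[n --> \oo] --> (0 : R).
  rewrite -[X in _ --> X](addr0 0) -{2}(mulr0 (2 * B)).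
  by apply: cvgD; [exact: tail_cvg0|apply: cvgMl_tmp; apply: cvg_harmonic].
have /cvgrPdist_le /(_ _ e80) [N _ /(_ N (leqnn N))] := cu.
rewrite /= sub0r normrN => /(le_trans (ler_norm _)) uN.
pose K : R := N.+1%:R; have K0 : 0 < K by rewrite ltr0n.
have r0 (z : R) : 0 <= 2 * z ^+ 2 / (K ^+ 2 + z ^+ 2).
  by rewrite divr_ge0 ?addr_ge0 ?sqr_ge0// mulr_ge0 ?sqr_ge0.
have BK : 2 * B * K^-1 <= e8.
  by apply: le_trans uN; rewrite lerDr; apply: Ex_ge0 => z; exact: r0.
have GK : Ex G (fun z : R => 2 * z ^+ 2 / (K ^+ 2 + z ^+ 2)) <= e8.
  by apply: le_trans uN; rewrite lerDl !mulr_ge0.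
have [b b0 Hb] := smoothed_approx K cf f0 fC (divr_gt0 e0 (ltr0n R 8)).
have [C2 [t2 [C20 Ht2]]] := hG b0.
pose D := sqrt2pi^-1 * C2 * C * (2 * (K + 1)).
have c0 : 0 <= sqrt2pi^-1 :> R by rewrite invr_ge0 ltW ?sqrt2pi_gt0.
have D0 : 0 <= D.
  rewrite /D; apply: mulr_ge0; last by lra.
  by rewrite mulr_ge0// mulr_ge0.
(* The last summand ensures D / sqrt t <= e/2, the others the range of the hypotheses and t > 0. *)
pose A := `|t1| + `|t2| + 1 + (2 * D / e) ^+ 2.
exists A; split; first exact: num_real.
move=> t At.
have tA : t1 <= t /\ t2 <= t /\ 0 < t /\ (2 * D / e) ^+ 2 <= t.
  have := ler_norm t1; have := ler_norm t2; have := normr_ge0 t1.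
  have := normr_ge0 t2; have := sqr_ge0 (2 * D / e); move: At; rewrite /A.
  move: (_ ^+ 2) `|t1| `|t2| => x y z *; do !split; lra.
have [t1t [t2t [t0 Dt]]] := tA.
have [bV EV] := hV t1t.
have [mV _] := bV.
have q0 : 0 < Num.sqrt t by rewrite sqrtr_gt0.
pose dl := C2 / Num.sqrt t.
have dl0 : 0 <= dl by rewrite divr_ge0.
have Dq : sqrt2pi^-1 * dl * C * (2 * (K + 1)) <= e / 2.
  have -> : sqrt2pi^-1 * dl * C * (2 * (K + 1)) = D / Num.sqrt t.
    by rewrite /dl /D; ring.
  have De : 2 * D / e <= Num.sqrt t.
    have De0 : 0 <= 2 * D / e by apply: divr_ge0; [apply: mulr_ge0|exact: ltW].
    by rewrite -(ger0_norm De0) -sqrtr_sqr ler_sqrt ?(ltW t0).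
  rewrite ler_pdivrMr//; move: De; rewrite ler_pdivrMr//; lra.
have tailV : Ex P (fun w => 2 * V t w ^+ 2 / (K ^+ 2 + V t w ^+ 2)) <= e8.
  have bV2 : bmf (fun w => V t w ^+ 2) by apply: bmfX.
  apply: le_trans BK.
  (* As K is a positive integer, K <= K^2, and the second moment bound gives a tail of order 1/K
     uniform in t. *)
  have h w : 2 * V t w ^+ 2 / (K ^+ 2 + V t w ^+ 2) <= 2 * K^-1 * V t w ^+ 2.
    rewrite [leRHS]mulrAC; apply: ler_wpM2l; first by rewrite mulr_ge0 ?sqr_ge0.
    rewrite lef_pV2 ?posrE//; last by rewrite ltr_wpDr ?sqr_ge0 ?exprn_gt0.
    apply: (@le_trans _ _ (K ^+ 2)); last by rewrite lerDl sqr_ge0.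
    by rewrite expr2; apply: ler_peMr; rewrite ?(ltW K0)// ler1n.
  apply: (@le_trans _ _ (Ex P (fun w => 2 * K^-1 * V t w ^+ 2))).
    apply: Ex_le => //; last exact: bmfZ.
    apply: (@bmf_continuous _ _ _ (V t) (fun z => 2 * z ^+ 2 / (K ^+ 2 + z ^+ 2))) => //.
    move=> z; apply: cvgM; first by apply: cvgMl_tmp; apply: exprn_continuous.
    apply: cvgV; first by rewrite gt_eqF// ltr_wpDr ?sqr_ge0 ?exprn_gt0.
    by apply: cvgD; [exact: cvg_cst|apply: exprn_continuous].
  by rewrite ExZ// mulrAC; apply: ler_wpM2r; rewrite ?invr_ge0 ?(ltW K0)// ler_wpM2l.
have mid : measurable_fun setT (id : measurableTypeR R -> R) by exact: measurable_id.
have errV := smoothed_error cf f0 fC K0 P mV b0 Hb.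
have errG := smoothed_error cf f0 fC K0 G mid b0 Hb.
have cmp a : `|Ex P (fun w => gauss_kernel b^-1 (V t w - a)) -
      Ex G (fun z : R => gauss_kernel b^-1 (z - a))| <= dl by exact: Ht2.
have cmp1 := @smoothed_compare R f C K cf f0 fC K0 _ _ P (V t) _ _ G id b dl mV mid b0 dl0.
have cmp2 := @smoothed_compare R f C K cf f0 fC K0 _ _ G id _ _ P (V t) b dl mid mV b0 dl0.
have {}cmp1 : Ex P (fun w => smoothed f K b (V t w)) <=
    Ex G (fun z : R => smoothed f K b z) + e / 2.
  apply: le_trans (cmp1 _) _; last by rewrite lerD2l.
  by move=> a; have := cmp a; rewrite ler_norml => /andP[_]; rewrite lerBlDl addrC.
have {}cmp2 : Ex G (fun z : R => smoothed f K b z) <=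
    Ex P (fun w => smoothed f K b (V t w)) + e / 2.
  apply: le_trans (cmp2 _) _; last by rewrite lerD2l.
  by move=> a; have := cmp a; rewrite ler_norml => /andP[+ _]; lra.
have := ler_wpM2l C0 tailV; have := ler_wpM2l C0 GK.
move: errV errG cmp1 cmp2 Ce8; rewrite !ler_norml.
set x1 := Ex P _; set x2 := Ex P _; set x3 := Ex P _.
set y1 := Ex G _; set y2 := Ex G _; set y3 := Ex G _.
move=> /andP[? ?] /andP[? ?] ? ? ? ? ?; apply/andP; split; lra.
Qed.

Lemma weak_cvg (f : R -> R) : continuous f -> (exists C, forall x, `|f x| <= C) ->
  Ex P (fun w => f (V t w)) @[t --> +oo] --> Ex G (f : measurableTypeR R -> R).
Proof.
move=> cf [C fC].
have cfC : continuous (fun x => f x + C).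
  by move=> x; apply: cvgD; [exact: cf|exact: cvg_cst].
have h x : - C <= f x <= C by rewrite -ler_norml.
have cE : Ex P (fun w => f (V t w) + C) @[t --> +oo] -->
    Ex G (fun z : measurableTypeR R => f z + C).
  apply: (@weak_cvg_nonneg (fun x => f x + C) (2 * C)) => // x;
  by have /andP[] := h x; lra.
have bG : bmf (f : measurableTypeR R -> R).
  apply: (@bmf_bound _ (measurableTypeR R) R f C) => //.
  exact: continuous_measurable_fun.
have eG : Ex G (fun z : measurableTypeR R => f z + C) =
    Ex G (f : measurableTypeR R -> R) + C.
  by rewrite ExD ?Ex_cst//; exact: bmf_cst.
rewrite eG in cE.
have cB : Ex P (fun w => f (V t w) + C) - C @[t --> +oo] -->
    Ex G (f : measurableTypeR R -> R).
  by rewrite -[X in _ --> X](addrK C); apply: cvgB cE _; exact: cvg_cst.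
apply: cvg_trans cB.
apply: near_eq_cvg; exists t1; split; first exact: num_real.
move=> t /ltW t1t; have [bV _] := hV t1t.
rewrite /= ExD ?Ex_cst ?addrK//; last exact: bmf_cst.
exact: (bmf_continuous cf bV).
Qed.

End WeakConvergence.

(** * Tools for comparing the ratio of path integrals with its numerator *)

Section PathIntegralAlgebra.
Context {R : realType} {S : finType} d (T : measurableType d)
  (P : probability T R).
Variables (M : S -> S -> R) (nu : S -> R) (X : R -> T -> S).
Hypothesis hX : is_markov_chain P M nu X.

Lemma path_integral_lin (a b : S -> R) (c t : R) w :
  path_integral X (fun x => a x + c * b x) t w =
  path_integral X a t w + c * path_integral X b t w.
Proof.
have [La _ hLa] := fin_bound a; have [Lb _ hLb] := fin_bound b.
have ia := path_integrable hX hLa t w; have ib := path_integrable hX hLb t w.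
rewrite /path_integral RintegralD ?RintegralZl//.
exact: (integrableZl _ c ib).
Qed.

Lemma path_integral_cst (c t : R) w : 0 < t ->
  path_integral X (fun=> c) t w = c * t.
Proof.
move=> t0; rewrite /path_integral Rintegral_cst//= lebesgue_measure_itv /=.
by rewrite lte_fin t0 -EFinB /= subr0.
Qed.

Lemma path_integral_ge (a : S -> R) (c t : R) w : 0 < t ->
  (forall x, c <= a x) -> c * t <= path_integral X a t w.
Proof.
move=> t0 ca; have := path_integral_lin a (fun=> c) (- 1) t w.
rewrite path_integral_cst// => e.
have : 0 <= path_integral X (fun x => a x + - 1 * c) t w.
  by apply: Rintegral_ge0 => s _; rewrite mulN1r subr_ge0.
rewrite e; lra.
Qed.

End PathIntegralAlgebra.

(** Each inverse is below the sum of all of them. The added 1 keeps the bound positive even for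
    empty S. *)
Lemma fin_lower_bound (R : realType) (S : finType) (wt : S -> R) :
  (forall x, 0 < wt x) -> exists2 dl : R, 0 < dl & forall x, dl <= wt x.
Proof.
move=> wt0; exists (1 + \sum_x (wt x)^-1)^-1.
  by rewrite invr_gt0 ltr_pwDl// sumr_ge0// => x _; rewrite invr_ge0 ltW.
move=> x; rewrite -[leRHS]invrK lef_pV2 ?posrE ?invr_gt0//; last first.
  by rewrite ltr_pwDl// sumr_ge0// => y _; rewrite invr_ge0 ltW.
rewrite (bigD1 x)//= addrCA lerDl addr_ge0// sumr_ge0// => y _.
by rewrite invr_ge0 ltW.
Qed.

(** For |r| >= |u| + 1 the profile varies by at most 1. Otherwise 1 - e^(-d) <= d leaves the factor
    (|r| + |u|) / 2 <= |u| + 1 times E(u), at most 17 + 1. *)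
Lemma gauss_kernel_lipschitz (R : realType) (i x y : R) : 0 <= i ->
  `|gauss_kernel i x - gauss_kernel i y| <= 18 * i * `|x - y|.
Proof.
move=> i0.
pose E (u : R) := expR (- (u ^+ 2 / 2)).
have E0 u : 0 <= E u := expR_ge0 _.
have E1 u : E u <= 1.
  by rewrite /E -[leRHS]expR0 ler_expR oppr_le0 divr_ge0 ?sqr_ge0.
have EL u r : `|u| <= `|r| -> `|E u - E r| <= 18 * `|u - r|.
  move=> ur; have dist : `|r| - `|u| <= `|u - r|.
    by rewrite distrC; apply: lerB_dist.
  have u2 : `|u| ^+ 2 = u ^+ 2 by rewrite real_normK ?num_real.
  have r2 : `|r| ^+ 2 = r ^+ 2 by rewrite real_normK ?num_real.
  have Er : E r <= E u.
    rewrite ler_expR lerN2 ler_wpM2r ?invr_ge0// -u2 -r2.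
    by rewrite lerXn2r ?nnegrE.
  rewrite ger0_norm ?subr_ge0//.
  have [big|small] := leP (`|u| + 1) `|r|.
    have := E0 r; have := E1 u; lra.
  have Eur : E u - E r <= E u * ((r ^+ 2 - u ^+ 2) / 2).
    have -> : E r = E u * expR (- ((r ^+ 2 - u ^+ 2) / 2)).
      by rewrite /E -expRD; congr expR; field.
    have := ler_wpM2l (E0 u) (expR_ge1Dx (- ((r ^+ 2 - u ^+ 2) / 2))); lra.
  apply: le_trans Eur _.
  have -> : E u * ((r ^+ 2 - u ^+ 2) / 2) =
      (`|r| - `|u|) * ((`|r| + `|u|) / 2 * E u).
    by rewrite -u2 -r2; field.
  have uE : `|u| * E u <= 17 by have := pow_gauss_le u (isT : (1 <= 4)%N); rewrite expr1.
  have b18 : (`|r| + `|u|) / 2 * E u <= 18.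
    have h : (`|r| + `|u|) / 2 <= `|u| + 1 by lra.
    apply: le_trans (ler_wpM2r (E0 u) h) _; rewrite mulrDl mul1r.
    by have := E1 u; lra.
  rewrite mulrC; apply: ler_pM => //.
  - by rewrite mulr_ge0// divr_ge0// addr_ge0.
  - by rewrite subr_ge0.
have gE z : gauss_kernel i z = Num.sqrt i * E (z * Num.sqrt i).
  by rewrite /gauss_kernel /E exprMn sqr_sqrtr// expr2.
have ELs u r : `|E u - E r| <= 18 * `|u - r|.
  have [/EL//|/ltW/EL] := leP `|u| `|r|.
  by rewrite distrC [`|r - u|]distrC.
rewrite !gE -mulrBr normrM (ger0_norm (sqrtr_ge0 i)).
apply: le_trans (ler_wpM2l (sqrtr_ge0 i) (ELs _ _)) _.
rewrite -mulrBl normrM (ger0_norm (sqrtr_ge0 i)).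
rewrite le_eqVlt; apply/orP; left; apply/eqP.
by rewrite -[i in RHS]sqr_sqrtr//; ring.
Qed.

Lemma norm_mul_le (R : realType) (a b : R) : `|a| * `|b| <= a ^+ 2 + b ^+ 2.
Proof.
rewrite -(real_normK (num_real a)) -(real_normK (num_real b)).
have := sqr_ge0 (`|a| - `|b|).
have -> : (`|a| - `|b|) ^+ 2 = `|a| ^+ 2 + `|b| ^+ 2 - 2 * (`|a| * `|b|) by ring.
have := sqr_ge0 `|a|; have := sqr_ge0 `|b|; lra.
Qed.

Lemma rate_cvg (R : realType) (F : R -> R) (l C t0 : R) :
  (forall t, t0 <= t -> `|F t - l| <= C / Num.sqrt t) ->
  F t @[t --> +oo] --> l.
Proof.
move=> HF; apply/cvgrPdist_le => e e0.
exists (`|t0| + 1 + (`|C| / e) ^+ 2); split; first exact: num_real.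
move=> t Ht; have := ler_norm t0; have := sqr_ge0 (`|C| / e).
have n0 := normr_ge0 t0 => h1 h2.
have t0t : t0 <= t by lra.
have tgt0 : 0 < t by lra.
have q0 : 0 < Num.sqrt t by rewrite sqrtr_gt0.
rewrite distrC; apply: le_trans (HF t t0t) _; rewrite ler_pdivrMr//.
apply: le_trans (ler_norm C) _; rewrite -ler_pdivrMl// mulrC.
have c0 : 0 <= `|C| / e by rewrite divr_ge0// ltW.
rewrite -(ger0_norm c0) -sqrtr_sqr ler_sqrt ?(ltW tgt0)//; lra.
Qed.

Lemma expectation_cvg (R : realType) d (T : measurableType d)
    (P : probability T R) (Y : R -> T -> R) (l t0 : R) :
  (forall t, t0 <= t -> bmf (Y t)) ->
  Ex P (Y t) @[t --> +oo] --> l -> 'E_P[Y t]%E @[t --> +oo%R] --> l%:E.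
Proof.
move=> bY cY; apply: cvg_EFin.
  exists t0; split; first exact: num_real.
  by move=> t /ltW /bY bYt; rewrite expectationE.
apply: cvg_trans cY; apply: near_eq_cvg; exists t0; split; first exact: num_real.
by move=> t /ltW /bY bYt; rewrite /= expectationE.
Qed.

(** * Weighted averages *)

Section WeightedAverages.
Context {R : realType} {S : finType}.
Variables (M : S -> S -> R) (pi wt g : S -> R) (m : R).
Hypothesis rev : reversible_generator M pi.
Hypothesis wt0 : forall x, 0 < wt x.
Let h x := wt x * (g x - m).
Let pw := \sum_x wt x * pi x.
Hypothesis h0 : \sum_x h x * pi x = 0.
Variable chi : S -> R.
Hypothesis chiE : forall x, \sum_z M x z * chi z = - h x.
Context d (T : measurableType d) (P : probability T R).
Variables (nu : S -> R) (X : R -> T -> S).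
Hypothesis hX : is_markov_chain P M nu X.
Local Notation v := (asymptotic_variance pi h chi).
Local Notation W t w := (path_integral X h t w / Num.sqrt t).
Local Notation U t w := (Num.sqrt t * (weighted_average X wt g t w - m)).

Lemma pw_gt0 : 0 < pw.
Proof.
(* A probability space is nonempty, and so is S, through any value of the chain. *)
have T0 : [set: T] !=set0.
  apply/set0P/eqP => TE; have := @probability_setT _ _ _ P.
  by rewrite TE measure0 => /esym/eqP; rewrite onee_eq0.
have [w _] := T0; rewrite /pw (bigD1 (X 0 w))//= ltr_pwDl//.
  by rewrite mulr_gt0// (rev_pos rev).
by apply: sumr_ge0 => x _; rewrite mulr_ge0 ?ltW// (rev_pos rev).
Qed.

Lemma weighted_average_sub t w : 0 < t ->
  weighted_average X wt g t w - m =
  path_integral X h t w / path_integral X wt t w.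
Proof.
move=> t0; have [dl dl0 dlP] := fin_lower_bound wt0.
have B0 : 0 < path_integral X wt t w.
  by apply: lt_le_trans (path_integral_ge hX w t0 dlP); rewrite mulr_gt0.
rewrite /weighted_average.
have -> : path_integral X (fun x => wt x * g x) t w =
    path_integral X h t w + m * path_integral X wt t w.
  rewrite -(path_integral_lin hX); congr (path_integral X _ t w).
  by apply/funext => x; rewrite /h; ring.
by field; rewrite gt_eqF.
Qed.

Lemma weighted_average_lln :
  {ae P, forall w, weighted_average X wt g t w @[t --> +oo] --> m}.
Proof.
have [dl dl0 dlP] := fin_lower_bound wt0.
apply: filterS (path_integral_lln rev hX h0) => w cw.
have c1 : (weighted_average X wt g t w - m) @[t --> +oo] --> 0.
  apply/cvgrPdist_le => e e0.
  have /cvgrPdist_le /(_ (e * dl) (mulr_gt0 e0 dl0)) [A [_ HA]] := cw.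
  exists (`|A| + 1); split; first exact: num_real.
  move=> t At; have t0 : 0 < t by have := normr_ge0 A; lra.
  have /HA : A < t by have := ler_norm A; lra.
  rewrite /= !sub0r !normrN weighted_average_sub// => hN.
  have Bt := path_integral_ge hX w t0 dlP.
  have B0 : 0 < path_integral X wt t w.
    by apply: lt_le_trans Bt; rewrite mulr_gt0.
  move: hN; rewrite !normrM !normfV (gtr0_norm t0) (gtr0_norm B0).
  rewrite !ler_pdivrMr// => hN; apply: le_trans hN _.
  by rewrite -mulrA ler_wpM2l// ltW.
have c2 : (weighted_average X wt g t w - m) + m @[t --> +oo] --> m.
  by rewrite -[X in _ --> X]add0r; apply: cvgD c1 _; exact: cvg_cst.
by apply: cvg_trans c2; apply: near_eq_cvg; apply: nearW => t; rewrite subrK.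
Qed.

Lemma bmf_W t : 0 < t -> bmf (fun w => W t w).
Proof.
move=> t0; have [L _ hL] := fin_bound h.
by under eq_fun do rewrite mulrC; apply/bmfZ/(bmf_path_integral hX hL t0).
Qed.

Lemma bmf_U t : 0 < t -> bmf (fun w => U t w).
Proof.
move=> t0; have [dl dl0 dlP] := fin_lower_bound wt0.
have [L L0 hL] := fin_bound h; have [Lw _ hLw] := fin_bound wt.
have bN := bmf_path_integral hX hL t0; have [mN _] := bN.
have [mB _] := bmf_path_integral hX hLw t0.
have Bt w := path_integral_ge hX w t0 dlP.
have dt0 : 0 < dl * t by rewrite mulr_gt0.
apply: bmfZ; under eq_fun do rewrite weighted_average_sub//.
apply: bmfM => //; apply: (@bmf_bound _ _ _ _ (dl * t)^-1).
  (* Inversion is made continuous everywhere by cutting at dl t, a lower bound of the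
     denominator. *)
  rewrite (_ : (fun w => _) =
      (fun z => (Num.max z (dl * t))^-1) \o path_integral X wt t).
    apply: measurableT_comp mB; apply: continuous_measurable_fun => z.
    apply: cvgV.
      by rewrite gt_eqF// lt_max dt0 orbT.
    by apply: (@continuous_max _ _ id (cst (dl * t))); [exact: cvg_id|exact: cvg_cst].
  by apply/funext => w /=; rewrite max_l.
move=> w; rewrite normfV gtr0_norm; last exact: lt_le_trans (Bt w).
by rewrite lef_pV2// posrE; apply: lt_le_trans (Bt w).
Qed.

(** Write U = W Q with Q = t / B_t <= 1 / dl. The deviation of Q from 1 / pw is - Q Z / (pw sqrt t),
    where Z is the normalised fluctuation of B and has bounded moments, so each replacement of Q by
    1 / pw gains 1 / sqrt t. *)
Lemma weighted_average_estimates : exists C t0 : R, [/\ 0 <= C, 1 <= t0 &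
  forall t, t0 <= t ->
    [/\ Ex P (fun w => (pw * U t w) ^+ 2) <= C,
        Ex P (fun w => `|pw * U t w - W t w|) <= C / Num.sqrt t &
        `|Ex P (fun w => U t w ^+ 2) - pw^-1 ^+ 2 * Ex P (fun w => W t w ^+ 2)|
          <= C / Num.sqrt t]].
Proof.
have [dl dl0 dlP] := fin_lower_bound wt0; have p0 := pw_gt0.
pose h2 x := wt x - pw.
have h20 : \sum_x h2 x * pi x = 0.
  under eq_bigr do rewrite mulrBl.
  by rewrite sumrB -mulr_sumr (rev_sum rev) mulr1 subrr.
have [chi2 chi2E] := poisson rev h20.
have [C1 [t1 [C10 t11 H1]]] := moment_bound rev chiE hX.
have [C2 [t2 [C20 t21 H2]]] := moment_bound rev chi2E hX.
have idl0 : 0 < dl^-1 by rewrite invr_gt0.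
pose A1 := (pw * dl^-1) ^+ 2 * C1.
pose A2 := dl^-1 * (C1 + C2).
pose A3 := (pw^-1 * dl^-1) * (dl^-1 + pw^-1) * (C1 + C2).
have A10 : 0 <= A1 by rewrite mulr_ge0// sqr_ge0.
have A20 : 0 <= A2 by apply: mulr_ge0; [exact: ltW|exact: addr_ge0].
have ip0 : 0 < pw^-1 by rewrite invr_gt0.
have A30 : 0 <= A3.
  apply: mulr_ge0; last exact: addr_ge0.
  by apply: mulr_ge0; [apply: mulr_ge0; exact: ltW|apply: addr_ge0; exact: ltW].
have [l0 l1 l2 l3] : [/\ 0 <= A1 + A2 + A3, A1 <= A1 + A2 + A3,
    A2 <= A1 + A2 + A3 & A3 <= A1 + A2 + A3].
  by move: A1 A2 A3 A10 A20 A30 => x y z *; split; lra.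
exists (A1 + A2 + A3), (t1 + t2); split=> //; first lra.
move=> t tt; have t0 : 0 < t by lra.
have [EW2 EW4] := H1 t ltac:(lra); have [EZ2 _] := H2 t ltac:(lra).
set q := Num.sqrt t in EW2 EW4 EZ2 *.
have q0 : 0 < q by rewrite sqrtr_gt0.
have q2 : q ^+ 2 = t by rewrite sqr_sqrtr// ltW.
pose Z w := path_integral X h2 t w / q.
pose Q w := t / path_integral X wt t w.
have Bt w := path_integral_ge hX w t0 dlP.
have B0 w : 0 < path_integral X wt t w.
  by apply: lt_le_trans (Bt w); rewrite mulr_gt0.
have Q0 w : 0 <= Q w by rewrite divr_ge0// ltW.
have Qdl w : Q w <= dl^-1.
  by rewrite ler_pdivrMr// mulrC ler_pdivlMr// mulrC.
have UE w : U t w = W t w * Q w.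
  rewrite weighted_average_sub// /Q -/q; move: (B0 w).
  move: (path_integral X wt t w) (path_integral X h t w) => Bw Nw Bw0.
  by rewrite -q2; field; rewrite !gt_eqF.
have BE w : path_integral X wt t w = t * pw + q * Z w.
  rewrite /Z [q * _]mulrC divfK ?gt_eqF//.
  have -> : h2 = (fun x => wt x + - 1 * pw) by apply/funext => x; rewrite mulN1r.
  rewrite (path_integral_lin hX wt (fun=> pw)) path_integral_cst//; ring.
have QE w : Q w - pw^-1 = - (pw^-1 * Q w * Z w / q).
  have B0' : t * pw + q * Z w != 0 by rewrite -BE gt_eqF.
  rewrite /Q BE; move: (Z w) B0' => z; rewrite -q2 => B0'.
  by field; rewrite B0' !gt_eqF.
have bW : bmf (fun w => W t w) := bmf_W t0.
have bU : bmf (fun w => U t w) := bmf_U t0.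
have bZ : bmf Z.
  have [L _ hL] := fin_bound h2.
  by rewrite /Z; under eq_fun do rewrite mulrC; apply/bmfZ/(bmf_path_integral hX hL t0).
have qpos : 0 <= q^-1 by rewrite invr_ge0 ltW.
have le_main A : A <= A1 + A2 + A3 -> A / q <= (A1 + A2 + A3) / q.
  by move=> le; rewrite ler_wpM2r.
split.
- apply: (@le_trans _ _ A1) => //.
  apply: (@le_trans _ _ (Ex P (fun w => (pw * dl^-1) ^+ 2 * W t w ^+ 2))).
    apply: Ex_le => [||w]; first by apply/bmfX/bmfZ.
      by apply/bmfZ/bmfX.
    rewrite UE; move: (W t w) (Q w) (Q0 w) (Qdl w) => a u u0 udl.
    have -> : (pw * (a * u)) ^+ 2 = (pw * u) ^+ 2 * a ^+ 2 by ring.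
    apply: ler_wpM2r; first exact: sqr_ge0.
    have pu : 0 <= pw * u by apply: mulr_ge0 => //; exact: ltW.
    have pd : 0 <= pw * dl^-1 by apply: mulr_ge0; exact: ltW.
    by rewrite lerXn2r ?nnegrE//; apply: ler_wpM2l => //; exact: ltW.
  by rewrite ExZ ?ler_wpM2l ?sqr_ge0//; exact: bmfX.
- apply: le_trans (le_main A2 l2).
  apply: (@le_trans _ _ (Ex P (fun w => dl^-1 / q * (W t w ^+ 2 + Z w ^+ 2)))).
    apply: Ex_le => [||w].
    + by apply/bmf_norm/bmfB => //; apply: bmfZ.
    + by apply/bmfZ/bmfD; apply: bmfX.
    have -> : pw * U t w - W t w = W t w * (pw * (Q w - pw^-1)).
      by rewrite UE mulrBr mulfV ?gt_eqF//; ring.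
    have -> : pw * (Q w - pw^-1) = - (Q w * Z w / q).
      by rewrite QE; field; rewrite !gt_eqF.
    move: (W t w) (Z w) (Q w) (Q0 w) (Qdl w) => a b u u0 udl.
    rewrite !(normrM, normrN) (ger0_norm u0) (ger0_norm qpos).
    have ab := norm_mul_le a b.
    have -> : `|a| * (u * `|b| * q^-1) = (u / q) * (`|a| * `|b|) by ring.
    by apply: ler_pM => //; [exact: mulr_ge0|exact: ler_wpM2r].
  rewrite ExZ; last by apply: bmfD; apply: bmfX.
  rewrite ExD; [|exact: bmfX|exact: bmfX].
  have -> : A2 / q = dl^-1 / q * (C1 + C2) by rewrite /A2; ring.
  by apply: ler_wpM2l; [rewrite mulr_ge0// ltW|apply: lerD].
- apply: le_trans (le_main A3 l3).
  rewrite -ExZ; last exact: bmfX.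
  rewrite -ExB; [|exact: bmfX|by apply/bmfZ/bmfX].
  have bD : bmf (fun w => U t w ^+ 2 - pw^-1 ^+ 2 * W t w ^+ 2).
    by apply: bmfB; [exact: bmfX|by apply/bmfZ/bmfX].
  apply: le_trans (Ex_norm P bD) _.
  pose k := pw^-1 * dl^-1 * (dl^-1 + pw^-1).
  apply: (@le_trans _ _ (Ex P (fun w => k / q * (W t w ^+ 4 + Z w ^+ 2)))).
    apply: Ex_le => [||w]; first exact: bmf_norm.
      by apply/bmfZ/bmfD; apply: bmfX.
    have -> : U t w ^+ 2 - pw^-1 ^+ 2 * W t w ^+ 2 =
        W t w ^+ 2 * ((Q w - pw^-1) * (Q w + pw^-1)) by rewrite UE; ring.
    rewrite QE; move: (W t w) (Z w) (Q w) (Q0 w) (Qdl w) => a b u u0 udl.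
    have s0 : 0 <= u + pw^-1 by apply: addr_ge0 => //; exact: ltW.
    have ipQ : 0 <= pw^-1 * u by apply: mulr_ge0 => //; exact: ltW.
    pose c := pw^-1 * u * (u + pw^-1) / q.
    have c0 : 0 <= c by apply: mulr_ge0 => //; apply: mulr_ge0.
    have -> : a ^+ 2 * (- (pw^-1 * u * b / q) * (u + pw^-1)) = - (c * (a ^+ 2 * b)).
      by rewrite /c; ring.
    rewrite normrN [leLHS]normrM (ger0_norm c0) [X in c * X]normrM.
    rewrite (ger0_norm (sqr_ge0 a)).
    (* Here the fourth moment of W enters, to control W^2 |Z|. *)
    have ab : a ^+ 2 * `|b| <= a ^+ 4 + b ^+ 2.
      have := norm_mul_le (a ^+ 2) b.
      by rewrite (ger0_norm (sqr_ge0 a)) -exprM.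
    apply: ler_pM => //; first by rewrite mulr_ge0 ?sqr_ge0.
    rewrite /c ler_wpM2r// /k; apply: ler_pM => //; last by rewrite lerD2r.
    by rewrite ler_wpM2l// ltW.
  rewrite ExZ; last by apply: bmfD; apply: bmfX.
  rewrite ExD; [|exact: bmfX|exact: bmfX].
  have -> : A3 / q = k / q * (C1 + C2) by rewrite /A3 /k; ring.
  apply: ler_wpM2l; last exact: lerD.
  apply: mulr_ge0 => //.
  by apply: mulr_ge0; [apply: mulr_ge0; exact: ltW|apply: addr_ge0; exact: ltW].
Qed.

Lemma path_second_moment : second_moment_cvg P (fun t w => W t w) v.
Proof.
have [C [t0 [C0 t01 HC]]] := second_moment_rate rev chiE hX.
apply: (@expectation_cvg _ _ _ P _ _ t0 _ (rate_cvg HC)) => t tt.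
have tgt0 : 0 < t by apply: lt_le_trans ltr01 (le_trans t01 tt).
exact: (bmfX 2 (bmf_W tgt0)).
Qed.

Lemma weighted_second_moment :
  second_moment_cvg P (fun t w => U t w) (pw^-1 ^+ 2 * v).
Proof.
have [C [t0 [C0 t01 HC]]] := second_moment_rate rev chiE hX.
have [D [t1 [D0 t11 HD]]] := weighted_average_estimates.
have rate t : t0 + t1 <= t ->
    `|Ex P (fun w => U t w ^+ 2) - pw^-1 ^+ 2 * v| <=
    (D + pw^-1 ^+ 2 * C) / Num.sqrt t.
  move=> tt; have [_ _ h1] := HD t ltac:(lra); have h2 := HC t ltac:(lra).
  have -> : Ex P (fun w => U t w ^+ 2) - pw^-1 ^+ 2 * v =
    (Ex P (fun w => U t w ^+ 2) - pw^-1 ^+ 2 * Ex P (fun w => W t w ^+ 2)) +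
    pw^-1 ^+ 2 * (Ex P (fun w => W t w ^+ 2) - v) by ring.
  apply: le_trans (ler_normD _ _) _; rewrite mulrDl; apply: lerD => //.
  rewrite normrM (ger0_norm (sqr_ge0 pw^-1)) -[leRHS]mulrA.
  by apply: ler_wpM2l; first exact: sqr_ge0.
apply: (@expectation_cvg _ _ _ P _ _ t0 _ (rate_cvg rate)) => t tt.
have tgt0 : 0 < t by lra.
exact: (bmfX 2 (bmf_U tgt0)).
Qed.

Lemma integral_scaled_law (G : probability (measurableTypeR R) R) (a : R)
    (f : R -> R) : continuous f -> (exists C, forall x, `|f x| <= C) ->
  (\int[scaled_law a G]_x (f x)%:E)%E =
  (Ex G (fun z : measurableTypeR R => f (a * z)))%:E.
Proof.
move=> cf [C fC]; have mf := continuous_measurable_fun cf.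
have ma : measurable_fun setT (fun z : measurableTypeR R => a * z : measurableTypeR R).
  exact: measurable_funM.
have bf : bmf (fun z : measurableTypeR R => f (a * z)).
  apply: (@bmf_bound _ (measurableTypeR R) R _ C) => //.
  exact: measurableT_comp mf ma.
have := expectationE G bf; rewrite unlock => <-.
rewrite /scaled_law integral_pushforward//.
- by apply/measurable_EFinP.
- exact: bmf_integrable bf.
Qed.

(** The variable pw U is close to W in mean, so the Lipschitz bound hands it the Gaussian rate of W.
    The factor 1 / pw is then restored by rescaling the test function. *)
Lemma weighted_average_clt : cvg_in_distribution P (fun t w => U t w)
  (scaled_law pw^-1 (gaussian v)).
Proof.
have v0 : 0 <= v := asymptotic_variance_ge0 rev chiE.
have [G -> EG] := gaussian_law v0; have p0 := pw_gt0.
move=> f cf bf; rewrite integral_scaled_law//.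
have [C [t1 [C0 t11 HC]]] := weighted_average_estimates.
pose V t w := pw * U t w.
have hV t : t1 <= t -> bmf (V t) /\ Ex P (fun w => V t w ^+ 2) <= C.
  move=> tt; have [h1 _ _] := HC t tt; split=> //.
  by apply: bmfZ; apply: bmf_U; lra.
have hG b : 0 < b -> exists C t0 : R, 0 <= C /\
  forall t a : R, t0 <= t ->
    `|Ex P (fun w => gauss_kernel b^-1 (V t w - a)) -
      Ex G (fun z : R => gauss_kernel b^-1 (z - a))| <= C / Num.sqrt t.
  move=> b0; have [K [K0 HK]] := gauss_clt_rate rev chiE hX b0.
  have ib : 0 <= b^-1 by rewrite invr_ge0 ltW.
  exists (18 * b^-1 * C + K), t1; split.
    by rewrite addr_ge0// !mulr_ge0.
  move=> t a tt; have t1' : 1 <= t by lra.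
  have t0 : 0 < t by lra.
  have [_ h2 _] := HC t tt; rewrite EG//.
  have bV := (hV t tt).1; have bWt := bmf_W t0.
  have [mV _] := bV; have [mW _] := bWt.
  have bgV := bmf_gauss_kernel b^-1 a mV; have bgW := bmf_gauss_kernel b^-1 a mW.
  have bVW : bmf (fun w => `|V t w - W t w|) by apply/bmf_norm/bmfB.
  have e1 : `|Ex P (fun w => gauss_kernel b^-1 (V t w - a)) -
      Ex P (fun w => gauss_kernel b^-1 (W t w - a))| <= 18 * b^-1 * C / Num.sqrt t.
    rewrite -ExB//; apply: le_trans (Ex_norm P (bmfB bgV bgW)) _.
    apply: (@le_trans _ _ (Ex P (fun w => 18 * b^-1 * `|V t w - W t w|))).
      apply: Ex_le => [||w]; [exact/bmf_norm/bmfB|exact: bmfZ|].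
      have := gauss_kernel_lipschitz (V t w - a) (W t w - a) ib.
      by rewrite opprB addrA subrK.
    by rewrite ExZ// -[leRHS]mulrA ler_wpM2l// mulr_ge0.
  have e2 := HK t a t1'.
  have -> : Ex P (fun w => gauss_kernel b^-1 (V t w - a)) - gauss_kernel (b + v)^-1 a =
    (Ex P (fun w => gauss_kernel b^-1 (V t w - a)) -
     Ex P (fun w => gauss_kernel b^-1 (W t w - a))) +
    (Ex P (fun w => gauss_kernel b^-1 (W t w - a)) - gauss_kernel (b + v)^-1 a).
    by ring.
  by apply: le_trans (ler_normD _ _) _; rewrite mulrDl; apply: lerD.
have cfa : continuous (fun z => f (pw^-1 * z)).
  move=> z; apply: (@continuous_cvg _ _ _ _ _ _ f); first exact: cf.
  by apply: cvgMl_tmp; exact: cvg_id.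
have bfa : exists C, forall x, `|f (pw^-1 * x)| <= C.
  by have [A HA] := bf; exists A.
have := weak_cvg hV hG cfa bfa.
under [X in X @ _ --> _ -> _]eq_fun do under [X in Ex _ X]eq_fun do
  rewrite /V mulKf ?gt_eqF//.
apply: (@expectation_cvg _ _ _ P _ _ t1) => t tt; apply: (bmf_continuous cf).
by apply: bmf_U; apply: lt_le_trans ltr01 (le_trans t11 tt).
Qed.

End WeightedAverages.

(** * The modified landscape *)

Section Landscape.
Context {R : realType} {S : finType}.
Variables (H : S -> R) (f : R -> R) (c alpha : R).
Local Notation K := (modified_H f alpha c H).
Local Notation wt := (weight f alpha c H).

Lemma Hmin_le x : Hmin H <= H x.
Proof.
apply: ge_inf; last by exists x.
exists (- \sum_y `|H y|) => _ [y _ <-]; rewrite lerNl.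
apply: le_trans (ler_norm _) _; rewrite normrN (bigD1 y)//= lerDl.
exact: sumr_ge0.
Qed.

Lemma weight_gt0 x : 0 < wt x.
Proof. by rewrite divr_gt0 ?expR_gt0. Qed.

(** Importance weighting: the modified Boltzmann factor cancels and the original one is left. *)
Lemma weight_gibbs x :
  wt x * gibbs K x = expR (- (H x - Hmin H)) / Zmod f alpha c H.
Proof. by rewrite /weight /gibbs mulrA divfK// gt_eqF ?expR_gt0. Qed.

Lemma gibbs_shift x : gibbs H x = expR (- (H x - Hmin H)) / Z0 H.
Proof.
rewrite /gibbs /Z0.
have e y : expR (- (H y - Hmin H)) = expR (Hmin H) * expR (- H y).
  by rewrite -expRD opprB.
rewrite e; under [in RHS]eq_bigr do rewrite e.
by rewrite -mulr_sumr -mulf_div divff ?mul1r// gt_eqF ?expR_gt0.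
Qed.

Lemma Zmod_gt0 (x0 : S) : 0 < Zmod f alpha c H.
Proof. exact: gibbs_sum_gt0 x0. Qed.

Lemma Z0_gt0 (x0 : S) : 0 < Z0 H.
Proof.
by rewrite /Z0 (bigD1 x0)//= ltr_pwDl ?expR_gt0// sumr_ge0.
Qed.

Lemma mean_weight : \sum_x wt x * gibbs K x = Z0 H / Zmod f alpha c H.
Proof. by under eq_bigr do rewrite weight_gibbs; rewrite -mulr_suml. Qed.

(** Weighting turns the modified Gibbs law into a multiple of mu, for which g - mu(g) is centred. *)
Lemma mean_weighted_centered (g : S -> R) (x0 : S) :
  \sum_x wt x * (g x - mean (gibbs H) g) * gibbs K x = 0.
Proof.
have Z00 := Z0_gt0 x0.
have -> : \sum_x wt x * (g x - mean (gibbs H) g) * gibbs K x =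
    Z0 H / Zmod f alpha c H * \sum_x (g x - mean (gibbs H) g) * gibbs H x.
  rewrite mulr_sumr; apply: eq_bigr => x _.
  rewrite mulrAC weight_gibbs gibbs_shift; field.
  by rewrite !gt_eqF ?(Zmod_gt0 x0).
under eq_bigr do rewrite mulrBl.
rewrite sumrB -mulr_sumr -/(mean _ g).
have -> : \sum_x gibbs H x = 1.
  by under eq_bigr do rewrite gibbs_shift; rewrite -mulr_suml divff// gt_eqF.
by rewrite mulr1 subrr mulr0.
Qed.

Hypothesis classical : (forall y, 0 <= y -> f y = 0) \/ alpha = 0.

Lemma modified_H_classical x : K x = H x - Hmin H.
Proof.
rewrite /modified_H; under eq_Rintegral => u _.
  have -> : alpha * f (pos_part (u - c)) = 0.
    case: classical => [f0|->]; last by rewrite mul0r.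
    by rewrite f0 ?mulr0// /pos_part le_max lexx orbT.
  rewrite add0r invr1; over.
rewrite Rintegral_cst// mul1r /= lebesgue_measure_itv /= lte_fin.
have := Hmin_le x; rewrite le_eqVlt => /predU1P[->|lt].
  by rewrite ltxx subrr.
by rewrite lt -EFinB.
Qed.

Lemma weight_classical x : wt x = 1.
Proof. by rewrite /weight modified_H_classical divff// gt_eqF ?expR_gt0. Qed.

Lemma mh_generator_classical (Q : S -> S -> R) x y :
  mh_generator Q K x y = mh_generator Q H x y.
Proof.
have e u z : mh_rate Q K u z = mh_rate Q H u z.
  rewrite /mh_rate !modified_H_classical; congr (_ * expR (- pos_part _)); ring.
by rewrite /mh_generator e; under eq_bigr do rewrite e.
Qed.

Lemma ratio_classical (x0 : S) : Zmod f alpha c H / Z0 H = 1.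
Proof.
rewrite /Zmod (eq_bigr (fun x => expR (- (H x - Hmin H)))) => [|x _].
  by rewrite divff// gt_eqF// (Z0_gt0 x0).
by rewrite modified_H_classical.
Qed.

End Landscape.

Theorem theorem4p2 (R : realType) (S : finType) (H : S -> R)
  (Q : S -> S -> R) (f : R -> R) (c alpha : R) (g : S -> R)
  (hQ : is_generator Q) (hQsym : is_symmetric Q) (hQirr : is_irreducible Q)
  (hf : admissible f) (hc : Hmin H <= c <= Hmax H) (halpha : 0 <= alpha)
  (* the chain, with an arbitrary initial law nu *)
  (d : measure_display) (T : measurableType d) (P : probability T R)
  (nu : S -> R) (X : R -> T -> S)
  (hX : is_markov_chain P (mh_generator Q (modified_H f alpha c H)) nu X)
  (* the same chain with initial law mu; its expectation is E_mu *)
  (d' : measure_display) (T' : measurableType d') (Pmu : probability T' R)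
  (Y : R -> T' -> S)
  (hY : is_markov_chain Pmu (mh_generator Q (modified_H f alpha c H))
          (gibbs H) Y) :
  let wt := weight f alpha c H in
  let m := mean (gibbs H) g in
  let ratio := Zmod f alpha c H / Z0 H in
  (\forall w \ae P, weighted_average X wt g t w @[t --> +oo%R] --> m)
  /\
  exists v : R,
    [/\ 0 <= v,
        (* v is the limiting variance *)
        second_moment_cvg Pmu
          (fun t w => path_integral Y (fun x => wt x * (g x - m)) t w
                        / Num.sqrt t) v,
        (* and it normalises the mean squared error of the weighted average *)
        second_moment_cvg Pmu
          (fun t w => Num.sqrt t * (weighted_average Y wt g t w - m))
          (ratio ^+ 2 * v),
        cvg_in_distribution P
          (fun t w => Num.sqrt t * (weighted_average X wt g t w - m))
          (scaled_law ratio (gaussian v)) &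
        (* the classical case *)
        (forall y, 0 <= y -> f y = 0) \/ alpha = 0 ->
        [/\ forall x, wt x = 1,
            forall x y, mh_generator Q (modified_H f alpha c H) x y
                        = mh_generator Q H x y,
            \forall w \ae P,
              path_integral X g t w / t @[t --> +oo%R] --> m,
            second_moment_cvg Pmu
              (fun t w => Num.sqrt t * (path_integral Y g t w / t - m)) v &
            cvg_in_distribution P
              (fun t w => Num.sqrt t * (path_integral X g t w / t - m))
              (gaussian v)]].
Proof.
move=> wt m ratio.
have [x0 _] : exists x0 : S, True.
  have [w _] : [set: T] !=set0.
    apply/set0P/eqP => TE; have := @probability_setT _ _ _ P.
    by rewrite TE measure0 => /esym/eqP; rewrite onee_eq0.
  by exists (X 0 w).
have rev := mh_reversible (modified_H f alpha c H) x0 hQ hQsym hQirr.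
have wt0 : forall x, 0 < wt x by exact: weight_gt0.
have h0 := mean_weighted_centered H f c alpha g x0.
have [chi chiE] := poisson rev h0.
have ratioE : (\sum_x wt x * gibbs (modified_H f alpha c H) x)^-1 = ratio.
  by rewrite mean_weight invf_div.
have lln := weighted_average_lln rev wt0 h0 hX.
have clt := weighted_average_clt rev wt0 chiE hX.
(* The same corrector serves both initial laws, so a single v governs the second moments under mu
   and the limit law under [nu]. *)
have second := path_second_moment rev chiE hY.
have wsecond := weighted_second_moment rev wt0 chiE hY.
rewrite ratioE in clt wsecond.
split; first exact: lln.
exists (asymptotic_variance (gibbs (modified_H f alpha c H))
  (fun x => wt x * (g x - m)) chi).
have v0 := asymptotic_variance_ge0 rev chiE.
split=> // cl.
have wt1 x : wt x = 1 := weight_classical H c cl x.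
have r1 := ratio_classical H c cl x0.
(* With unit weights the denominator is the elapsed time, so for t > 0 the classical statements are
   the weighted ones. *)
have WE (d1 : measure_display) (T1 : measurableType d1) (Z : R -> T1 -> S) t w :
    0 < t -> weighted_average Z wt g t w = path_integral Z g t w / t.
  move=> t0; rewrite /weighted_average; congr (_ / _).
    by congr (path_integral Z _ t w); apply/funext => x; rewrite wt1 mul1r.
  rewrite (_ : wt = fun=> 1); last by apply/funext => x; rewrite wt1.
  by rewrite path_integral_cst// mul1r.
split=> //.
- by move=> x y; apply: mh_generator_classical.
- apply: filterS lln => w; apply: cvg_trans; apply: near_eq_cvg.
  by exists 0; split; [exact: num_real|move=> t t0; rewrite WE].
- move: wsecond; rewrite /ratio r1 expr1n mul1r; apply: cvg_trans.
  apply: near_eq_cvg; exists 0; split; first exact: num_real.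
  by move=> t t0 /=; congr ('E_Pmu[_])%E; apply/funext => w; rewrite WE.
- move=> phi cphi bphi; have := clt phi cphi bphi.
  have [G GE _] := gaussian_law v0.
  rewrite GE integral_scaled_law// /ratio r1.
  rewrite (_ : (fun z => phi (1 * z)) = phi); last first.
    by apply/funext => z; rewrite mul1r.
  have bG : bmf (phi : measurableTypeR R -> R).
    have [C phiC] := bphi; apply: (@bmf_bound _ (measurableTypeR R) R _ C) => //.
    exact: continuous_measurable_fun.
  have GphiE : 'E_G[phi]%E = (Ex G phi)%:E by exact: expectationE.
  rewrite unlock in GphiE; rewrite GphiE; apply: cvg_trans.
  apply: near_eq_cvg; exists 0; split; first exact: num_real.
  by move=> t t0 /=; congr ('E_P[_])%E; apply/funext => w; rewrite WE.
Qed.
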